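(* If $f\in\mathscr F$, $\gamma\in(0,1/3)$ and (A2), (A3), (A4) hold, then, as $n\to\infty$, $$n^{1/2}\bigl(\tilde d_n^{(2)\star}-\tilde d_n^{(2)}\bigr)\stackrel{d^\star}{\to}C_2Z_1\quad(P\text{-a.s.}),$$ where $C_2=\sigma/[f'(d_0)(1-p)^{1/2}]$ and $Z_1$ is standard normal. That is, $$\sup_{t\in\mathbb R}\Bigl|P^\star\bigl(n^{1/2}(\tilde d_n^{(2)\star}-\tilde d_n^{(2)})\le t\bigr)-P(C_2Z_1\le t)\Bigr|\to0\quad P\text{-almost surely}.$$
   Context: Let $d_0\in(0,1)$, $f:[0,1]\to\mathbb R$ and $\theta_0=f(d_0)$. $\mathscr F_0$: increasing real functions on $[0,1]$ with positive and continuous first derivative in a neighborhood of $d_0$. $\mathscr F$: those $f\in\mathscr F_0$ whose third derivative exists and is uniformly bounded in a neighborhood of $d_0$. Probabilistic setting. For each sample size $m$ there are deterministic distinct design points $x_1<\dots<x_m$ in $[0,1]$ (a triangular array; the $x_i$ depend on $m$), with empirical distribution function $F_m$. $\varepsilon$ is a continuous real random variable with mean $0$ and variance $\sigma^2\in(0,\infty)$. On a probability space $(\Omega,\mathscr A,P)$ there are, for every $n$, errors $\{\varepsilon_{in}\}_{i\le n},\{\varepsilon'_{in}\}_{i\le n},\{\varepsilon''_{in}\}_{i\le n}$, all i.i.d. copies of $\varepsilon$ (over all $i$, $n$ and the three families); the index $n$ is suppressed. Assumptions. (A2) There is a distribution function $G$ whose Lebesgue density $g$ is positive and has a bounded first derivative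 on $[0,1]$, and a constant $c$ with $\sup_{x\in[0,1]}|F_m(x)-G(x)|\le c\,m^{-1/2}$ for all $m$. (A3) $f\in\mathscr F_0$ is differentiable on $[0,1]$ with $\inf_{[0,1]}f'$ and $\sup_{[0,1]}f'$ both positive and finite. (A4) $\mathbb E|\varepsilon|^q<\infty$ for all $q\in\mathbb N$. Isotonic estimator. Given $Y_i=f(x_i)+\varepsilon_i$, $i=1,\dots,m$, $\hat f$ is the least squares fit over nondecreasing functions, determined at the $x_i$ and extended to $[0,1]$ as a right-continuous step function with jumps only at design points ($\hat f(x)=\hat f(x_1)$ for $x<x_1$). Set $\hat d_m^{(1)}=\inf\{x\in[0,1]:\hat f(x)\ge\theta_0\}$, with value $1$ if the set is empty. Two-stage procedure. Fix $p\in(0,1)$, $\gamma>0$, $K>0$. For total budget $n$, let $n_1$ be $\lfloor np\rfloor$ or $\lfloor np\rfloor+1$, whichever makes $n-n_1$ even, and $n_2=(n-n_1)/2$. Stage one: compute $\hat d_{n_1}^{(1)}$ from $n_1$ design points and responses. Put $L=\hat d_{n_1}^{(1)}-Kn_1^{-\gamma}$, $U=\hat d_{n_1}^{(1)}+Kn_1^{-\gamma}$. Stage two: $Y_i'=f(L)+\varepsilon_i'$, $Y_i''=f(U)+\varepsilon_i''$, $i=1,\dots,n_2$ ($f$ extended to $\mathbb R$ in any fixed measurable way). Let $(\hat\beta_0,\hat\beta_1)$ be the least squares intercept and slope from fitting $y=\beta_0+\beta_1x$ to $\{(L,Y_i'),(U,Y_i'')\}_{i\le n_2}$, and $\tilde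 d_n^{(2)}=(\theta_0-\hat\beta_0)/\hat\beta_1$. Bootstrap. Conditionally on the data (on $\omega\in\Omega$), $Y_1'^{\star},\dots,Y_{n_2}'^{\star}$ are drawn i.i.d. uniformly (with replacement) from $\{Y_i'\}_{i\le n_2}$ and, independently, $Y_1''^{\star},\dots,Y_{n_2}''^{\star}$ i.i.d. uniformly from $\{Y_i''\}_{i\le n_2}$. $(\hat\beta_0^\star,\hat\beta_1^\star)$ are the least squares intercept and slope from $\{(L,Y_i'^\star),(U,Y_i''^\star)\}_{i\le n_2}$ and $\tilde d_n^{(2)\star}=(\theta_0-\hat\beta_0^\star)/\hat\beta_1^\star$. (Quotients are defined arbitrarily when the denominator is zero.) $P^\star$ denotes conditional probability given the original data; $\stackrel{d^\star}{\to}$, $(P\text{-a.s.})$ means that for $P$-almost every $\omega$ the conditional distributions given $\omega$ converge weakly. *)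

(* Defs.v *)
From HB Require Import structures.
From mathcomp Require Import all_boot all_order all_algebra.
From mathcomp Require Import all_classical all_reals all_analysis.

Set Implicit Arguments.
Unset Strict Implicit.
Unset Printing Implicit Defensive.
Import Order.TTheory GRing.Theory Num.Theory.
Import numFieldNormedType.Exports.
Local Open Scope classical_set_scope.
Local Open Scope ring_scope.

(* Derivative of the restriction of h to [0, 1]: one-sided at 0 and 1, and
   insensitive to the values of h outside [0, 1]. *)
Definition is_derive01 (R : realType) (h : R -> R) (a l : R) : Prop :=
  (fun y => (h y - h a) / (y - a)) @ within `[0, 1] a^' --> l.

Definition class_F0 (R : realType) (d0 : R) (f : R -> R) : Prop :=
  {in `[0, 1] &, {homo f : a b / a < b}} /\
  \forall a \near d0,
    [/\ derivable f a 1, 0 < derive1 f a & {for a, continuous (derive1 f)}].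

Definition class_F (R : realType) (d0 : R) (f : R -> R) : Prop :=
  class_F0 d0 f /\
  exists M : R, \forall a \near d0,
    (forall k, (k < 3)%N -> derivable (derive1n k f) a 1) /\
    `|derive1n 3 f a| <= M.

(* A design with m points is the family x 0, ..., x m.-1. *)
Definition is_design (R : realType) (m : nat) (x : nat -> R) : Prop :=
  (forall i, (i < m)%N -> 0 <= x i <= 1) /\
  (forall i j, (i < j < m)%N -> x i < x j).

Definition num_le (R : realType) (m : nat) (x : nat -> R) (t : R) : nat :=
  #|[pred i : 'I_m | x i <= t]|.

Definition ecdf (R : realType) (m : nat) (x : nat -> R) (t : R) : R :=
  (num_le m x t)%:R / m%:R.

Definition has_density (R : realType) (G g : R -> R) : Prop :=
  [/\ measurable_fun setT g, (forall t, 0 <= g t),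
      (\int[lebesgue_measure]_t (g t)%:E = 1)%E &
      forall t,
        ((G t)%:E = \int[lebesgue_measure]_(s in `]-oo, t]) (g s)%:E)%E].

Definition assumption_A2 (R : realType) (x : nat -> nat -> R) : Prop :=
  exists G g : R -> R,
    [/\ has_density G g,
        (forall t, t \in `[0, 1] -> 0 < g t),
        (exists dg : R -> R, exists M : R, forall t, t \in `[0, 1] ->
           is_derive01 g t (dg t) /\ `|dg t| <= M) &
        exists c : R, forall m : nat, (0 < m)%N ->
          (ereal_sup [set `|ecdf m (x m) t - G t|%:E | t in `[0%R, 1%R]]
             <= (c / Num.sqrt m%:R)%:E)%E].

Definition assumption_A3 (R : realType) (d0 : R) (f : R -> R) : Prop :=
  class_F0 d0 f /\
  exists df : R -> R,
    [/\ (forall t, t \in `[0, 1] -> is_derive01 f t (df t)),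
        (0 < ereal_inf [set (df t)%:E | t in `[0%R, 1%R]] < +oo)%E &
        (0 < ereal_sup [set (df t)%:E | t in `[0%R, 1%R]] < +oo)%E].

Definition assumption_A4 d (T : measurableType d) (R : realType)
    (Q : probability T R) (e : {RV Q >-> R}) : Prop :=
  forall q : nat, ('E_Q[fun w => (`|e w| ^+ q)%R] < +oo)%E.

Definition mutually_independent d (T : measurableType d) (R : realType)
    (P : probability T R) (I : eqType) (D : set I)
    (X : I -> {RV P >-> R}) : Prop :=
  forall (s : seq I) (B : I -> set R), uniq s -> (forall i, i \in s -> D i) ->
    (forall i, measurable (B i)) ->
    P (\bigcap_(i in [set` s]) (X i @^-1` B i)) =
      (\prod_(i <- s) P (X i @^-1` B i))%E.

Definition errors d (T : measurableType d) (R : realType)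
    (P : probability T R) (eps eps' eps'' : nat -> nat -> {RV P >-> R})
    (j : 'I_3 * nat * nat) : {RV P >-> R} :=
  nth eps [:: eps; eps'; eps''] j.1.1 j.1.2 j.2.

(* In an index (k, n, i), k is the family, n the budget and i < n. *)
Definition iid_copies dE (TE : measurableType dE) d (T : measurableType d)
    (R : realType) (Q : probability TE R) (e : {RV Q >-> R})
    (P : probability T R) (eps eps' eps'' : nat -> nat -> {RV P >-> R})
    : Prop :=
  let D := [set j : 'I_3 * nat * nat | (j.2 < j.1.2)%N] in
  mutually_independent D (errors eps eps' eps'') /\
  forall j, D j -> forall B : set R, measurable B ->
    distribution P (errors eps eps' eps'' j) B = distribution Q e B.

Definition nondecreasing01 (R : realType) (h : R -> R) : Prop :=
  {in `[0, 1] &, {homo h : a b / a <= b}}.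

Definition sum_sq (R : realType) (m : nat) (x y : nat -> R) (h : R -> R) : R :=
  \sum_(i < m) (y i - h (x i)) ^+ 2.

(* Some least squares fit; only its values at the design points, which do not
   depend on the choice, are used. *)
Definition isotonic_fit (R : realType) (m : nat) (x y : nat -> R) : R -> R :=
  get [set h : R -> R | nondecreasing01 h /\
         forall k, nondecreasing01 k -> sum_sq m x y h <= sum_sq m x y k].

(* The design being increasing, x (num_le m x t).-1 is the largest design
   point <= t, and the smallest design point if there is none. *)
Definition isotonic_step (R : realType) (m : nat) (x y : nat -> R) (t : R) : R :=
  isotonic_fit m x y (x (num_le m x t).-1).

Definition dhat1 (R : realType) (theta0 : R) (m : nat) (x y : nat -> R) : R :=
  let A := [set t | 0 <= t <= 1 /\ theta0 <= isotonic_step m x y t] in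
  if `[< A !=set0 >] then inf A else 1.

Definition stage1_size (R : realType) (p : R) (n : nat) : nat :=
  let k := Num.truncn (n%:R * p) in if odd (n - k) then k.+1 else k.

Definition stage2_size (R : realType) (p : R) (n : nat) : nat :=
  (n - stage1_size p n)./2.

Definition rss (R : realType) (s : seq (R * R)) (b : R * R) : R :=
  \sum_(q <- s) (q.2 - (b.1 + b.2 * q.1)) ^+ 2.

(* (intercept, slope); the minimizer is unique as soon as s has two distinct
   abscissas. *)
Definition least_squares_line (R : realType) (s : seq (R * R)) : R * R :=
  get [set b : R * R | forall c, rss s b <= rss s c].

Definition dtilde2 (R : realType) (theta0 L U : R) (k : nat)
    (y' y'' : 'I_k -> R) : R :=
  let b := least_squares_line
             ([seq (L, y' i) | i : 'I_k] ++ [seq (U, y'' i) | i : 'I_k]) in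
  (theta0 - b.1) / b.2.

(* Law of S (r', r'') when r' and r'' consist of k + k independent uniform
   draws from 'I_k, i.e. (r', r'') is uniform on the pairs of maps. *)
Definition resampling_prob (R : realType) (k : nat)
    (S : {ffun 'I_k -> 'I_k} * {ffun 'I_k -> 'I_k} -> R) (A : set R) : R :=
  #|[pred r | `[< A (S r) >]]|%:R /
  #|{: {ffun 'I_k -> 'I_k} * {ffun 'I_k -> 'I_k}}|%:R.

(* P*(n^(1/2) (dtilde2* - dtilde2) <= t), given the second-stage responses. *)
Definition bootstrap_cdf (R : realType) (theta0 L U : R) (n k : nat)
    (y' y'' : 'I_k -> R) (t : R) : R :=
  resampling_prob
    (fun r => Num.sqrt n%:R *
       (dtilde2 theta0 L U (fun i => y' (r.1 i)) (fun i => y'' (r.2 i))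
        - dtilde2 theta0 L U y' y''))
    [set s | s <= t].

(* Main.v *)
Require Import Defs.
From HB Require Import structures.
From mathcomp Require Import all_boot all_order all_algebra.
From mathcomp Require Import all_classical all_reals all_analysis.
From mathcomp Require Import measurable_realfun ring lra zify.

(** The two-point least squares fit is the line through (L, mean Y') and
(U, mean Y''). Let h be half the distance between L and U, let a and b be the
differences between the two means and theta0, and let x' and x'' be the changes
of the two means under resampling. Then the bootstrap error is
<<
  dtilde* - dtilde = 2 h (a x'' - b x') / ((b - a) (b - a + x'' - x')).
>>
If the first stage has located d0 up to o(h), a Taylor expansion of f at d0 gives
a / h --> - f'(d0) and b / h --> f'(d0). Both x' and x'' are of order
n2^-(1/2), which is o(h), so the error is asymptotically
- (x' + x'') / (2 f'(d0)): a sum of n2 + n2 independent centered draws, given the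
data. Its conditional variance times n converges to C2^2, because the sample
variances converge to sigma^2 and n / n2 converges to 2 / (1 - p).

The conditional central limit theorem for the draws is proved by Lindeberg's
exchange method, with an explicit error of order n2^-(1/2) that depends on the
data through third absolute moments ([lindeberg_iter], [resampling_clt_ub],
[resampling_clt_lb]). Together with Chebyshev's inequality for x' and x'' it
yields, for every fixed n and every data set, a bound on the distance between
the bootstrap distribution function and the normal one that is uniform in t
([bootstrap_cdf_near_normal]); along a fixed sequence of data the bound tends to
0 as soon as averages of powers of the errors converge and the first stage is
o(h)-accurate ([bootstrap_cdf_limit]).

The accuracy of the first stage is where gamma < 1/3 is used. Lowering or raising
a block of fitted values shows that, if the isotonic estimate misses d0 by
delta, some window of consecutive design points, of length at least of order
n1 delta, has an average error at least of order delta ([dhat1_near]). A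
moment of order 2 q bounds the probability of this event, for one window, by a
multiple of (n1 delta^3)^-q. With delta = eta n^-gamma and q large this is
summable even after a union over all the windows, and the Borel-Cantelli lemma
makes the first-stage error o(n^-gamma) almost surely ([ae_small_averages],
[dhat1_rate]). The same statement, for the window formed by a whole row, gives
the strong laws for the errors of the second stage, their squares and their
fourth powers. *)

Set Implicit Arguments.
Unset Strict Implicit.
Unset Printing Implicit Defensive.
Import Order.TTheory GRing.Theory Num.Theory.
Import numFieldNormedType.Exports.
Local Open Scope classical_set_scope.
Local Open Scope ring_scope.

(** * The Gaussian density and its smoothing operators *)

Section gaussian_moments.
Context {R : realType}.
Notation mu := (@lebesgue_measure R).

Definition gaussian_density (z : R) : R := normal_pdf 0 1 z.
Local Notation g01 := gaussian_density.

Lemma gaussian_densityE z : g01 z = normal_peak 1 * expR (- z ^+ 2 / 2).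
Proof.
by rewrite /gaussian_density normal_pdfE ?oner_eq0// /normal_fun subr0 expr1n.
Qed.

Lemma gaussian_density_ge0 z : 0 <= g01 z.
Proof. exact: normal_pdf_ge0. Qed.

Lemma continuous_gaussian_density : continuous g01.
Proof. by apply: continuous_normal_pdf; rewrite oner_eq0. Qed.

Lemma measurable_gaussian_density : measurable_fun setT g01.
Proof. exact: measurable_normal_pdf. Qed.

Lemma is_derive_gaussian_density (z : R) :
  is_derive z 1 g01 (- z * g01 z).
Proof.
rewrite (_ : g01 = fun z => normal_peak 1 * expR (- z ^+ 2 / 2)); last first.
  by apply/funext => y; rewrite gaussian_densityE.
by apply: is_derive_eq; rewrite /GRing.scale /=; field.
Qed.

(** The cubic Taylor term of the exponential gives enough decay for all the
moments up to order 5. *)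
Lemma gaussian_density_tail (z : R) : z ^+ 6 * g01 z <= 48 * normal_peak 1.
Proof.
have e3 : (z ^+ 2 / 2) ^+ 3 <= 6 * expR (z ^+ 2 / 2).
  have := expR_ge1Dxn 2 (divr_ge0 (sqr_ge0 z) (ler0n R 2)).
  rewrite (_ : 3`!%:R = 6 :> R)// => h.
  lra.
rewrite gaussian_densityE mulrCA mulrC ler_wpM2r ?normal_peak_ge0//.
rewrite mulNr expRN ler_pdivrMr ?expR_gt0//.
rewrite (_ : z ^+ 6 = 8 * (z ^+ 2 / 2) ^+ 3); last by field.
lra.
Qed.

Lemma cvg_gaussian_density_poly (k : nat) : (k < 6)%N ->
  (z ^+ k * g01 z) @[z --> +oo] --> (0 : R).
Proof.
move=> k6.
apply: (@squeeze_cvgr _ _ _ _ (cst 0) (fun z => 48 * normal_peak 1 * z^-1)).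
- near=> z.
  have z1 : 1 <= z by near: z; apply: nbhs_pinfty_ge; rewrite num_real.
  have z0 : 0 < z by apply: lt_le_trans z1.
  rewrite /= mulr_ge0 ?exprn_ge0 ?gaussian_density_ge0 ?(ltW z0)//=.
  rewrite ler_pdivlMr//; apply: le_trans (gaussian_density_tail z).
  rewrite mulrAC -exprSr ler_wpM2r ?gaussian_density_ge0//.
  by rewrite ler_eXn2l.
- exact: cvg_cst.
- rewrite -[X in _ --> X](mulr0 (48 * normal_peak 1)).
  apply: cvgMr; apply/gtr0_cvgV0; last exact: cvg_id.
  by near=> z; near: z; apply: nbhs_pinfty_gt; rewrite num_real.
Unshelve. all: by end_near. Qed.

Lemma integral_gaussian_density : (\int[mu]_z (g01 z)%:E = 1)%E.
Proof. exact: integral_normal_pdf. Qed.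

Lemma continuous_poly_gaussian (k : nat) : continuous (fun z : R => z ^+ k * g01 z).
Proof.
move=> z; apply: cvgM; last exact: continuous_gaussian_density.
exact: exprn_continuous.
Qed.

Let poly_gaussian_ge0 (k : nat) z : 0 <= z -> 0 <= z ^+ k * g01 z.
Proof. by move=> z0; rewrite mulr_ge0 ?exprn_ge0 ?gaussian_density_ge0. Qed.

(** A primitive of [z ^+ 3 * g01 z] is [- (z ^+ 2 + 2) * g01 z]. *)
Lemma gaussian_third_moment_half :
  (\int[mu]_(z in `[0%R, +oo[) (z ^+ 3 * g01 z)%:E = (2 * g01 0)%:E)%E.
Proof.
have dF (z : R) : is_derive z 1 (fun z => - (z ^+ 2 + 2) * g01 z) (z ^+ 3 * g01 z).
  have := is_derive_gaussian_density z => h.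
  by apply: is_derive_eq; rewrite /GRing.scale /=; ring.
rewrite (@ge0_continuous_FTC2y _ _ (fun z => - (z ^+ 2 + 2) * g01 z) 0 0).
- by rewrite -[LHS]EFinB; congr (_%:E); ring.
- by move=> z; exact: poly_gaussian_ge0.
- exact/continuous_subspaceT/continuous_poly_gaussian.
- rewrite (_ : (fun z => _) = fun z => - (z ^+ 2 * g01 z) - 2 * (z ^+ 0 * g01 z)).
    rewrite -[X in _ --> X]subr0 -[X in _ - X](mulr0 2) -[X in X - _]oppr0.
    apply: cvgB; first by apply: cvgN; exact: cvg_gaussian_density_poly.
    by apply: cvgMr; exact: cvg_gaussian_density_poly.
  by apply/funext => z; ring.
- by move=> z _; have [] := dF z.
- have : continuous (fun z : R => - (z ^+ 2 + 2) * g01 z).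
    move=> z; apply/differentiable_continuous/derivable1_diffP.
    by have [] := dF z.
  by move=> h; apply: cvg_at_right_filter; exact: h.
- by move=> z _; rewrite derive1E; apply: derive_val.
Qed.

(** A primitive of [(1 - z ^+ 2) * g01 z] is [z * g01 z]; the integrand changes
sign at 1, so the half-line is cut there. *)
Lemma gaussian_second_moment_half :
  (\int[mu]_(z in `[0%R, +oo[) (z ^+ 2 * g01 z)%:E =
   \int[mu]_(z in `[0%R, +oo[) (g01 z)%:E)%E.
Proof.
have dF (z : R) : is_derive z 1 (fun z => z * g01 z) ((1 - z ^+ 2) * g01 z).
  have := is_derive_gaussian_density z => h.
  by apply: is_derive_eq; rewrite /GRing.scale /=; ring.
have cF : continuous (fun z : R => z * g01 z).
  move=> z; apply/differentiable_continuous/derivable1_diffP.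
  by have [] := dF z.
have cf : continuous (fun z : R => (1 - z ^+ 2) * g01 z).
  move=> z; rewrite (_ : (fun z => _) = fun z => g01 z - z ^+ 2 * g01 z).
    apply: cvgB; first exact: continuous_gaussian_density.
    exact: continuous_poly_gaussian.
  by apply/funext => t; ring.
have I1 : (\int[mu]_(z in `[0%R, 1%R]) ((1 - z ^+ 2) * g01 z)%:E = (g01 1)%:E)%E.
  rewrite (@continuous_FTC2 _ _ (fun z => z * g01 z)) ?ltr01//.
  - by rewrite mul1r mul0r sube0.
  - exact: continuous_subspaceT.
  - split.
    + by move=> z _; have [] := dF z.
    + by apply: cvg_at_right_filter; exact: cF.
    + by apply: cvg_at_left_filter; exact: cF.
  - by move=> z _; rewrite derive1E; apply: derive_val.
have I2 : (\int[mu]_(z in `[1%R, +oo[) ((1 - z ^+ 2) * g01 z)%:E = - (g01 1)%:E)%E.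
  rewrite (@le0_continuous_FTC2y _ _ (fun z => z * g01 z) _ 0).
  - by rewrite mul1r sub0e.
  - move=> z z1; rewrite mulr_le0_ge0 ?gaussian_density_ge0// subr_le0.
    by rewrite exprn_ege1.
  - exact: continuous_subspaceT.
  - exact: (@cvg_gaussian_density_poly 1).
  - by apply: cvg_at_right_filter; exact: cF.
  - by move=> z _; have [] := dF z.
  - by move=> z _; rewrite derive1E; apply: derive_val.
have mg k (D : set R) : measurable_fun D (fun z : R => z ^+ k * g01 z).
  apply: measurable_funTS; apply: continuous_measurable_fun.
  exact: continuous_poly_gaussian.
have mg0 (D : set R) : measurable_fun D g01.
  by apply: measurable_funTS; exact: measurable_gaussian_density.
have ig (D : set R) : measurable D -> mu.-integrable D (fun z => (g01 z)%:E).
  move=> mD; apply: (@integrableS _ _ _ _ setT) => //.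
  exact: (integrable_normal_pdf 0 1).
have i01 : mu.-integrable `[0%R, 1%R] (fun z => ((1 - z ^+ 2) * g01 z)%:E).
  apply: continuous_compact_integrable; first exact: segment_compact.
  exact: continuous_subspaceT.
have i1y : mu.-integrable `[1%R, +oo[ (fun z => ((1 - z ^+ 2) * g01 z)%:E).
  apply/integrableP; split.
    by apply/measurable_EFinP; apply: measurable_funTS; exact: continuous_measurable_fun.
  apply/abse_integralP => //.
    by apply/measurable_EFinP; apply: measurable_funTS; exact: continuous_measurable_fun.
  by rewrite I2 abseN abse_EFin ltry.
have e2 z : ((z ^+ 2 * g01 z)%:E = (g01 z)%:E - ((1 - z ^+ 2) * g01 z)%:E)%E.
  by rewrite -EFinB; congr (_%:E); ring.
have J1 : (\int[mu]_(z in `[0%R, 1%R]) (z ^+ 2 * g01 z)%:E =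
    \int[mu]_(z in `[0%R, 1%R]) (g01 z)%:E - (g01 1)%:E)%E.
  by under eq_integral do rewrite e2; rewrite integralB// ?I1//; exact: ig.
have J2 : (\int[mu]_(z in `[1%R, +oo[) (z ^+ 2 * g01 z)%:E =
    \int[mu]_(z in `[1%R, +oo[) (g01 z)%:E + (g01 1)%:E)%E.
  under eq_integral do rewrite e2.
  by rewrite integralB// ?I2 ?oppeK//; exact: ig.
have split01 (h : R -> \bar R) : measurable_fun setT h ->
   (forall z : R, 0 <= z -> (0 <= h z)%E) ->
   (\int[mu]_(z in `[0%R, +oo[) h z = \int[mu]_(z in `[0%R, 1%R]) h z + \int[mu]_(z in `[1%R, +oo[) h z)%E.
  move=> mh h0; rewrite -[X in _ = (_ + X)%E]integral_itv_obnd_cbnd.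
    rewrite -ge0_integral_setU//=.
    - by rewrite -itv_bndbnd_setU//= bnd_simp.
    - exact: measurable_funTS.
    - move=> z [] /=; rewrite in_itv/= => /andP[z0 _]; apply: h0 => //.
      by rewrite (le_trans ler01)// ltW.
    - apply/disj_setPS => z [] /=; rewrite !in_itv/= andbT => /andP[_ z1].
      by rewrite ltNge z1.
  exact: measurable_funTS.
rewrite split01; last 2 first.
- exact/measurable_EFinP.
- by move=> z z0; rewrite lee_fin poly_gaussian_ge0.
rewrite [RHS]split01; last 2 first.
- exact/measurable_EFinP.
- by move=> z _; rewrite lee_fin gaussian_density_ge0.
rewrite J1 J2 addeACA -EFinN -EFinD addNr adde0//.
Qed.

Lemma integrable_gaussian_abs3 :
  mu.-integrable setT (EFin \o (fun z => `|z| ^+ 3 * g01 z)).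
Proof.
have c3 : continuous (fun z : R => `|z| ^+ 3 * g01 z).
  move=> z; apply: cvgM; last exact: continuous_gaussian_density.
  apply: (@continuous_comp _ _ _ (fun z : R => `|z|) (fun t => t ^+ 3)).
    exact: norm_continuous.
  exact: exprn_continuous.
have m3 : measurable_fun setT (EFin \o (fun z : R => `|z| ^+ 3 * g01 z)).
  by apply/measurable_EFinP; exact: continuous_measurable_fun.
apply/integrableP; split => //.
apply/abse_integralP => //; rewrite ge0_symfun_integralT//.
- rewrite -set_itvcy (_ : (\int[mu]_(x in `[0%R, +oo[) _)%E = (2 * g01 0)%:E).
    by rewrite -EFinM abse_EFin ltry.
  rewrite -gaussian_third_moment_half; apply: eq_integral => z.
  by rewrite inE/= in_itv/= andbT => z0; rewrite ger0_norm.
- by move=> z; rewrite mulr_ge0 ?gaussian_density_ge0.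
- by move=> z; rewrite /= normrN !gaussian_densityE sqrrN.
Qed.

(** Every integrability question below reduces to cubic growth. *)
Lemma integrable_gaussian_dominated (h : R -> R) (C : R) :
  measurable_fun setT h -> (forall z, `|h z| <= C * (1 + `|z| ^+ 3)) ->
  mu.-integrable setT (EFin \o (fun z => h z * g01 z)).
Proof.
move=> mh hC.
apply: (@le_integrable _ _ R mu setT measurableT _
    (EFin \o (fun z : R => C * (g01 z + `|z| ^+ 3 * g01 z)))) => //.
- apply/measurable_EFinP/measurable_funM => //.
  exact: measurable_gaussian_density.
- move=> z _; rewrite lee_fin normrM (ger0_norm (gaussian_density_ge0 z)).
  apply: le_trans (ler_norm _).
  rewrite (_ : C * _ = C * (1 + `|z| ^+ 3) * g01 z); last by ring.
  by rewrite ler_wpM2r ?gaussian_density_ge0.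
- rewrite (_ : EFin \o _ =
      fun z => (C%:E * (g01 z + `|z| ^+ 3 * g01 z)%:E)%E)//.
  apply: integrableZl => //.
  apply: (integrableD _ (integrable_normal_pdf 0 1) integrable_gaussian_abs3) => //.
Qed.

Lemma gaussian_mass : \int[mu]_z g01 z = 1.
Proof. by rewrite /Rintegral integral_gaussian_density. Qed.

Let abs_le_cube (t : R) : 0 <= t -> t <= 1 + t ^+ 3.
Proof.
by move=> t0; have := mulr_ge0 (addr_ge0 t0 ler01) (sqr_ge0 (t - 1)); nra.
Qed.

Let sqr_le_cube (t : R) : 0 <= t -> t ^+ 2 <= 1 + t ^+ 3.
Proof.
by move=> t0; have := mulr_ge0 (addr_ge0 t0 ler01) (sqr_ge0 (t - 1)); nra.
Qed.

Lemma integrable_gaussian1 : mu.-integrable setT (EFin \o (fun z => z * g01 z)).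
Proof.
apply: (@integrable_gaussian_dominated id 1) => // z.
by rewrite mul1r abs_le_cube.
Qed.

Lemma integrable_gaussian2 :
  mu.-integrable setT (EFin \o (fun z => z ^+ 2 * g01 z)).
Proof.
apply: (@integrable_gaussian_dominated (fun z => z ^+ 2) 1) => // z.
by rewrite mul1r normrX sqr_le_cube.
Qed.

(** The density is even and Lebesgue measure is invariant under reflection. *)
Lemma gaussian_mean : \int[mu]_z (z * g01 z) = 0.
Proof.
have mN : measurable_fun setT (-%R : measurableTypeR R -> measurableTypeR R) by exact: oppr_measurable.
have e : (\int[mu]_z (z * g01 z)%:E = \int[mu]_z (- z * g01 z)%:E)%E.
  have := @integral_pushforward _ _ (measurableTypeR R) (measurableTypeR R) R -%R mN mu setT
    (EFin \o (fun z => z * g01 z)).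
  move=> H.
  transitivity (\int[pushforward mu (-%R : measurableTypeR R -> measurableTypeR R)]_y
    (EFin \o (fun z : R => (z * g01 z)%R)) y)%E.
    apply: eq_measure_integral => //= A mA _.
    exact/esym/(lebesgue_measureN mA).
  rewrite H; last exact: measurableT.
  - by rewrite preimage_setT; apply: eq_integral => z _ /=; rewrite !gaussian_densityE sqrrN.
  - by case/integrableP : integrable_gaussian1.
  - rewrite preimage_setT (_ : _ \o _ = fun z => (- (z * g01 z)%:E)%E).
      exact/integrableN/integrable_gaussian1.
    by apply/funext => z; rewrite /= !gaussian_densityE sqrrN mulNr.
have : \int[mu]_z (z * g01 z) = - \int[mu]_z (z * g01 z).
  rewrite {1}/Rintegral e -mulN1r -RintegralZl//; last exact: integrable_gaussian1.
  by rewrite /Rintegral; congr fine; apply: eq_integral => z _; rewrite mulN1r mulNr.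
by lra.
Qed.

Lemma gaussian_variance : \int[mu]_z (z ^+ 2 * g01 z) = 1.
Proof.
rewrite /Rintegral ge0_symfun_integralT; last 3 first.
- by move=> z; rewrite mulr_ge0 ?sqr_ge0 ?gaussian_density_ge0.
- exact: continuous_poly_gaussian.
- by move=> z; rewrite /= sqrrN !gaussian_densityE sqrrN.
rewrite -set_itvcy gaussian_second_moment_half set_itvcy.
rewrite -ge0_symfun_integralT; last 3 first.
- by move=> z; rewrite gaussian_density_ge0.
- exact: continuous_gaussian_density.
- by move=> z; rewrite /= !gaussian_densityE sqrrN.
by rewrite integral_gaussian_density.
Qed.

(** The average of [phi] against the normal law of mean [x] and standard
deviation [s], written so that [s = 0] is allowed. *)
Definition gaussian_smoothing (s : R) (phi : R -> R) (x : R) : R :=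
  \int[mu]_z (phi (x + s * z) * g01 z).
Local Notation G := gaussian_smoothing.

(** Test functions; unlike continuous ones, they include the indicators of
half-lines. *)
Definition unit_measurable (phi : R -> R) :=
  measurable_fun setT phi /\ forall x, 0 <= phi x <= 1.

Lemma continuous_affine (x s : R) : continuous (fun z : R => x + s * z).
Proof.
by move=> z; apply: cvgD; [exact: cvg_cst | apply: cvgMr; exact: cvg_id].
Qed.

Lemma unit_measurable_affine phi x s :
  unit_measurable phi -> unit_measurable (fun z => phi (x + s * z)).
Proof.
move=> [cphi phi01]; split => [|z]; last exact: phi01.
apply: (measurableT_comp cphi); apply: continuous_measurable_fun.
exact: continuous_affine.
Qed.

Lemma integrable_smoothing phi x s : unit_measurable phi ->
  mu.-integrable setT (EFin \o (fun z => phi (x + s * z) * g01 z)).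
Proof.
move=> /(unit_measurable_affine x s)[cphi phi01].
apply: (@integrable_gaussian_dominated _ 1) => // z.
have /andP[h0 h1] := phi01 z.
by rewrite mul1r ger0_norm// (le_trans h1)// lerDl.
Qed.

Lemma smoothing0 phi x : G 0 phi x = phi x.
Proof.
rewrite /G; under eq_Rintegral do rewrite mul0r addr0.
by rewrite RintegralZl ?gaussian_mass ?mulr1//; exact: integrable_normal_pdf.
Qed.

Lemma smoothing_near phi phi' s x (e : R) :
  unit_measurable phi -> unit_measurable phi' ->
  (forall y, `|phi y - phi' y| <= e) -> `|G s phi x - G s phi' x| <= e.
Proof.
move=> hphi hphi' near.
rewrite /G -RintegralB//; [|exact: integrable_smoothing..].
apply: (le_trans (le_normr_Rintegral _ _)) => //.
  have := integrableB measurableT (integrable_smoothing x s hphi)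
    (integrable_smoothing x s hphi').
  by [].
have ig : mu.-integrable setT (EFin \o g01) by exact: (integrable_normal_pdf 0 1).
apply: (@le_trans _ _ (\int[mu]_z (e * g01 z))); last first.
  by rewrite RintegralZl// gaussian_mass mulr1.
apply: le_Rintegral => //.
- have := integrableB measurableT (integrable_smoothing x s hphi)
    (integrable_smoothing x s hphi').
  move=> /integrable_abse; apply: eq_integrable => //.
- have := integrableZl measurableT e ig.
  by [].
- move=> z _; rewrite -mulrBl normrM (ger0_norm (gaussian_density_ge0 z)).
  by rewrite ler_wpM2r ?gaussian_density_ge0.
Qed.

(** Smoothing averages over translations, hence commutes with the average over a
uniform draw from [c]. *)
Lemma smoothing_mean (I : finType) (phi : R -> R) (c : I -> R) s x :
  unit_measurable phi ->
  G s (fun y => #|I|%:R^-1 * \sum_(i : I) phi (y + c i)) x =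
  #|I|%:R^-1 * \sum_(i : I) G s phi (x + c i).
Proof.
move=> hphi.
have int i := integrable_smoothing (x + c i) s hphi.
have sumint (r : seq I) : 
   mu.-integrable setT (EFin \o (fun z => \sum_(i <- r) phi (x + c i + s * z) * g01 z)) /\
   \int[mu]_z (\sum_(i <- r) phi (x + c i + s * z) * g01 z) = \sum_(i <- r) G s phi (x + c i).
  elim: r => [|i r [IHi IHr]].
    split; last by rewrite big_nil; under eq_Rintegral do rewrite big_nil; rewrite Rintegral_cst// mul0r.
    by under eq_fun do rewrite big_nil; exact: integrable0.
  have -> : (fun z => \sum_(j <- i :: r) phi (x + c j + s * z) * g01 z) =
       (fun z => phi (x + c i + s * z) * g01 z + \sum_(j <- r) phi (x + c j + s * z) * g01 z).
    by apply/funext => z; rewrite big_cons.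
  split; first by have := integrableD measurableT (int i) IHi.
  by rewrite RintegralD// IHr big_cons.
rewrite -(sumint _).2 -RintegralZl//; last exact: (sumint _).1.
apply: eq_Rintegral => z _.
rewrite -mulr_suml -mulrA; congr (_ * (_ * _)).
by apply: eq_bigr => i _; rewrite addrAC.
Qed.

Lemma normal_peak_scale (s : R) : 0 < s -> normal_peak s * s = normal_peak 1.
Proof.
move=> s0; rewrite /normal_peak expr1n mul1r -mulrnAr sqrtrM ?sqr_ge0//.
by rewrite sqrtr_sqr gtr0_norm// invfM mulrAC mulVf ?mul1r// gt_eqF.
Qed.

(** Substitution [v = x + s * z]. *)
Lemma smoothing_density (phi : R -> R) (x s : R) : 0 < s ->
  continuous phi -> (forall y : R, 0 <= phi y <= 1) ->
  (G s phi x)%:E = (\int[mu]_v (phi v * normal_pdf x s v)%:E)%E.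
Proof.
move=> s0 cphi phi01.
have um : unit_measurable phi by split => //; exact: continuous_measurable_fun.
have -> : ((G s phi x)%:E = \int[mu]_z (phi (x + s * z) * g01 z)%:E)%E.
  by rewrite fineK//; apply: integrable_fin_num => //; exact: integrable_smoothing.
have dF (z : R) : is_derive z 1 (fun z : R => x + s * z) s.
  by apply: is_derive_eq; rewrite /GRing.scale /=; ring.
have F'E : (fun z : R => x + s * z)^`()%classic = cst s.
  by apply/funext => z; rewrite derive1E; apply: derive_val.
rewrite (@increasing_ge0_integration_by_substitutionT _ (fun z : R => x + s * z)
   (fun v => phi v * normal_pdf x s v)).
- apply: eq_integral => z _; rewrite F'E /=; congr (_%:E).
  rewrite -[RHS]/(phi (x + s * z) * normal_pdf x s (x + s * z) * s) -mulrA.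
  rewrite gaussian_densityE -(normal_peak_scale s0) normal_pdfE ?gt_eqF//.
  rewrite /normal_fun mulrAC; congr (_ * (_ * expR _ * _)).
  by rewrite -mulr_natr; field; rewrite gt_eqF.
- by move=> z z' zz'; rewrite ltrD2l ltr_pM2l.
- by rewrite F'E => z; exact: cvg_cst.
- by rewrite F'E; exact: is_cvg_cst.
- by rewrite F'E; exact: is_cvg_cst.
- by move=> z; have [] := dF z.
- apply: cvg_comp; last exact: cvg_addrl_Ny.
  by apply/gt0_cvgMrNy => //; exact: cvg_id.
- apply: cvg_comp; last exact: cvg_addrl.
  by apply/gt0_cvgMry => //; exact: cvg_id.
- move=> z; apply: cvgM; first exact: cphi.
  by apply: continuous_normal_pdf; rewrite gt_eqF.
- by move=> z; rewrite mulr_ge0 ?normal_pdf_ge0//; have /andP[] := phi01 z.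
Qed.

(** Completing the square in [z]: for independent standard normal Z and Z', the
joint density of Z and x + s Z + t Z' is the density of the second variable
times the conditional density of the first. *)
Lemma normal_pdf_mul (x v s t z : R) : 0 < s -> 0 < t ->
  let r := Num.sqrt (s ^+ 2 + t ^+ 2) in
  g01 z * normal_pdf (x + s * z) t v =
  normal_pdf x r v * normal_pdf (s * (v - x) / r ^+ 2) (t / r) z.
Proof.
move=> s0 t0 r.
have q0 : 0 < s ^+ 2 + t ^+ 2 by rewrite addr_gt0 ?exprn_gt0.
have r0 : 0 < r by rewrite sqrtr_gt0.
have r2 : r ^+ 2 = s ^+ 2 + t ^+ 2 by rewrite sqr_sqrtr// ltW.
have tr0 : 0 < t / r by rewrite divr_gt0.
rewrite gaussian_densityE !normal_pdfE ?gt_eqF//.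
have pe : normal_peak 1 * normal_peak t = normal_peak r * normal_peak (t / r).
  apply: (@mulIf _ t); first by rewrite gt_eqF.
  rewrite -mulrA normal_peak_scale// {2}(_ : t = r * (t / r)); last by field; rewrite gt_eqF.
  by rewrite mulrACA !normal_peak_scale.
rewrite mulrACA [RHS]mulrACA pe; congr (_ * _).
rewrite /normal_fun -!expRD; congr expR.
rewrite expr_div_n r2; field.
by rewrite !gt_eqF.
Qed.

Lemma smoothing_unit phi s x : unit_measurable phi -> 0 <= G s phi x <= 1.
Proof.
move=> um; apply/andP; split.
  apply: Rintegral_ge0 => z _; rewrite mulr_ge0 ?gaussian_density_ge0//.
  by have /andP[] := um.2 (x + s * z).
rewrite -gaussian_mass; apply: le_Rintegral => //.
- exact: integrable_smoothing.
- exact: (integrable_normal_pdf 0 1).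
- move=> z _; rewrite ler_piMl ?gaussian_density_ge0//.
  by have /andP[] := um.2 (x + s * z).
Qed.

Lemma unit_measurable_smoothing phi s :
  unit_measurable phi -> unit_measurable (G s phi).
Proof.
move=> um; split => [|x]; last exact: smoothing_unit.
have mf : measurable_fun setT
    (fun xz : measurableTypeR R * measurableTypeR R =>
       (phi (xz.1 + s * xz.2) * g01 xz.2)%:E).
  apply/measurable_EFinP; apply: measurable_funM.
    apply: (measurableT_comp um.1); apply: measurable_funD => //.
    by apply: measurable_funM => //.
  by apply: (measurableT_comp measurable_gaussian_density).
have f0 (xz : measurableTypeR R * measurableTypeR R) :
    (0 <= (phi (xz.1 + s * xz.2) * g01 xz.2)%:E)%E.
  rewrite lee_fin mulr_ge0 ?gaussian_density_ge0//.
  by have /andP[] := um.2 (xz.1 + s * xz.2).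
have /(_ mf f0) mF := @measurable_fun_fubini_tonelli_F _ _ (measurableTypeR R)
  (measurableTypeR R) R mu
  (fun xz => (phi (xz.1 + s * xz.2) * g01 xz.2)%:E).
by apply: (measurableT_comp _ mF); exact: fine_measurable.
Qed.

(** A sum of independent normal variables is normal. After Tonelli,
[normal_pdf_mul] lets the inner variable integrate to 1. *)
Lemma smoothing_comp (phi : R -> R) (s t x : R) : 0 <= s -> 0 <= t ->
  continuous phi -> (forall y : R, 0 <= phi y <= 1) ->
  G s (G t phi) x = G (Num.sqrt (s ^+ 2 + t ^+ 2)) phi x.
Proof.
rewrite le_eqVlt => /predU1P[<-|s0].
  move=> t0 _ _; rewrite smoothing0 expr0n/= add0r sqrtr_sqr.
  by rewrite ger0_norm.
rewrite le_eqVlt => /predU1P[<-|t0] cphi phi01.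
  rewrite expr0n/= addr0 sqrtr_sqr gtr0_norm//.
  by congr (G s _ x); apply/funext => y; rewrite smoothing0.
have um : unit_measurable phi by split => //; exact: continuous_measurable_fun.
set r := Num.sqrt _.
have r0 : 0 < r by rewrite sqrtr_gt0 addr_gt0 ?exprn_gt0.
apply: EFin_inj.
have -> : ((G s (G t phi) x)%:E = \int[mu]_z (G t phi (x + s * z) * g01 z)%:E)%E.
  rewrite fineK//; apply: integrable_fin_num => //; apply: integrable_smoothing.
  exact: unit_measurable_smoothing.
have phi0 y : 0 <= phi y by have /andP[] := phi01 y.
have mpdf (y r' : R) : measurable_fun setT (fun v : measurableTypeR R => normal_pdf y r' v).
  exact: measurable_normal_pdf.
transitivity (\int[mu]_z \int[mu]_v (g01 z * normal_pdf (x + s * z) t v * phi v)%:E)%E.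
  apply: eq_integral => z _; rewrite EFinM smoothing_density// muleC.
  rewrite -ge0_integralZl//.
  - by apply: eq_integral => v _; rewrite -EFinM mulrA mulrAC.
  - by apply/measurable_EFinP; apply: measurable_funM => //; exact: um.1.
  - by move=> v _; rewrite lee_fin mulr_ge0 ?normal_pdf_ge0.
  - by rewrite lee_fin gaussian_density_ge0.
have := @fubini_tonelli _ _ (measurableTypeR R) (measurableTypeR R) R mu mu
  (fun zv => (g01 zv.1 * normal_pdf (x + s * zv.1) t zv.2 * phi zv.2)%:E).
move=> -> /=.
- rewrite smoothing_density//; apply: eq_integral => v _.
  under eq_integral do rewrite normal_pdf_mul// -/r mulrAC EFinM.
  rewrite ge0_integralZl//.
  + by rewrite integral_normal_pdf mule1 mulrC.
  + exact/measurable_EFinP.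
  + by move=> z _; rewrite lee_fin normal_pdf_ge0.
  + by rewrite lee_fin mulr_ge0 ?normal_pdf_ge0.
- apply/measurable_EFinP; apply: measurable_funM; last first.
    by apply: (measurableT_comp um.1).
  apply: measurable_funM.
    by apply: (measurableT_comp measurable_gaussian_density).
  rewrite (_ : (fun zv => _) = fun zv : measurableTypeR R * measurableTypeR R =>
      normal_pdf 0 t (zv.2 - (x + s * zv.1))).
    apply: (measurableT_comp (measurable_normal_pdf 0 t)).
    apply: measurable_funB => //; apply: measurable_funD => //.
    by apply: measurable_funM.
  by apply/funext => zv; rewrite !normal_pdfE ?gt_eqF// normal_fun_center.
- move=> zv; rewrite lee_fin mulr_ge0// mulr_ge0 ?gaussian_density_ge0//.
  exact: normal_pdf_ge0.
Qed.

End gaussian_moments.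

(** * Replacing resampled terms by Gaussian ones *)

Section lindeberg.
Context {R : realType}.
Notation mu := (@lebesgue_measure R).
Local Notation g01 := (@gaussian_density R).
Local Notation G := (@gaussian_smoothing R).

Definition gaussian_abs3 : R := \int[mu]_z (`|z| ^+ 3 * g01 z).

(** Third-order Taylor control, in a form that a piecewise cubic function
satisfies without any mention of its derivatives. *)
Definition cubic_remainder (M : R) (phi : R -> R) :=
  forall x, exists a b, forall h,
    `|phi (x + h) - phi x - a * h - b * h ^+ 2| <= M * `|h| ^+ 3.

(** The first Gaussian moment vanishes and the second is 1, so only [b * s ^+ 2]
survives from the quadratic expansion. *)
Lemma smoothing_taylor phi x s a b M : unit_measurable phi ->
  (forall h, `|phi (x + h) - phi x - a * h - b * h ^+ 2| <= M * `|h| ^+ 3) ->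
  `|G s phi x - phi x - b * s ^+ 2| <= M * `|s| ^+ 3 * gaussian_abs3.
Proof.
move=> um taylor.
pose rem z := phi (x + s * z) - phi x - a * (s * z) - b * (s * z) ^+ 2.
have rem_le z : `|rem z| <= M * `|s| ^+ 3 * `|z| ^+ 3.
  by rewrite -mulrA -exprMn -normrM; exact: taylor.
have M0 : 0 <= M * `|s| ^+ 3 by have := rem_le 1; rewrite normr1 expr1n mulr1; exact: le_trans.
have mphi : measurable_fun setT (fun z => phi (x + s * z)).
  by case: (unit_measurable_affine x s um).
have irem : mu.-integrable setT (EFin \o (fun z => rem z * g01 z)).
  apply: (@integrable_gaussian_dominated _ _ (M * `|s| ^+ 3)) => [|z].
    rewrite /rem; apply: measurable_funB.
      apply: measurable_funB; first by apply: measurable_funB.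
      by apply: measurable_funM => //; exact: measurable_funM.
    apply: measurable_funM => //.
    by apply: measurable_funX; exact: measurable_funM.
  by apply: (le_trans (rem_le z)); rewrite ler_wpM2l// lerDr.
have i0 : mu.-integrable setT (EFin \o g01) by exact: (integrable_normal_pdf 0 1).
have i0x : mu.-integrable setT (EFin \o (fun z => phi x * g01 z)).
  by have := integrableZl measurableT (phi x) i0.
have i1 : mu.-integrable setT (EFin \o (fun z => (a * s) * (z * g01 z))).
  by have := integrableZl measurableT (a * s) integrable_gaussian1.
have i2 : mu.-integrable setT (EFin \o (fun z => (b * s ^+ 2) * (z ^+ 2 * g01 z))).
  by have := integrableZl measurableT (b * s ^+ 2) integrable_gaussian2.
have -> : G s phi x - phi x - b * s ^+ 2 = \int[mu]_z (rem z * g01 z).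
  have -> : G s phi x = \int[mu]_z (rem z * g01 z + (phi x * g01 z +
      ((a * s) * (z * g01 z) + (b * s ^+ 2) * (z ^+ 2 * g01 z)))).
    by apply: eq_Rintegral => z _; rewrite /rem; ring.
  have i12 := integrableD measurableT i1 i2.
  have i012 := integrableD measurableT i0x i12.
  rewrite RintegralD// RintegralD// RintegralD// !RintegralZl//.
  - by rewrite gaussian_mass gaussian_mean gaussian_variance; ring.
  - exact: integrable_gaussian2.
  - exact: integrable_gaussian1.
apply: (le_trans (le_normr_Rintegral _ _)) => //.
rewrite /gaussian_abs3 -RintegralZl//; last exact: integrable_gaussian_abs3.
apply: le_Rintegral => //.
- by have := integrable_abse irem; apply: eq_integrable.
- by have := integrableZl measurableT (M * `|s| ^+ 3) integrable_gaussian_abs3.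
- move=> z _; rewrite normrM (ger0_norm (gaussian_density_ge0 z)) mulrA.
  by rewrite ler_wpM2r ?gaussian_density_ge0.
Qed.

Definition mean (I : finType) (c : I -> R) : R := #|I|%:R^-1 * \sum_(i : I) c i.

Lemma le_mean (I : finType) (c c' : I -> R) :
  (forall i, c i <= c' i) -> mean c <= mean c'.
Proof. by move=> cc'; rewrite ler_wpM2l ?invr_ge0//; exact: ler_sum. Qed.

Lemma mean_cst (I : finType) (a : R) : (0 < #|I|)%N -> mean (fun _ : I => a) = a.
Proof.
move=> I0; rewrite /mean sumr_const -[a *+ _]mulr_natl mulrA mulVf ?mul1r//.
by rewrite pnatr_eq0 -lt0n.
Qed.

Lemma meanD (I : finType) (c c' : I -> R) :
  mean (fun i => c i + c' i) = mean c + mean c'.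
Proof. by rewrite /mean big_split mulrDr. Qed.

Lemma meanZ (I : finType) (a : R) (c : I -> R) :
  mean (fun i => a * c i) = a * mean c.
Proof. by rewrite /mean -mulr_sumr mulrCA. Qed.

Lemma ler_norm_mean (I : finType) (c : I -> R) : `|mean c| <= mean (fun i => `|c i|).
Proof.
rewrite /mean normrM ger0_norm ?invr_ge0// ler_wpM2l ?invr_ge0//.
exact: ler_norm_sum.
Qed.

Lemma meanB (I : finType) (c c' : I -> R) :
  mean (fun i => c i - c' i) = mean c - mean c'.
Proof. by rewrite /mean sumrB mulrBr. Qed.

Lemma mean_near (I : finType) (c c' : I -> R) (e : R) : (0 < #|I|)%N ->
  (forall i, `|c i - c' i| <= e) -> `|mean c - mean c'| <= e.
Proof.
move=> I0 h; rewrite -meanB; apply: (le_trans (ler_norm_mean _)).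
by rewrite -[leRHS](mean_cst e I0); exact: le_mean.
Qed.

Section one_step.
Context (I : finType) (c : I -> R).
Hypothesis I_gt0 : (0 < #|I|)%N.
Hypothesis c_centered : mean c = 0.
Let s := Num.sqrt (mean (fun i => c i ^+ 2)).

Let mean_sqr_ge0 : 0 <= mean (fun i => c i ^+ 2).
Proof. by rewrite mulr_ge0 ?invr_ge0// sumr_ge0// => i _; exact: sqr_ge0. Qed.

(** The cost of exchanging one centered draw from [c] for a normal variable of the
same variance. *)
Definition lindeberg_error (M : R) : R :=
  M * (mean (fun i => `|c i| ^+ 3) +
       Num.sqrt (mean (fun i => c i ^+ 2)) ^+ 3 * gaussian_abs3).

(** A centered draw and a centered normal variable with the same variance agree on
quadratic polynomials; only the two cubic remainders are left. *)
Lemma lindeberg_step phi M x : unit_measurable phi -> cubic_remainder M phi ->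
  `|mean (fun i => phi (x + c i)) - G s phi x| <= lindeberg_error M.
Proof.
move=> um /(_ x)[a [b taylor]].
have := smoothing_taylor s um taylor.
have s2 : s ^+ 2 = mean (fun i => c i ^+ 2) by rewrite sqr_sqrtr.
have : `|mean (fun i => phi (x + c i)) - phi x - b * s ^+ 2|
    <= M * mean (fun i => `|c i| ^+ 3).
  rewrite (_ : _ - _ - _ =
      mean (fun i => phi (x + c i) - phi x - a * c i - b * c i ^+ 2)).
    apply: (le_trans (ler_norm_mean _)); rewrite -meanZ.
    by apply: le_mean => i; exact: taylor.
  by rewrite !meanB !meanZ mean_cst// c_centered s2; ring.
rewrite /lindeberg_error -/s (ger0_norm (sqrtr_ge0 _)) -/s.
set A := mean (fun i => `|c i| ^+ 3); set B := mean _; set S := G s phi x.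
have -> : M * (A + s ^+ 3 * gaussian_abs3) = M * A + M * s ^+ 3 * gaussian_abs3 by ring.
rewrite !ler_norml => /andP[h1 h2] /andP[h3 h4]; apply/andP; split; lra.
Qed.

Definition resampled_sum (m : nat) (r : {ffun 'I_m -> I}) : R :=
  \sum_(i < m) c (r i).

(** Conditioning on the first of the independent draws. *)
Lemma mean_ffun_cons (m : nat) (F : R -> R) :
  mean (fun r : {ffun 'I_m.+1 -> I} => F (resampled_sum r)) =
  mean (fun j => mean (fun r : {ffun 'I_m -> I} => F (c j + resampled_sum r))).
Proof.
pose cons (jr : I * {ffun 'I_m -> I}) : {ffun 'I_m.+1 -> I} :=
  [ffun i => if unlift ord0 i is Some i' then jr.2 i' else jr.1].
pose uncons (r : {ffun 'I_m.+1 -> I}) : I * {ffun 'I_m -> I} :=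
  (r ord0, [ffun i => r (lift ord0 i)]).
have consK : cancel cons uncons.
  move=> [j r]; rewrite /uncons ffunE unlift_none; congr (_, _).
  by apply/ffunP => i; rewrite !ffunE liftK.
have unconsK : cancel uncons cons.
  move=> r; apply/ffunP => i; rewrite ffunE.
  by case: unliftP => [i'|] -> //=; rewrite ffunE.
rewrite /mean (reindex cons); last by exists uncons => ? _.
rewrite -(pair_big xpredT xpredT (fun j r => F (resampled_sum (cons (j, r)))))/=.
rewrite -mulr_sumr mulrA; congr (_ * _).
  by rewrite !card_ffun !card_ord expnS natrM invfM.
apply: eq_bigr => j _; apply: eq_bigr => r _; congr F.
rewrite /resampled_sum big_ord_recl ffunE unlift_none; congr (_ + _).
by apply: eq_bigr => i _; rewrite ffunE liftK.
Qed.

(** Lindeberg's method: one draw is exchanged at a time. The normal variables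
already introduced only smooth the test function, and smoothing does not
increase the cost of an exchange. *)
Lemma lindeberg_iter (phi : R -> R) M m x : continuous phi ->
  (forall y : R, 0 <= phi y <= 1) -> cubic_remainder M phi ->
  `|mean (fun r : {ffun 'I_m -> I} => phi (x + resampled_sum r))
    - G (s * Num.sqrt m%:R) phi x| <= m%:R * lindeberg_error M.
Proof.
move=> cphi phi01 taylor.
have um : unit_measurable phi by split => //; exact: continuous_measurable_fun.
elim: m x => [|m IH] x.
  rewrite sqrtr0 mulr0 smoothing0 mul0r.
  have -> : (fun r : {ffun 'I_0 -> I} => phi (x + resampled_sum r)) = fun=> phi x.
    by apply/funext => r; rewrite /resampled_sum big_ord0 addr0.
  by rewrite mean_cst ?subrr ?normr0// card_ffun card_ord expn0.
rewrite (mean_ffun_cons _ (fun t => phi (x + t))).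
set t := s * Num.sqrt m%:R in IH *.
have t0 : 0 <= t by rewrite mulr_ge0 ?sqrtr_ge0.
have h1 : `|mean (fun j => mean (fun r : {ffun 'I_m -> I} => phi (x + (c j + resampled_sum r))))
     - mean (fun j => G t phi (x + c j))| <= m%:R * lindeberg_error M.
  apply: mean_near => // j.
  have := IH (x + c j); congr (`|mean _ - _| <= _).
  by apply/funext => r; rewrite addrA.
have h2 : `|G t (fun y => mean (fun j => phi (y + c j))) x - G t (G s phi) x| <= lindeberg_error M.
  apply: smoothing_near.
  - split.
      apply: measurable_funM => //; apply: measurable_sum => j.
      apply: (measurableT_comp um.1); exact: measurable_funD.
    move=> y; apply/andP; split.
      rewrite -(mean_cst 0 I_gt0).
      by apply: le_mean => j; have /andP[] := phi01 (y + c j).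
    rewrite -(mean_cst 1 I_gt0).
    by apply: le_mean => j; have /andP[] := phi01 (y + c j).
  - exact: unit_measurable_smoothing.
  - by move=> y; exact: lindeberg_step.
have h3 : G t (G s phi) x = G (s * Num.sqrt m.+1%:R) phi x.
  rewrite smoothing_comp ?sqrtr_ge0//; congr (G _ phi x).
  rewrite /t exprMn (sqr_sqrtr (ler0n _ _)) -[X in _ + X]mulr1 -mulrDr natr1 sqrtrM ?sqr_ge0//.
  by rewrite sqrtr_sqr ger0_norm ?sqrtr_ge0.
rewrite (smoothing_mean c t x um) h3 in h2.
have -> : m.+1%:R * lindeberg_error M = m%:R * lindeberg_error M + lindeberg_error M.
  by rewrite -natr1 mulrDl mul1r.
rewrite -/(mean _) in h2.
rewrite [X in `|X|](_ : _ = (mean (fun j => mean (fun r : {ffun 'I_m -> I} =>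
   phi (x + (c j + resampled_sum r)))) - mean (fun j => G t phi (x + c j))) +
   (mean (fun j => G t phi (x + c j)) - G (s * Num.sqrt m.+1%:R) phi x)).
  by apply: (le_trans (ler_normD _ _)); exact: lerD.
by rewrite addrA subrK.
Qed.

End one_step.

(** A truncated power function, as used to build cubic splines. *)
Definition pos_cube (t : R) : R := Num.max t 0 ^+ 3.

Lemma pos_cube_pos t : 0 <= t -> pos_cube t = t ^+ 3.
Proof. by move=> t0; rewrite /pos_cube max_l. Qed.

Lemma pos_cube_neg t : t <= 0 -> pos_cube t = 0.
Proof. by move=> t0; rewrite /pos_cube max_r// expr0n. Qed.

Lemma continuous_pos_cube : continuous pos_cube.
Proof.
move=> t; apply: (@continuous_comp _ _ _ (fun t : R => Num.max t 0) (fun t => t ^+ 3)).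
  by apply: continuous_max; [exact: cvg_id|exact: cvg_cst].
exact: exprn_continuous.
Qed.

(** The second-order part is that of the cubic on the right of 0 and zero on the
left; both choices keep the remainder below the cube when [t] and [t + h] are
on different sides of 0. *)
Lemma pos_cube_taylor t : exists a b, forall h,
  `|pos_cube (t + h) - pos_cube t - a * h - b * h ^+ 2| <= `|h| ^+ 3.
Proof.
have cube_le (u v : R) : 0 <= u -> u <= v -> u ^+ 3 <= v ^+ 3.
  by move=> u0 uv; rewrite lerXn2r// nnegrE// (le_trans u0).
have [t0|/ltW t0] := leP 0 t.
- exists (3 * t ^+ 2), (3 * t) => h; have [th|th] := leP 0 (t + h).
    rewrite !pos_cube_pos// -normrX (_ : (t + h) ^+ 3 - _ - _ - _ = h ^+ 3)//.
    by ring.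
  have h0 : h <= 0 by lra.
  rewrite (pos_cube_pos t0) (pos_cube_neg (ltW th)) ler0_norm ?(ler0_norm h0); last first.
    have := mulr_ge0 t0 (sqr_ge0 (t + 3 / 2 * h)); have := mulr_ge0 t0 (sqr_ge0 h); nra.
  have := @exprn_ge0 _ 3 (- (t + h)); rewrite oppr_ge0 (ltW th) => /(_ isT); lra.
- exists 0, 0 => h; rewrite !mul0r !subr0 (pos_cube_neg t0) subr0.
  have [th|/ltW th] := leP 0 (t + h); last by rewrite (pos_cube_neg th) normr0 exprn_ge0.
  rewrite pos_cube_pos// !ger0_norm ?exprn_ge0//; last by lra.
  by apply: cube_le => //; lra.
Qed.

(** The integral of the quadratic B-spline with knots 0, 1, 2, 3: it climbs from
0 to 1 between 0 and 3, and its pieces are cubic, so that [cubic_remainder] is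
elementary. *)
Definition smooth_step (t : R) : R :=
  (pos_cube t - 3 * pos_cube (t - 1) + 3 * pos_cube (t - 2) - pos_cube (t - 3)) / 6.

Lemma continuous_smooth_step : continuous smooth_step.
Proof.
have csub (u : R) : continuous (fun t : R => pos_cube (t - u)).
  move=> t; apply: (@continuous_comp _ _ _ (fun t : R => t - u)).
    by apply: cvgB; [exact: cvg_id|exact: cvg_cst].
  exact: continuous_pos_cube.
move=> t; apply: cvgM; last exact: cvg_cst.
apply: cvgB; last exact: csub.
apply: cvgD; last by apply: cvgMr; exact: csub.
apply: cvgB; first exact: continuous_pos_cube.
by apply: cvgMr; exact: csub.
Qed.

Lemma smooth_step0 t : t <= 0 -> smooth_step t = 0.
Proof. by move=> t0; rewrite /smooth_step !pos_cube_neg; lra. Qed.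

Lemma smooth_step1 t : 3 <= t -> smooth_step t = 1.
Proof. by move=> t0; rewrite /smooth_step !pos_cube_pos; try lra; field. Qed.

Lemma smooth_step01 t : 0 <= smooth_step t <= 1.
Proof.
rewrite /smooth_step.
have [t0|t0] := leP t 0; first by rewrite !pos_cube_neg; lra.
have [t1|t1] := leP t 1.
  rewrite (pos_cube_pos (ltW t0)) !pos_cube_neg; try lra.
  have : t ^+ 3 <= 1 by rewrite exprn_ile1// ltW.
  by have := exprn_ge0 3 (ltW t0); lra.
have [t2|t2] := leP t 2.
  rewrite (pos_cube_pos (ltW t0)) (@pos_cube_pos (t - 1)) ?(@pos_cube_neg (t - 2)) ?(@pos_cube_neg (t - 3)); try lra.
  have u0 : 0 <= t - 1 by lra.
  have u1 : 0 <= 2 - t by lra.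
  have := mulr_ge0 (sqr_ge0 (t - 1)) u1; have := mulr_ge0 u0 u1.
  have := sqr_ge0 (t - 1); have : 0 <= (2 - t) ^+ 2 * (t + 1) by rewrite mulr_ge0 ?sqr_ge0//; lra.
  by move=> *; apply/andP; split; lra.
have [t3|t3] := leP t 3.
  rewrite (pos_cube_pos (ltW t0)) (@pos_cube_pos (t - 1)) ?(@pos_cube_pos (t - 2)) ?(@pos_cube_neg (t - 3)); try lra.
  have := exprn_ge0 3 (_ : 0 <= 3 - t); rewrite subr_ge0 => /(_ t3) h.
  have : (3 - t) ^+ 3 <= 1 by rewrite exprn_ile1; lra.
  by move=> h'; apply/andP; split; lra.
by rewrite !pos_cube_pos; lra.
Qed.

Lemma smooth_step_taylor : cubic_remainder (4 / 3) smooth_step.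
Proof.
move=> t.
have [a0 [b0 h0]] := pos_cube_taylor t.
have [a1 [b1 h1]] := pos_cube_taylor (t - 1).
have [a2 [b2 h2]] := pos_cube_taylor (t - 2).
have [a3 [b3 h3]] := pos_cube_taylor (t - 3).
exists ((a0 - 3 * a1 + 3 * a2 - a3) / 6), ((b0 - 3 * b1 + 3 * b2 - b3) / 6) => h.
have {}h0 := h0 h; have {}h1 := h1 h; have {}h2 := h2 h; have {}h3 := h3 h.
rewrite /smooth_step !(addrAC t h).
rewrite !ler_norml in h0 h1 h2 h3 *.
move: h0 h1 h2 h3 => /andP[? ?] /andP[? ?] /andP[? ?] /andP[? ?].
by apply/andP; split; lra.
Qed.

(** A smooth minorant of the indicator of [y <= tau] that is 1 below
[tau - 3 * delta]. *)
Definition smooth_indicator (tau delta y : R) : R :=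
  smooth_step ((tau - y) / delta).

Lemma smooth_indicator01 tau delta y : 0 <= smooth_indicator tau delta y <= 1.
Proof. exact: smooth_step01. Qed.

Lemma continuous_smooth_indicator tau delta : continuous (smooth_indicator tau delta).
Proof.
move=> y; apply: (@continuous_comp _ _ _ (fun y : R => (tau - y) / delta)).
  apply: cvgM; last exact: cvg_cst.
  by apply: cvgB; [exact: cvg_cst|exact: cvg_id].
exact: continuous_smooth_step.
Qed.

Lemma smooth_indicator_taylor tau delta : 0 < delta ->
  cubic_remainder (4 / 3 / delta ^+ 3) (smooth_indicator tau delta).
Proof.
move=> d0 y; have [a [b hab]] := smooth_step_taylor ((tau - y) / delta).
exists (- a / delta), (b / delta ^+ 2) => h.
have := hab (- h / delta); rewrite normrM normrN normfV (gtr0_norm d0).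
rewrite /smooth_indicator (_ : (tau - (y + h)) / delta = (tau - y) / delta + - h / delta); last first.
  by rewrite -mulrDl; congr (_ / _); ring.
rewrite (_ : - a / delta * h = a * (- h / delta)); last by ring.
rewrite (_ : b / delta ^+ 2 * h ^+ 2 = b * (- h / delta) ^+ 2); last first.
  by field; rewrite gt_eqF.
move/le_trans; apply.
by rewrite expr_div_n le_eqVlt; apply/orP; left; apply/eqP; field; rewrite gt_eqF.
Qed.

Lemma smooth_indicator_le tau delta y : 0 < delta ->
  smooth_indicator tau delta y <= (y <= tau)%R%:R.
Proof.
move=> d0; have [_|ytau] := leP y tau.
  by have /andP[] := smooth_indicator01 tau delta y.
rewrite /smooth_indicator smooth_step0//.
by rewrite mulr_le0_ge0 ?invr_ge0 ?subr_le0 // ltW.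
Qed.

Lemma smooth_indicator_ge tau delta y : 0 < delta ->
  (y <= tau - 3 * delta)%R%:R <= smooth_indicator tau delta y.
Proof.
move=> d0; have [ytau|_] := leP y (tau - 3 * delta); last first.
  by have /andP[] := smooth_indicator01 tau delta y.
by rewrite /smooth_indicator smooth_step1// ler_pdivlMr//; lra.
Qed.

Definition normal_cdf (s t : R) : R := fine (normal_prob 0 1 [set z : R | s * z <= t]).

Let measurable_halfline (s t : R) : measurable [set z : R | s * z <= t].
Proof.
rewrite -[X in measurable X]setTI; exact: measurable_fun_le.
Qed.

Lemma normal_cdfE s t : normal_cdf s t = \int[mu]_z ((s * z <= t)%R%:R * g01 z).
Proof.
rewrite /normal_cdf /normal_prob /Rintegral; congr fine.
rewrite [LHS]integral_mkcond; congr (integral _ _ _); apply/funext => z.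
rewrite /patch; case: ifPn => [|]; first by rewrite inE /= => ->; rewrite mul1r.
by rewrite notin_setE /= => /negP/negbTE ->; rewrite mul0r.
Qed.

Lemma unit_measurable_halfline (t : R) : unit_measurable (fun y : R => (y <= t)%R%:R).
Proof.
split=> [|y]; last by case: (y <= t); rewrite ?lexx ?ler01.
rewrite (_ : (fun _ => _) = \1_[set y : R | y <= t]).
  apply: measurable_indic; have := measurable_halfline 1 t.
  by under eq_set do rewrite mul1r.
by apply/funext => y; rewrite indicE mem_setE.
Qed.

Lemma normal_cdf_smoothing s t : normal_cdf s t = G s (fun y => (y <= t)%R%:R) 0.
Proof. by rewrite normal_cdfE; apply: eq_Rintegral => z _; rewrite add0r. Qed.

Lemma le_smoothing phi phi' s x : unit_measurable phi -> unit_measurable phi' ->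
  (forall y, phi y <= phi' y) -> G s phi x <= G s phi' x.
Proof.
move=> um um' le; apply: le_Rintegral => //; try exact: integrable_smoothing.
by move=> z _; rewrite ler_wpM2r ?gaussian_density_ge0.
Qed.

(** The density of [s] times a standard normal variable is at most
[normal_peak 1 / s]. *)
Lemma normal_cdf_lip s t d : 0 < s -> 0 <= d ->
  normal_cdf s (t + d) <= normal_cdf s t + normal_peak 1 * d / s.
Proof.
move=> s0 d0.
have inc : [set z : R | s * z <= t + d] =
    [set z : R | s * z <= t] `|` `]t / s, (t + d) / s].
  apply/seteqP; split=> z /=; rewrite in_itv/= ltr_pdivrMr// ler_pdivlMr// (mulrC z).
    by move=> h; have [|h'] := leP (s * z) t; [left|right].
  by case=> [h|/andP[]//]; rewrite (le_trans h)// lerDl.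
rewrite /normal_cdf inc.
have fin (A : set R) : measurable A -> normal_prob 0 1 A \is a fin_num.
  by move=> mA; exact: fin_num_measure.
have mi : measurable (`]t / s, (t + d) / s] : set R) by [].
have mA := measurable_halfline s t.
set A := [set z : R | s * z <= t] in mA *; set B := `]t / s, (t + d) / s]%classic in mi *.
apply: (@le_trans _ _ (fine (normal_prob 0 1 A + normal_prob 0 1 B)%E)).
  apply: fine_le.
  - by apply: fin; exact: measurableU.
  - by rewrite fin_numD !fin.
  - by apply: measureU2.
rewrite fineD ?fin// lerD2l.
rewrite -[leRHS]/(fine (normal_peak 1 * d / s)%:E); apply: fine_le => //; first exact: fin.
rewrite /normal_prob.
apply: (@le_trans _ _ (\int[mu]_(z in B) (normal_peak 1)%:E)%E).
  apply: ge0_le_integral => //.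
  - by move=> z _; rewrite lee_fin normal_pdf_ge0.
  - by apply/measurable_EFinP; apply: measurable_funTS; exact: measurable_normal_pdf.
  - by move=> z _; rewrite lee_fin normal_pdf_ub ?oner_eq0.
rewrite integral_cst//= lebesgue_measure_itv/= lte_fin.
case: ifPn => _; last first.
  by rewrite mule0 lee_fin mulr_ge0 ?mulr_ge0 ?normal_peak_ge0 ?invr_ge0// ltW.
by rewrite -EFinD -EFinM lee_fin -mulrBl addrAC subrr add0r mulrA.
Qed.

Section two_samples.
Context (k : nat) (c' c'' : 'I_k -> R) (sigma tau delta : R).
Hypotheses (k_gt0 : (0 < k)%N) (c'0 : mean c' = 0) (c''0 : mean c'' = 0).
Hypotheses (delta_gt0 : 0 < delta) (sigma_ge0 : 0 <= sigma).
Hypothesis variance : k%:R * (mean (fun i => c' i ^+ 2) + mean (fun i => c'' i ^+ 2)) = sigma ^+ 2.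

Let T : finType := ({ffun 'I_k -> 'I_k} * {ffun 'I_k -> 'I_k})%type.
Let S (r : T) : R := resampled_sum c' r.1 + resampled_sum c'' r.2.
Let M : R := 4 / 3 / delta ^+ 3.
Let phi : R -> R := smooth_indicator tau delta.

(** The sum of the costs of the [k + k] exchanges. *)
Definition resampling_error : R :=
  k%:R * (lindeberg_error c' M + lindeberg_error c'' M).

Let cardk : (0 < #|'I_k|)%N. Proof. by rewrite card_ord. Qed.

Let cardT0 : (0 < #|{ffun 'I_k -> 'I_k}|)%N.
Proof. by rewrite card_ffun !card_ord expn_gt0 k_gt0. Qed.

Lemma mean_pair (F : T -> R) : mean F = mean (fun r1 => mean (fun r2 => F (r1, r2))).
Proof.
rewrite /mean card_prod natrM invfM -mulrA -mulr_sumr; congr (_ * (_ * _)).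
rewrite (pair_big xpredT xpredT (fun r1 r2 => F (r1, r2))) /=.
by apply: eq_bigr => -[].
Qed.

(** The two samples are exchanged one after the other, the second one
conditionally on the draws from the first. *)
Lemma smooth_resampling_clt : `|mean (fun r => phi (S r)) - G sigma phi 0| <= resampling_error.
Proof.
have cphi : continuous phi by exact: continuous_smooth_indicator.
have phi01 y : 0 <= phi y <= 1 by exact: smooth_indicator01.
have taylor : cubic_remainder M phi by exact: smooth_indicator_taylor.
have um : unit_measurable phi by split => //; exact: continuous_measurable_fun.
pose a := Num.sqrt (mean (fun i => c' i ^+ 2)) * Num.sqrt k%:R.
pose b := Num.sqrt (mean (fun i => c'' i ^+ 2)) * Num.sqrt k%:R.
have a0 : 0 <= a by rewrite mulr_ge0 ?sqrtr_ge0.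
have b0 : 0 <= b by rewrite mulr_ge0 ?sqrtr_ge0.
have sqr0 (c : 'I_k -> R) : 0 <= mean (fun i => c i ^+ 2).
  by rewrite mulr_ge0 ?invr_ge0// sumr_ge0// => i _; exact: sqr_ge0.
have -> : G sigma phi 0 = G b (G a phi) 0.
  rewrite smoothing_comp//; congr (G _ phi 0).
  rewrite -[LHS](ger0_norm sigma_ge0) -sqrtr_sqr -variance /a /b !exprMn.
  by rewrite !(sqr_sqrtr (sqr0 _)) sqr_sqrtr//; congr Num.sqrt; ring.
rewrite mean_pair.
have h1 : `|mean (fun r1 : {ffun 'I_k -> 'I_k} => mean (fun r2 : {ffun 'I_k -> 'I_k} => phi (S (r1, r2)))) -
    mean (fun r1 : {ffun 'I_k -> 'I_k} => G b phi (0 + resampled_sum c' r1))| <= k%:R * lindeberg_error c'' M.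
  apply: mean_near => // r1; rewrite add0r.
  exact: (lindeberg_iter cardk c''0 k (resampled_sum c' r1) cphi phi01 taylor).
have h2 : `|mean (fun r1 : {ffun 'I_k -> 'I_k} => G b phi (0 + resampled_sum c' r1)) - G b (G a phi) 0|
    <= k%:R * lindeberg_error c' M.
  rewrite /mean -smoothing_mean//; apply: smoothing_near.
  - split.
      apply: measurable_funM => //; apply: measurable_sum => j.
      by apply: (measurableT_comp um.1); exact: measurable_funD.
    move=> y; apply/andP; split.
      rewrite -[leLHS](mean_cst 0 cardT0).
      by apply: le_mean => j; have /andP[] := phi01 (y + resampled_sum c' j).
    rewrite -[leRHS](mean_cst 1 cardT0).
    by apply: le_mean => j; have /andP[] := phi01 (y + resampled_sum c' j).
  - exact: unit_measurable_smoothing.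
  - by move=> y; exact: (lindeberg_iter cardk c'0 k y cphi phi01 taylor).
rewrite /resampling_error mulrDr [leRHS]addrC.
rewrite [X in `|X|](_ : _ = (mean (fun r1 : {ffun 'I_k -> 'I_k} => mean (fun r2 : {ffun 'I_k -> 'I_k} => phi (S (r1, r2)))) -
    mean (fun r1 : {ffun 'I_k -> 'I_k} => G b phi (0 + resampled_sum c' r1))) +
    (mean (fun r1 : {ffun 'I_k -> 'I_k} => G b phi (0 + resampled_sum c' r1)) - G b (G a phi) 0)).
  by apply: (le_trans (ler_normD _ _)); exact: lerD.
by rewrite addrA subrK.
Qed.

(** The indicator of a half-line is caught between two smooth indicators whose
thresholds differ by [3 * delta]. *)
Lemma resampling_clt_ub :
  mean (fun r => (S r <= tau - 3 * delta)%R%:R) <= normal_cdf sigma tau + resampling_error.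
Proof.
apply: (@le_trans _ _ (mean (fun r => phi (S r)))).
  by apply: le_mean => r; exact: smooth_indicator_ge.
have := smooth_resampling_clt; rewrite ler_norml => /andP[_].
rewrite lerBlDl => /le_trans; apply; rewrite lerD2r normal_cdf_smoothing.
apply: le_smoothing => [||y]; [|exact: unit_measurable_halfline|exact: smooth_indicator_le].
split => [|y]; last exact: smooth_indicator01.
by apply: continuous_measurable_fun; exact: continuous_smooth_indicator.
Qed.

Lemma resampling_clt_lb :
  normal_cdf sigma (tau - 3 * delta) - resampling_error <= mean (fun r => (S r <= tau)%R%:R).
Proof.
apply: (@le_trans _ _ (mean (fun r => phi (S r)))); last first.
  by apply: le_mean => r; exact: smooth_indicator_le.
have := smooth_resampling_clt; rewrite ler_norml => /andP[+ _].
rewrite lerNl opprB lerBlDl -lerBlDr => h; apply: le_trans h; rewrite lerB// normal_cdf_smoothing.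
apply: le_smoothing => [||y]; [exact: unit_measurable_halfline| |exact: smooth_indicator_ge].
split => [|y]; last exact: smooth_indicator01.
by apply: continuous_measurable_fun; exact: continuous_smooth_indicator.
Qed.

End two_samples.

End lindeberg.

(** * The bootstrap error of the two-point regression *)

Section two_point_regression.
Context {R : realType}.
Context (k : nat) (L U : R) (y' y'' : 'I_k -> R).
Hypotheses (k_gt0 : (0 < k)%N) (LU : L < U).

Let k_neq0 : k%:R != 0 :> R. Proof. by rewrite pnatr_eq0 -lt0n. Qed.

Let design := [seq (L, y' i) | i : 'I_k] ++ [seq (U, y'' i) | i : 'I_k].

Let sum_sqrB (y : 'I_k -> R) (u : R) :
  \sum_i (y i - u) ^+ 2 = \sum_i (y i - mean y) ^+ 2 + k%:R * (mean y - u) ^+ 2.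
Proof.
have sumy : \sum_i y i = k%:R * mean y by rewrite /mean card_ord mulrA divff// mul1r.
transitivity (\sum_i ((y i - mean y) ^+ 2 + (2 * (mean y - u)) * (y i - mean y) + (mean y - u) ^+ 2)).
  by apply: eq_bigr => i _; ring.
rewrite !big_split /= -mulr_sumr sumrB sumy !sumr_const card_ord.
by rewrite -[mean y *+ k]mulr_natl subrr mulr0 addr0 mulr_natl.
Qed.

Let rssE b : rss design b =
  \sum_i (y' i - mean y') ^+ 2 + \sum_i (y'' i - mean y'') ^+ 2 +
  k%:R * ((mean y' - (b.1 + b.2 * L)) ^+ 2 + (mean y'' - (b.1 + b.2 * U)) ^+ 2).
Proof.
have sumI (F : R * R -> R) (E : 'I_k -> R * R) :
    \sum_(q <- [seq E i | i : 'I_k]) F q = \sum_i F (E i).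
  by rewrite big_map big_enum.
by rewrite /rss big_cat /= !sumI /= (sum_sqrB y' _) (sum_sqrB y'' _); ring.
Qed.

(** The residual sum of squares is the variation within the samples plus [k] times
the squared distances of the two fitted values to the two means; a line
through two points makes both distances zero. *)
Lemma least_squares_line_two_points :
  least_squares_line design =
    let slope := (mean y'' - mean y') / (U - L) in
    (mean y' - slope * L, slope).
Proof.
rewrite /=; set slope := (_ / _); set b := (X in _ = X).
have UL : U - L != 0 by rewrite subr_eq0 gt_eqF.
have b1 : b.1 + b.2 * L = mean y' by rewrite /b /= subrK.
have b2 : b.1 + b.2 * U = mean y'' by rewrite /b /= /slope; field.
have : [set b : R * R | forall c, rss design b <= rss design c] b.
  move=> c; rewrite !rssE lerD2l b1 b2 !subrr expr0n/= addr0 mulr0.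
  by rewrite mulr_ge0 ?addr_ge0 ?sqr_ge0.
move=> bmin; rewrite /least_squares_line.
set A := (X in get X); have : A (get A) by apply: getPex; exists b.
move: (get A) => c /(_ b); rewrite !rssE lerD2l b1 b2 !subrr expr0n/= addr0 mulr0.
rewrite pmulr_rle0 ?ltr0n// => le0.
have [s1 s2] := (sqr_ge0 (mean y' - (c.1 + c.2 * L)), sqr_ge0 (mean y'' - (c.1 + c.2 * U))).
have /eqP : (mean y' - (c.1 + c.2 * L)) ^+ 2 = 0 by lra.
have /eqP : (mean y'' - (c.1 + c.2 * U)) ^+ 2 = 0 by lra.
rewrite !sqrf_eq0 !subr_eq0 => /eqP e2 /eqP e1.
have c2 : c.2 = slope by rewrite /slope e1 e2; field.
by rewrite [LHS]surjective_pairing /b -c2 e1 addrK.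
Qed.

Lemma dtilde2_two_points theta0 : mean y' != mean y'' ->
  dtilde2 theta0 L U y' y'' =
    L + (U - L) * (theta0 - mean y') / (mean y'' - mean y').
Proof.
move=> neq; rewrite /dtilde2 least_squares_line_two_points /=; field.
by rewrite subr_eq0 eq_sym neq subr_eq0 gt_eqF.
Qed.

End two_point_regression.

Section resampling_moments.
Context {R : realType}.

(** The shift [x] is there for the induction on the number of draws. *)
Lemma resampled_sum_sqr (I : finType) (c : I -> R) m x : (0 < #|I|)%N ->
  mean c = 0 ->
  mean (fun r : {ffun 'I_m -> I} => (x + resampled_sum c r) ^+ 2) =
  x ^+ 2 + m%:R * mean (fun i => c i ^+ 2).
Proof.
move=> I0 c0; elim: m x => [|m IH] x.
  under eq_fun do rewrite /resampled_sum big_ord0 addr0.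
  by rewrite mean_cst ?mul0r ?addr0// card_ffun card_ord expn0.
rewrite (mean_ffun_cons _ _ (fun t => (x + t) ^+ 2)).
under [X in mean X]eq_fun do under eq_fun do rewrite addrA.
under eq_fun do rewrite IH.
transitivity (mean (fun j => x ^+ 2 + 2 * x * c j + c j ^+ 2 + m%:R * mean (fun i => c i ^+ 2))).
  by congr mean; apply/funext => j; ring.
rewrite !meanD !mean_cst// meanZ c0 -natr1; ring.
Qed.

Lemma resampled_sum_chebyshev (I : finType) (c : I -> R) m t : (0 < #|I|)%N ->
  mean c = 0 -> 0 < t ->
  mean (fun r : {ffun 'I_m -> I} => (t < `|resampled_sum c r|)%R%:R) <=
  m%:R * mean (fun i => c i ^+ 2) / t ^+ 2.
Proof.
move=> I0 c0 t0.
rewrite ler_pdivlMr ?exprn_gt0// mulrC -[leLHS]meanZ.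
have := resampled_sum_sqr m 0 I0 c0; rewrite expr0n/= add0r => <-.
apply: le_mean => r; rewrite add0r; case: ltP => h; last by rewrite mulr0 sqr_ge0.
rewrite /= mulr1n mulr1 -[leRHS]real_normK ?num_real//.
by rewrite lerXn2r ?nnegrE ?(ltW t0)// ltW.
Qed.

End resampling_moments.

Lemma perturbed_gt0 {R : realType} (D t x' x'' : R) :
  2 * t < D -> `|x'| <= t -> `|x''| <= t -> 0 < D + x'' - x'.
Proof. by rewrite !ler_norml => ? /andP[? ?] /andP[? ?]; lra. Qed.

Lemma le_indicators {R : realType} (w s p q : bool) :
  (w -> ~~ p -> ~~ q -> s) -> w%:R <= s%:R + (p%:R + q%:R) :> R.
Proof.
by case: w; case: s; case: p; case: q => //= h; rewrite ?mulr1n ?mulr0n; try lra;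
  have := h isT isT isT.
Qed.

Section bootstrap_bound.
Context {R : realType}.
Context (theta0 L U : R) (n k : nat) (y' y'' : 'I_k -> R).
Hypotheses (k_gt0 : (0 < k)%N) (LU : L < U).
Let a := mean y' - theta0.
Let b := mean y'' - theta0.
Let D := mean y'' - mean y'.
Let v' := mean (fun i => (y' i - mean y') ^+ 2).
Let v'' := mean (fun i => (y'' i - mean y'') ^+ 2).
Let V := v' + v''.
Context (C M delta : R).
Hypotheses (C_gt0 : 0 < C) (M_gt0 : 0 < M) (delta_gt0 : 0 < delta).
Hypothesis V_gt0 : 0 < V.
Let t := M / Num.sqrt k%:R.
Hypothesis slope_gt0 : 2 * t < D.
Hypothesis linearization : forall x' x'', `|x'| <= t -> `|x''| <= t ->
  `|Num.sqrt n%:R * (U - L) * (a * x'' - b * x') / (D * (D + x'' - x'))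
    + C / Num.sqrt (V / k%:R) * (x' + x'')| <= delta.

Let q := - (C / Num.sqrt (V / k%:R)).

(** One draw's share of the linear part of the bootstrap error, scaled so that the
sum over all the draws has standard deviation exactly [C]. *)
Definition studentized (y : 'I_k -> R) (i : 'I_k) : R := q * ((y i - mean y) / k%:R).

Let k_neq0 : k%:R != 0 :> R. Proof. by rewrite pnatr_eq0 -lt0n. Qed.
Let cardk : (0 < #|'I_k|)%N. Proof. by rewrite card_ord. Qed.
Let cardT : (0 < #|{ffun 'I_k -> 'I_k}|)%N.
Proof. by rewrite card_ffun !card_ord expn_gt0 k_gt0. Qed.

Let xi (y : 'I_k -> R) (r : {ffun 'I_k -> 'I_k}) : R :=
  resampled_sum (fun i => (y i - mean y) / k%:R) r.

Let centered (y : 'I_k -> R) : mean (fun i : 'I_k => (y i - mean y) / k%:R) = 0.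
Proof.
rewrite (_ : (fun i => _) = fun i => k%:R^-1 * (y i - mean y)).
  by rewrite meanZ meanB mean_cst// subrr mulr0.
by apply/funext => i; rewrite mulrC.
Qed.

Let mean_resample (y : 'I_k -> R) (r : {ffun 'I_k -> 'I_k}) :
  mean (fun i : 'I_k => y (r i)) = mean y + xi y r.
Proof.
rewrite /xi /resampled_sum -mulr_suml sumrB sumr_const card_ord mulrBl.
by rewrite -[mean y *+ k]mulr_natr mulfK// /mean card_ord; ring.
Qed.

Let xi_sqr (y : 'I_k -> R) : k%:R * mean (fun i : 'I_k => ((y i - mean y) / k%:R) ^+ 2) =
  mean (fun i : 'I_k => (y i - mean y) ^+ 2) / k%:R.
Proof.
rewrite (_ : (fun i => _) = fun i => (k%:R ^+ 2)^-1 * (y i - mean y) ^+ 2).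
  by rewrite meanZ; field.
by apply/funext => i; rewrite expr_div_n mulrC.
Qed.

Let sqrtk : 0 < Num.sqrt k%:R :> R. Proof. by rewrite sqrtr_gt0 ltr0n. Qed.
Let t_gt0 : 0 < t. Proof. by rewrite divr_gt0. Qed.

Let T : finType := ({ffun 'I_k -> 'I_k} * {ffun 'I_k -> 'I_k})%type.
Let S (r : T) : R :=
  resampled_sum (studentized y') r.1 + resampled_sum (studentized y'') r.2.

Let SE r : S r = q * (xi y' r.1 + xi y'' r.2).
Proof. by rewrite /S /xi /resampled_sum -!mulr_sumr mulrDr. Qed.

Let W (r : T) : R := Num.sqrt n%:R *
  (dtilde2 theta0 L U (fun i => y' (r.1 i)) (fun i => y'' (r.2 i))
   - dtilde2 theta0 L U y' y'').

Let WE r : `|xi y' r.1| <= t -> `|xi y'' r.2| <= t -> `|W r - S r| <= delta.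
Proof.
move=> h' h''; rewrite SE; apply: le_trans (linearization h' h'').
move: h' h''; set x' := xi y' r.1; set x'' := xi y'' r.2 => h' h''.
have D0 : 0 < D by apply: lt_trans slope_gt0; rewrite mulr_gt0.
have Ds0 : 0 < D + x'' - x' := perturbed_gt0 slope_gt0 h' h''.
rewrite /W !dtilde2_two_points//; last 2 first.
- by rewrite lt_eqF// -subr_gt0.
- by rewrite !mean_resample -/x' -/x'' lt_eqF// -subr_gt0; move: Ds0; rewrite /D; congr (0 < _); ring.
rewrite le_eqVlt; apply/orP; left; apply/eqP; congr (`|_|).
rewrite !mean_resample -/x' -/x'' /q /a /b.
set s := C / _.
have -> : mean y'' + x'' - (mean y' + x') = D + x'' - x' by rewrite /D; ring.
rewrite mulNr opprK; congr (_ + _).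
have -> : mean y'' = mean y' + D by rewrite /D; ring.
have -> : mean y' + D - mean y' = D by ring.
by field; rewrite !gt_eqF.
Qed.

Let bootstrap_cdfE s : bootstrap_cdf theta0 L U n y' y'' s =
  mean (fun r : T => (W r <= s)%R%:R).
Proof.
rewrite /bootstrap_cdf /resampling_prob /mean mulrC; congr (_ * _).
rewrite -sum1_card natr_sum big_mkcond /=; apply: eq_bigr => r _.
rewrite inE /= -/(W r).
by case: (boolP (W r <= s)) => h; [rewrite asboolT|rewrite asboolF//; apply/negP].
Qed.

Let far : R := mean (fun r : T => (t < `|xi y' r.1|)%R%:R + (t < `|xi y'' r.2|)%R%:R).

Let far_le : far <= V / M ^+ 2.
Proof.
have t2 : t ^+ 2 = M ^+ 2 / k%:R by rewrite expr_div_n sqr_sqrtr.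
have M0 : M != 0 by rewrite gt_eqF.
rewrite /far meanD /V mulrDl; apply: lerD.
  rewrite mean_pair; under eq_fun do rewrite /= mean_cst//.
  apply: le_trans (resampled_sum_chebyshev k cardk (centered y') t_gt0) _.
  by rewrite xi_sqr t2 -/v' le_eqVlt; apply/orP; left; apply/eqP; field; rewrite M0.
rewrite mean_pair; under eq_fun do rewrite /=.
rewrite mean_cst//.
apply: le_trans (resampled_sum_chebyshev k cardk (centered y'') t_gt0) _.
by rewrite xi_sqr t2 -/v'' le_eqVlt; apply/orP; left; apply/eqP; field; rewrite M0.
Qed.

Let W_le_S s r : ((W r <= s)%R%:R <= (S r <= s + delta)%R%:R +
  ((t < `|xi y' r.1|)%R%:R + (t < `|xi y'' r.2|)%R%:R) :> R)%R.
Proof.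
apply: le_indicators => hW; rewrite -!leNgt => h' h''.
by have := WE h' h''; rewrite ler_norml => /andP[h1 h2]; rewrite -subr_ge0; lra.
Qed.

Let S_le_W s r : ((S r <= s - delta)%R%:R <= (W r <= s)%R%:R +
  ((t < `|xi y' r.1|)%R%:R + (t < `|xi y'' r.2|)%R%:R) :> R)%R.
Proof.
apply: le_indicators => hW; rewrite -!leNgt => h' h''.
by have := WE h' h''; rewrite ler_norml => /andP[h1 h2]; rewrite -subr_ge0; lra.
Qed.

Let studentized0 y : mean (studentized y) = 0.
Proof. by rewrite meanZ centered mulr0. Qed.

Let studentized_var : k%:R * (mean (fun i => studentized y' i ^+ 2) +
   mean (fun i => studentized y'' i ^+ 2)) = C ^+ 2.
Proof.
have e y : mean (fun i => studentized y i ^+ 2) =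
    q ^+ 2 * mean (fun i => ((y i - mean y) / k%:R) ^+ 2).
  by rewrite -meanZ; congr mean; apply/funext => i; rewrite exprMn.
rewrite !e -mulrDr mulrCA mulrDr !xi_sqr -mulrDl -/v' -/v'' -/V.
rewrite /q sqrrN expr_div_n sqr_sqrtr ?divr_ge0 ?(ltW V_gt0)//.
by field; rewrite k_neq0 gt_eqF.
Qed.

(** Chebyshev's inequality bounds by [V / M ^+ 2] the probability that a resampled
mean moves by more than [t]. Elsewhere the bootstrap error is within [delta]
of its linear part, to which the resampling central limit theorem applies. The
first term pays for moving the threshold of the normal law by [4 * delta]:
once [delta] for the linearization, three times for the smooth indicator. *)
Lemma bootstrap_cdf_near_normal s :
  `|bootstrap_cdf theta0 L U n y' y'' s - normal_cdf C s| <=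
  normal_peak 1 * (4 * delta) / C
  + resampling_error (studentized y') (studentized y'') delta + V / M ^+ 2.
Proof.
rewrite bootstrap_cdfE ler_distl; apply/andP; split.
  have := le_mean (S_le_W s); rewrite meanD -/far => h.
  have := resampling_clt_lb (s - delta) k_gt0 (studentized0 y') (studentized0 y'')
    delta_gt0 (ltW C_gt0) studentized_var.
  have := normal_cdf_lip (s - delta - 3 * delta) C_gt0 (_ : 0 <= 4 * delta).
  rewrite (_ : s - delta - 3 * delta + 4 * delta = s); last by ring.
  rewrite mulr_ge0 ?(ltW delta_gt0)// => /(_ isT).
  by have := far_le; rewrite -/S; lra.
have := le_mean (W_le_S s); rewrite meanD -/far => h.
have := resampling_clt_ub (s + 4 * delta) k_gt0 (studentized0 y') (studentized0 y'')
    delta_gt0 (ltW C_gt0) studentized_var.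
rewrite (_ : s + 4 * delta - 3 * delta = s + delta); last by ring.
have := normal_cdf_lip s C_gt0 (_ : 0 <= 4 * delta).
rewrite mulr_ge0 ?(ltW delta_gt0)// => /(_ isT).
by have := far_le; rewrite -/S; lra.
Qed.

End bootstrap_bound.

(** * Moments of sums of independent variables *)

Section independence.
Context d (T : measurableType d) (R : realType) (P : probability T R).

Definition independent_fun (X Y : T -> R) := forall A B : set R,
  measurable A -> measurable B ->
  P (X @^-1` A `&` Y @^-1` B) = (P (X @^-1` A) * P (Y @^-1` B))%E.

Lemma independent_fun_comp (X Y : T -> R) (f1 f2 : R -> R) :
  measurable_fun setT f1 -> measurable_fun setT f2 ->
  independent_fun X Y -> independent_fun (f1 \o X) (f2 \o Y).
Proof.
move=> m1 m2 XY A B mA mB; apply: (XY (f1 @^-1` A) (f2 @^-1` B)).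
  by rewrite -[X in measurable X]setTI; exact: m1.
by rewrite -[X in measurable X]setTI; exact: m2.
Qed.

(** Independence says that the joint law is the product of the laws; Fubini then
factors the integral of the product. *)
Lemma expectation_mul_independent (X Y : T -> R) :
  P.-integrable setT (EFin \o X) -> P.-integrable setT (EFin \o Y) ->
  independent_fun X Y ->
  P.-integrable setT (EFin \o (fun w => X w * Y w)) /\
  \int[P]_w (X w * Y w) = \int[P]_w X w * \int[P]_w Y w.
Proof.
move=> iX iY XY.
have mX : measurable_fun setT X by apply/measurable_EFinP; case/integrableP : iX.
have mY : measurable_fun setT Y by apply/measurable_EFinP; case/integrableP : iY.
pose X' : {mfun T >-> R} := HB.pack X (isMeasurableFun.Build _ _ _ _ X mX).
pose Y' : {mfun T >-> R} := HB.pack Y (isMeasurableFun.Build _ _ _ _ Y mY).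
have mXY : measurable_fun setT (fun w => (X w, Y w)) by exact: measurable_fun_pair.
pose XY' : {mfun T >-> (R * R)%type} := HB.pack (fun w => (X w, Y w))
  (isMeasurableFun.Build _ _ _ _ _ mXY).
pose mu := distribution P X'; pose nu := distribution P Y'.
pose joint := distribution P XY'.
have jointE (B : set (R * R)) : measurable B -> (mu \x nu)%E B = joint B.
  apply: product_measure_unique => A1 A2 mA1 mA2.
  by rewrite /joint /distribution /pushforward /= -XY//.
have jointeq (f : R * R -> \bar R) : (\int[joint]_z f z = \int[mu \x nu]_z f z)%E.
  by apply: eq_measure_integral => B mB _; exact/esym/jointE.
pose f (z : R * R) := (z.1 * z.2)%:E.
have mf : measurable_fun setT f.
  by apply/measurable_EFinP; exact: measurable_funM.
have imu : mu.-integrable setT (EFin \o id).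
  apply/integrableP; split; first exact/measurable_EFinP.
  rewrite (ge0_integral_distribution X' (f := fun x : R => `|x%:E|%E)) //.
    by case/integrableP : iX.
  by apply/measurableT_comp => //; exact/measurable_EFinP.
have inu : nu.-integrable setT (EFin \o id).
  apply/integrableP; split; first exact/measurable_EFinP.
  rewrite (ge0_integral_distribution Y' (f := fun x : R => `|x%:E|%E)) //.
    by case/integrableP : iY.
  by apply/measurableT_comp => //; exact/measurable_EFinP.
have iprod : (mu \x nu)%E.-integrable setT f.
  apply/integrable12ltyP => //.
  under eq_integral do under eq_integral do rewrite /f /= normrM EFinM.
  have mabs : measurable_fun setT (fun y : R => `|y|%:E).
    by apply/measurable_EFinP; first [exact: normr_measurable|exact: measurable_normr].
  have inner (x : R) : (\int[nu]_y (`|x|%:E * `|y|%:E) = `|x|%:E * \int[nu]_y `|y|%:E)%E.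
    rewrite ge0_integralZl_EFin //.
  under eq_integral do rewrite inner.
  rewrite ge0_integralZr //.
  - have /integrableP[_ i1] := imu; have /integrableP[_ i2] := inu.
    apply: lte_mul_pinfty => //; first exact: integral_ge0.
    by rewrite ge0_fin_numE //; exact: integral_ge0.
  - by apply: integral_ge0.
have iXY : P.-integrable setT (EFin \o (fun w => X w * Y w)).
  apply/integrableP; split; first by apply/measurable_EFinP; exact: measurable_funM.
  have := @ge0_integral_distribution _ _ _ _ _ P XY' (abse \o f).
  have mabsf : measurable_fun setT (abse \o f) by exact: measurableT_comp.
  move=> /(_ mabsf (fun=> abse_ge0 _)) H.
  rewrite -[X in (X < _)%E]/(\int[P]_x ((abse \o f) \o XY') x)%E -H jointeq.
  by case/integrableP : iprod.
split => //.
rewrite /Rintegral.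
have -> : (\int[P]_w (X w * Y w)%:E = \int[mu]_x \int[nu]_y f (x, y))%E.
  rewrite (integral12_prod_meas1 iprod) -jointeq.
  by rewrite (integral_distribution mf).
have inner (x : R) : (\int[nu]_y f (x, y) = x%:E * \int[nu]_y y%:E)%E.
  by rewrite -integralZl.
have -> : (\int[mu]_x \int[nu]_y f (x, y) = \int[mu]_x (x%:E * \int[nu]_y y%:E))%E.
  by apply: eq_integral => x _; exact: inner.
have -> : (\int[mu]_x (x%:E * \int[nu]_y y%:E) = \int[mu]_x x%:E * \int[nu]_y y%:E)%E.
  have <- : ((fine (\int[nu]_y y%:E))%:E = \int[nu]_y y%:E)%E.
    by rewrite fineK//; exact: integrable_fin_num.
  by rewrite integralZr.
have mE : measurable_fun setT (@EFin R) by apply/measurable_EFinP; exact: measurable_id.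
have e1 : (\int[mu]_x x%:E = \int[P]_w (X w)%:E)%E.
  by rewrite (integral_distribution (X := X') mE iX).
have e2 : (\int[nu]_x x%:E = \int[P]_w (Y w)%:E)%E.
  by rewrite (integral_distribution (X := Y') mE iY).
by rewrite e1 e2 fineM//; exact: integrable_fin_num.
Qed.

Definition cylinders (X : nat -> T -> R) (s : seq nat) : set (set T) :=
  [set A | exists2 B : nat -> set R, (forall i, measurable (B i)) &
    A = \bigcap_(i in [set` s]) (X i @^-1` B i)].

Definition independent_upto (X : nat -> T -> R) (N : nat) :=
  forall (s : seq nat) (B : nat -> set R), uniq s ->
    (forall i, i \in s -> (i < N)%N) -> (forall i, measurable (B i)) ->
    P (\bigcap_(i in [set` s]) (X i @^-1` B i)) =
      (\prod_(i <- s) P (X i @^-1` B i))%E.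

(** The events prescribed by finitely many of the variables form a pi-system
generating a sigma-algebra for which the sum is measurable. The finite
measures that send an event to the probability of its intersection with
[X b @^-1` C], respectively to the product of the probabilities, agree on that
pi-system. *)
Lemma independent_sum (X : nat -> T -> R) N a b :
  (forall i, measurable_fun setT (X i)) -> independent_upto X N ->
  (b < N)%N ->
  independent_fun (fun w => \sum_(a <= i < b) X i w) (X b).
Proof.
move=> mX ind bN A C mA mC.
pose s := index_iota a b.
pose G := cylinders X s.
have mXB i (B : set R) : measurable B -> measurable (X i @^-1` B).
  by move=> mB; rewrite -[X in measurable X]setTI; exact: mX.
have Gm : G `<=` measurable.
  move=> _ [B mB ->]; apply: fin_bigcap_measurable; first exact: finite_seq.
  by move=> i _; exact: mXB.
have GT : G setT.
  exists (fun=> setT) => //; apply/esym; rewrite -subTset => w _ i _ //.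
have GI : setI_closed G.
  move=> _ _ [B1 mB1 ->] [B2 mB2 ->]; exists (fun i => B1 i `&` B2 i).
    by move=> i; exact: measurableI.
  by apply/seteqP; split=> [w [h1 h2] i si|w h]; [split; [exact: h1|exact: h2]|split=> i si; have [] := h i si].
pose m1 := mrestr P (mXB b C mC).
pose c : {nonneg R} := NngNum (fine_ge0 (measure_ge0 P (X b @^-1` C))).
pose m2 := mscale c P.
have cE : (c%:num%:E = P (X b @^-1` C))%E.
  by rewrite /= fineK// fin_num_measure//; exact (mXB _ _ mC).
have := @g_sigma_algebra_measure_unique _ R T G Gm (fun=> setT) (fun=> GT) _ m1 m2 GI.
move=> /(_ _ _ _ ((fun w => \sum_(a <= i < b) X i w) @^-1` A)).
have m2E A0 : m2 A0 = (P A0 * P (X b @^-1` C))%E by rewrite /m2 /mscale -cE muleC.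
move=> H; rewrite -m2E; apply: H.
- by rewrite bigcup_const.
- move=> _ [B mB ->]; apply: etrans (esym (m2E _)).
  rewrite [RHS]muleC /m1 /mrestr.
  pose B' i := if i == b then C else B i.
  have us : uniq (b :: s) by rewrite /= iota_uniq mem_index_iota ltnn andbF.
  have sN i : i \in s -> (i < N)%N.
    by rewrite mem_index_iota => /andP[_ ib]; exact: ltn_trans bN.
  rewrite (ind s B (iota_uniq _ _) sN mB).
  have -> : (\prod_(i <- s) P (X i @^-1` B i) = \prod_(i <- s) P (X i @^-1` B' i))%E.
    apply: eq_big_seq => i; rewrite /B' mem_index_iota => /andP[_ ib].
    by rewrite ltn_eqF.
  have := ind (b :: s) B' us.
  have B'b : B' b = C by rewrite /B' eqxx.
  rewrite big_cons B'b => <-.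
  + congr (P _); rewrite /B'; apply/seteqP; split=> [w [h1 h2] i /=|w h].
      rewrite inE => /orP[/eqP ->|si]; first by rewrite eqxx.
      by case: eqP => [->//|_]; exact: h1.
    split=> [i si|]; last by have := h b; rewrite /= inE eqxx; exact.
    have := h i; rewrite /= inE si orbT; case: eqP => [ib|_]; last exact.
    by move: si; rewrite /= ib mem_index_iota ltnn andbF.
  + by move=> i; rewrite inE => /orP[/eqP -> //|]; exact: sN.
  + by move=> i; rewrite /B'; case: ifP.
- move=> _; apply: (@le_lt_trans _ _ 1%E); last exact: ltry.
  by apply: probability_le1; apply: measurableI => //; exact (mXB _ _ mC).
- have mS : measurable_fun setT ((fun w => \sum_(a <= i < b) X i w) : g_sigma_algebraType G -> R).
    pose X' i := if i \in s then X i else cst 0.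
    rewrite (_ : (fun w => _) = fun w => \sum_(a <= i < b) X' i w); last first.
      by apply/funext => w; apply: eq_big_nat => i ib; rewrite /X' mem_index_iota ib.
    apply: measurable_sum => i; rewrite /X'; case: ifPn => // si.
    move=> _ B mB; rewrite setTI; apply: sub_sigma_algebra.
    exists (fun j => if j == i then B else setT); first by move=> j; case: ifP.
    apply/seteqP; split=> [w Bw j /= _|w]; first by case: eqP => [->|].
    by move/(_ i si); rewrite eqxx.
  by have := mS measurableT A mA; rewrite setTI.
Qed.

End independence.

Section moments.
Context d (T : measurableType d) (R : realType) (P : probability T R).

Definition has_moments (X : T -> R) := measurable_fun setT X /\
  forall k, P.-integrable setT (EFin \o (fun w => `|X w| ^+ k)).

Lemma norm_add_exp (s x : R) k : `|s + x| ^+ k <= 2 ^+ k * (`|s| ^+ k + `|x| ^+ k).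
Proof.
have aux (u v : R) : 0 <= u -> u <= v -> (u + v) ^+ k <= 2 ^+ k * (u ^+ k + v ^+ k).
  move=> u0 uv; have v0 := le_trans u0 uv.
  apply: (@le_trans _ _ ((2 * v) ^+ k)).
    by rewrite lerXn2r ?nnegrE ?mulr_ge0 ?addr_ge0//; lra.
  by rewrite exprMn ler_wpM2l ?exprn_ge0// lerDr exprn_ge0.
apply: (@le_trans _ _ ((`|s| + `|x|) ^+ k)).
  by rewrite lerXn2r ?nnegrE ?addr_ge0 ?ler_normD.
have [sx|/ltW xs] := leP `|s| `|x|; first exact: aux.
by rewrite addrC [X in _ <= _ * X]addrC; exact: aux.
Qed.

Lemma measurable_normX (X : T -> R) k :
  measurable_fun setT X -> measurable_fun setT (fun w => `|X w| ^+ k).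
Proof. by move=> mX; apply: measurable_funX; exact: measurableT_comp. Qed.

Lemma has_momentsD X Y :
  has_moments X -> has_moments Y -> has_moments (fun w => X w + Y w).
Proof.
move=> [mX iX] [mY iY]; split=> [|k]; first exact: measurable_funD.
apply: (@le_integrable _ _ R P setT measurableT _
    (EFin \o (fun w => 2 ^+ k * (`|X w| ^+ k + `|Y w| ^+ k)))) => //.
- by apply/measurable_EFinP; apply: measurable_normX; exact: measurable_funD.
- move=> w _ /=; rewrite lee_fin [leLHS]ger0_norm ?exprn_ge0//.
  exact: le_trans (norm_add_exp _ _ _) (ler_norm _).
- have := integrableZl measurableT (2 ^+ k) (integrableD measurableT (iX k) (iY k)).
  by [].
Qed.

Lemma has_moments_cst (r : R) : has_moments (fun=> r).
Proof. by split=> // k; exact: finite_measure_integrable_cst. Qed.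

Lemma has_moments_sum (X : nat -> T -> R) a b : (forall i, (i < b)%N -> has_moments (X i)) ->
  has_moments (fun w => \sum_(a <= i < b) X i w).
Proof.
elim: b => [|b IH] hX.
  by under eq_fun do rewrite big_geq//; exact: has_moments_cst.
have [ab|ab] := leqP a b; last first.
  by under eq_fun do rewrite big_geq//; exact: has_moments_cst.
under eq_fun do rewrite big_nat_recr//=.
apply: has_momentsD; last exact: hX.
by apply: IH => i ib; apply: hX; exact: leqW.
Qed.

Lemma integrable_exp (X : T -> R) k : has_moments X ->
  P.-integrable setT (EFin \o (fun w => X w ^+ k)).
Proof.
move=> [mX iX]; apply: (@le_integrable _ _ R P setT measurableT _ _ _ _ (iX k)) => //.
- by apply/measurable_EFinP; exact: measurable_funX.
- by move=> w _ /=; rewrite lee_fin normrX ler_norm.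
Qed.

(** In the binomial expansion each monomial of degree at least 2 in [x] is at most
[x ^+ q.*2.+2] in absolute value if [s] is smaller than [x], and at most
[s ^+ q.*2 * x ^+ 2] otherwise. *)
Lemma expand_even_power (q : nat) : exists2 K : R, 0 <= K & forall s x : R,
  (s + x) ^+ (q.*2.+2) <= s ^+ q.*2.+2 + q.*2.+2%:R * (s ^+ q.*2.+1 * x)
    + K * (s ^+ q.*2 * x ^+ 2 + x ^+ q.*2.+2).
Proof.
set m := q.*2.+2.
exists (\sum_(i < m.-1) ('C(m, i.+2))%:R); first by apply: sumr_ge0.
move=> s x; rewrite exprDn big_ord_recl big_ord_recl /= bin0 bin1 subn0 expr0 mulr1 mulr1n.
rewrite addrA /bump /= subSS subn0 expr1 -mulr_natl lerD2l mulr_suml.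
apply: ler_sum => i _ /=.
rewrite !add1n -mulr_natl ler_wpM2l//.
have im : (i.+2 <= m)%N by have := ltn_ord i; rewrite /m /=.
apply: (le_trans (ler_norm _)); rewrite normrM !normrX.
have e2 (t : R) k : t ^+ k.*2 = `|t| ^+ k.*2.
  by rewrite -normrX ger0_norm// -mul2n mulnC exprM sqr_ge0.
rewrite (_ : m = q.+1.*2)// (e2 x q.+1) (e2 s q) (e2 x 1%N).
have [sx|/ltW xs] := leP `|s| `|x|.
  apply: (@le_trans _ _ (`|x| ^+ q.+1.*2)); last by rewrite lerDr mulr_ge0 ?exprn_ge0.
  rewrite -[X in _ <= _ ^+ X](@subnK i.+2 q.+1.*2)// exprD ler_wpM2r ?exprn_ge0//.
  by rewrite lerXn2r ?nnegrE.
apply: (@le_trans _ _ (`|s| ^+ q.*2 * `|x| ^+ 2)); last by rewrite lerDl exprn_ge0.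
rewrite (_ : (q.+1.*2 - i.+2)%N = (q.*2 - i)%N)//.
rewrite -[X in _ <= _ ^+ X * _](@subnK i q.*2)//.
rewrite exprD -mulrA ler_wpM2l ?exprn_ge0// -addn2 exprD ler_wpM2r ?exprn_ge0//.
by rewrite lerXn2r ?nnegrE.
Qed.

(** The moment bounds [M] do not depend on the row, so neither do the constants
derived from them. *)
Definition centered_independent (M : nat -> R) (N : nat) (X : nat -> T -> R) :=
  [/\ independent_upto P X N, (forall i, measurable_fun setT (X i)),
      (forall i, (i < N)%N -> has_moments (X i)),
      (forall i, (i < N)%N -> \int[P]_w X i w = 0) &
      (forall i k, (i < N)%N -> \int[P]_w (`|X i w| ^+ k) <= M k)].

(** A Marcinkiewicz-Zygmund bound. When a variable is added to the sum, the term
of the expansion that is linear in it has mean 0 by independence, and the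
remaining terms are controlled by the bound of the previous order. *)
Lemma sum_even_moment (M : nat -> R) (q : nat) : exists2 C : R, 0 <= C &
  forall N X, centered_independent M N X -> forall a b, (a <= b <= N)%N ->
  \int[P]_w ((\sum_(a <= i < b) X i w) ^+ q.*2) <= C * (b - a)%:R ^+ q.
Proof.
elim: q => [|q [C C0 IH]].
  exists 1 => // N X _ a b _; rewrite double0 expr0 mulr1.
  under eq_Rintegral do rewrite expr0.
  have hP : fine (P [set: T]) = 1 by rewrite probability_setT.
  by rewrite Rintegral_cst// hP mul1r.
have [K K0 hK] := expand_even_power q.
pose C' := K * (C * `|M 2| + `|M q.*2.+2|).
exists C'; first by rewrite mulr_ge0 ?addr_ge0 ?mulr_ge0.
move=> N X hX a; have [ind mX momX meanX leM] := hX.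
elim=> [|b IHb] /andP[ab bN].
  move: ab; rewrite leqn0 => /eqP ->.
  under eq_Rintegral do rewrite big_geq// doubleS expr0n/=.
  by rewrite Rintegral_cst// mul0r subnn expr0n/= mulr0.
move: ab; rewrite leq_eqVlt => /predU1P[->|ab].
  under eq_Rintegral do rewrite big_geq// doubleS expr0n/=.
  by rewrite Rintegral_cst// mul0r subnn expr0n/= mulr0.
rewrite ltnS in ab.
pose S w := \sum_(a <= i < b) X i w.
have mS : has_moments S by apply: has_moments_sum => i ib; apply: momX; exact: ltn_trans bN.
have indS : independent_fun P S (X b) := @independent_sum _ _ _ _ X N a b mX ind bN.
have indSX j k : P.-integrable setT (EFin \o (fun w => S w ^+ j * X b w ^+ k)) /\
    \int[P]_w (S w ^+ j * X b w ^+ k) = \int[P]_w (S w ^+ j) * \int[P]_w (X b w ^+ k).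
  apply: expectation_mul_independent; [exact: integrable_exp|exact/integrable_exp/momX|].
  by apply: (@independent_fun_comp _ _ _ _ S (X b) (fun t : R => t ^+ j) (fun t : R => t ^+ k)) => //;
    exact: measurable_funX.
have i1 := integrable_exp q.*2.+2 mS.
have [i2 e2] := indSX q.*2.+1 1%N.
have [i3 e3] := indSX q.*2 2%N.
have i4 := integrable_exp q.*2.+2 (momX b bN).
have i2' := integrableZl measurableT q.*2.+2%:R i2.
have i34 := integrableD measurableT i3 i4.
have i34' := integrableZl measurableT K i34.
have i12 := integrableD measurableT i1 i2'.
have step : \int[P]_w ((\sum_(a <= i < b.+1) X i w) ^+ q.+1.*2) <=
   \int[P]_w (S w ^+ q.*2.+2) +
   K * (\int[P]_w (S w ^+ q.*2) * \int[P]_w (X b w ^+ 2) + \int[P]_w (X b w ^+ q.*2.+2)).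
  apply: (@le_trans _ _ (\int[P]_w (S w ^+ q.*2.+2 + q.*2.+2%:R * (S w ^+ q.*2.+1 * X b w ^+ 1)
      + K * (S w ^+ q.*2 * X b w ^+ 2 + X b w ^+ q.*2.+2)))).
    apply: le_Rintegral => //.
    - apply: integrable_exp; apply: has_moments_sum => i; rewrite ltnS => ib.
      by apply: momX; exact: leq_ltn_trans bN.
    - exact: (integrableD measurableT i12 i34').
    - by move=> w _; rewrite big_nat_recr//= expr1; exact: hK.
  rewrite RintegralD// RintegralD// RintegralZl// e2 RintegralZl// RintegralD// e3.
  have -> : \int[P]_w (X b w ^+ 1) = 0.
    by under eq_Rintegral do rewrite expr1; exact: meanX.
  by rewrite mulr0 mulr0 addr0.
have even k : \int[P]_w (X b w ^+ k.*2) <= `|M k.*2|.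
  apply: le_trans (ler_norm _); apply: le_trans (leM b k.*2 bN).
  by rewrite le_eqVlt; apply/orP; left; apply/eqP/eq_Rintegral => w _;
    rewrite -normrX ger0_norm// -mul2n mulnC exprM sqr_ge0.
have S2q0 : 0 <= \int[P]_w (S w ^+ q.*2).
  by apply: Rintegral_ge0 => w _; rewrite -mul2n mulnC exprM sqr_ge0.
apply: (le_trans step).
set l := (b - a)%N; have -> : (b.+1 - a)%N = l.+1 by rewrite subSn.
have IHq : \int[P]_w (S w ^+ q.*2) <= C * l.+1%:R ^+ q.
  apply: le_trans (IH N X hX a b _) _; first by rewrite ab ltnW.
  by rewrite ler_wpM2l// lerXn2r ?nnegrE ?ler_nat.
have {}IHb := IHb _; rewrite -/l in IHb.
have {}IHb : \int[P]_w (S w ^+ q.*2.+2) <= C' * l%:R ^+ q.+1.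
  by apply: IHb; rewrite ab ltnW.
have lq1 : 1 <= l.+1%:R ^+ q :> R by rewrite exprn_ege1// ler1n.
apply: (@le_trans _ _ (C' * l%:R ^+ q.+1 + C' * l.+1%:R ^+ q)).
  apply: lerD => //; rewrite /C' -mulrA ler_wpM2l// mulrDl; apply: lerD.
    rewrite mulrAC; apply: ler_pM => //.
      by apply: Rintegral_ge0 => w _; exact: sqr_ge0.
    exact: (even 1%N).
  by apply: (le_trans (even q.+1)); rewrite ler_peMr.
rewrite -mulrDr ler_wpM2l//; first by rewrite mulr_ge0 ?addr_ge0 ?mulr_ge0.
rewrite [in leRHS]exprS -natr1 mulrDl mul1r lerD2r [in leRHS]natr1 exprS.
by rewrite ler_wpM2l// lerXn2r ?nnegrE ?ler_nat.
Qed.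

End moments.

(** * Almost sure bounds on the averages over windows *)

Section almost_sure_rates.
Context d (T : measurableType d) (R : realType) (P : probability T R).

(** The bound [c / n.+1 ^ 2] is at most [2 * c / n.+1 - 2 * c / n.+2], whose sum
telescopes. *)
Lemma borel_cantelli_inverse_square (F : (set T)^nat) (c : R) (n0 : nat) :
  (forall n, measurable (F n)) -> 0 <= c ->
  (forall n, (n0 <= n)%N -> (P (F n) <= (c * n.+1%:R ^- 2)%:E)%E) ->
  {ae P, forall w, \forall n \near \oo, ~ F n w}.
Proof.
move=> mF c0 PF.
pose F' n := if (n0 <= n)%N then F n else set0.
pose v (n : nat) : R := - (2 * c / n.+1%:R).
have v_homo : {homo v : x y / (x <= y)%N >-> (x <= y)%R}.
  move=> x y xy; rewrite lerN2 ler_wpM2l ?mulr_ge0// lef_pV2 ?posrE ?ltr0n//.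
  by rewrite ler_nat.
have cv : v @ \oo --> (0 : R).
  rewrite -[X in _ --> X]oppr0; apply: cvgN; rewrite -[X in _ --> X](mulr0 (2 * c)).
  by apply: cvgMr; exact: cvg_harmonic.
have limv : limn (EFin \o v) = 0%E.
  by apply/cvg_lim => //; apply: cvg_EFin => //; exact: nearW.
have P' n : (P (F' n) <= (v n.+1)%:E - (v n)%:E)%E.
  rewrite -EFinB.
  apply: (@le_trans _ _ (c * n.+1%:R ^- 2)%:E).
    rewrite /F'; case: ifPn => [|_]; first exact: PF.
    by rewrite measure0 lee_fin mulr_ge0// invr_ge0 exprn_ge0.
  rewrite lee_fin /v opprK.
  have n1 : 0 < n.+1%:R :> R by rewrite ltr0n.
  have -> : - (2 * c / n.+2%:R) + 2 * c / n.+1%:R = c * (2 / (n.+1%:R * n.+2%:R)).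
    rewrite -[n.+2%:R]natr1; field.
    by rewrite gt_eqF// gt_eqF// addr_gt0.
  rewrite ler_wpM2l// ler_pdivlMr ?mulr_gt0 ?ltr0n// -[n.+2%:R]natr1 mulrC.
  rewrite ler_pdivrMr ?exprn_gt0//.
  have : 1 <= n.+1%:R :> R by rewrite ler1n.
  by move: (n.+1%:R : R) n1 => t t0 t1; nra.
have mF' n : measurable (F' n) by rewrite /F'; case: ifP.
have : P (lim_sup_set F') = 0%E.
  apply: lim_sup_set_cvg0 => //.
  apply: (@le_lt_trans _ _ (\sum_(0 <= n <oo) ((v n.+1)%:E - (v n)%:E))%E).
    by apply: lee_nneseries => // n _; exact: P'.
  by rewrite nondecreasing_telescope_sumey// limv // sub0e -EFinN ltry.
move=> lim0; exists (lim_sup_set F'); split => //.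
  by apply: bigcap_measurableType => n _; exact: bigcup_measurable.
move=> w /= hw n _; apply: contrapT => hn; apply: hw.
exists (maxn n n0) => // m /=; rewrite geq_max => /andP[nm n0m] Fm; apply: hn.
by exists m => //; rewrite /F' n0m.
Qed.

Lemma measurable_norm_gt (f : T -> R) (t : R) :
  measurable_fun setT f -> measurable [set w | t < `|f w| ].
Proof.
move=> mf.
have mn : measurable_fun setT (fun w => `|f w|) by exact: measurableT_comp.
have := mn measurableT _ (measurable_itv `]t, +oo[); rewrite setTI.
congr measurable; apply/seteqP; split=> w /=; rewrite in_itv/= andbT//.
Qed.

(** Markov's inequality for the power [q.*2] of the sum. *)
Lemma window_tail (M : nat -> R) (q : nat) : exists2 C : R, 0 <= C &
  forall N X, centered_independent P M N X -> forall a b (t : R), (a <= b <= N)%N -> 0 < t ->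
  (P [set w | (t < `|\sum_(a <= i < b) X i w|)%R ]
     <= (C * (b - a)%:R ^+ q / t ^+ q.*2)%:E)%E.
Proof.
have [C C0 hC] := sum_even_moment P M q; exists C => // N X hX a b t abN t0.
have [ind mX momX meanX leM] := hX.
set S := fun w => \sum_(a <= i < b) X i w.
have mS : has_moments P S.
  by apply: has_moments_sum => i ib; apply: momX; apply: leq_trans ib _; case/andP: abN.
have mA : measurable [set w | t < `|S w| ].
  by apply: measurable_norm_gt; case: mS.
rewrite -(fineK (fin_num_measure P _ mA)) lee_fin ler_pdivlMr ?exprn_gt0// mulrC.
apply: le_trans (hC N X hX a b abN).
have -> : fine (P [set w | t < `|S w| ]) = \int[P]_w (\1_[set w | t < `|S w| ] w).
  by rewrite /Rintegral integral_indic// setIT.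
have iA : P.-integrable setT (EFin \o (fun w => \1_[set w | t < `|S w| ] w)).
  exact: integrable_indic.
rewrite -RintegralZl//; apply: le_Rintegral => //.
- by have := integrableZl measurableT (t ^+ q.*2) iA.
- exact: integrable_exp.
- move=> w _; rewrite indicE -/(S w).
  have S0 : 0 <= S w ^+ q.*2 by rewrite -mul2n mulnC exprM sqr_ge0.
  case: (boolP (w \in _)) => [|_]; last by rewrite mulr0.
  rewrite inE /= => tS; rewrite mulr1 -(ger0_norm S0) normrX.
  by rewrite lerXn2r ?nnegrE ?(ltW t0)// ltW.
Qed.

(** Windows whose length is at least a small multiple of [N n * u n] eventually
have averages below the same multiple of [u n]. All the randomness of the data
enters the limit theorem through instances of this property. *)
Definition small_averages (N : nat -> nat) (u : nat -> R) (X : nat -> nat -> R) :=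
  forall j, \forall n \near \oo, forall a b, (a <= b <= N n)%N ->
    (N n)%:R * u n / j.+1%:R <= (b - a)%:R ->
    `|\sum_(a <= i < b) X n i| <= (b - a)%:R * u n / j.+1%:R.

(** A window of length l violates the bound with probability at most a multiple of
(l u^2)^-q, hence of (N u^3)^-q as l is at least of order N u. The hypothesis
on [q] makes this at most a multiple of N^-4; there are (N + 1)^2 windows, and
the total is summable. *)
Lemma ae_small_averages (N : nat -> nat) (u : nat -> R) (X : nat -> nat -> T -> R)
    (M : nat -> R) (kappa : R) (q n0 : nat) :
  0 < kappa -> (forall n, (n0 <= n)%N -> kappa * n.+1%:R <= (N n)%:R) ->
  (forall n, 0 < u n) ->
  (forall n, (n0 <= n)%N -> (N n)%:R ^+ 4 <= ((N n)%:R * u n ^+ 3) ^+ q) ->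
  (forall n, (n0 <= n)%N -> centered_independent P M (N n) (X n)) ->
  {ae P, forall w, small_averages N u (fun n i => X n i w)}.
Proof.
move=> kappa0 hN u0 hu hX.
apply: ae_foralln => j.
have [C C0 hC] := window_tail M q.
pose eta : R := j.+1%:R^-1.
have eta0 : 0 < eta by rewrite invr_gt0 ltr0n.
pose E n a b := [set w | [/\ (a <= b <= N n)%N, (N n)%:R * u n * eta <= (b - a)%:R &
   (b - a)%:R * u n * eta < `|\sum_(a <= i < b) X n i w| ] ].
pose F n := \big[setU/set0]_(a < (N n).+1) \big[setU/set0]_(b < (N n).+1) E n a b.
pose F' n := if (n0 <= n)%N then F n else set0.
have mE n a b : (n0 <= n)%N -> measurable (E n a b).
  move=> n0n; have [_ mX _ _ _] := hX n n0n.
  rewrite /E; case: (boolP (a <= b <= N n)%N) => ab; last first.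
    by rewrite (_ : [set w | _] = set0)//; apply/seteqP; split=> // w [].
  case: (boolP ((N n)%:R * u n * eta <= (b - a)%:R)) => ab'; last first.
    by rewrite (_ : [set w | _] = set0)//; apply/seteqP; split=> // w [].
  rewrite (_ : [set w | _] = [set w | (b - a)%:R * u n * eta < `|\sum_(a <= i < b) X n i w| ]); last first.
    by apply/seteqP; split=> [w []|w].
  by apply: measurable_norm_gt; apply: measurable_sum.
have PE n a b : (n0 <= n)%N -> (P (E n a b) <= (C / eta ^+ (3 * q) / (N n)%:R ^+ 4)%:E)%E.
  move=> n0n; have N0 : 0 < (N n)%:R :> R.
    by apply: lt_le_trans (hN n n0n); rewrite mulr_gt0 ?ltr0n.
  have bound0 : 0 <= C / eta ^+ (3 * q) / (N n)%:R ^+ 4.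
    by rewrite !divr_ge0 ?exprn_ge0// ltW.
  case: (boolP (a <= b <= N n)%N) => ab; last first.
    rewrite (_ : E n a b = set0) ?measure0 ?lee_fin//.
    by apply/seteqP; split=> // w [] //; rewrite (negbTE ab).
  case: (boolP ((N n)%:R * u n * eta <= (b - a)%:R)) => ab'; last first.
    rewrite (_ : E n a b = set0) ?measure0 ?lee_fin//.
    by apply/seteqP; split=> // w [] //; rewrite (negbTE ab').
  have l0 : 0 < (b - a)%:R :> R by apply: lt_le_trans ab'; rewrite !mulr_gt0.
  have t0 : 0 < (b - a)%:R * u n * eta by rewrite !mulr_gt0.
  apply: (@le_trans _ _ (P [set w | (b - a)%:R * u n * eta < `|\sum_(a <= i < b) X n i w| ])).
    apply: le_measure; rewrite ?inE.
    - exact: mE.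
    - have [_ mX _ _ _] := hX n n0n.
      by apply: measurable_norm_gt; apply: measurable_sum.
    - by move=> w [].
  apply: (le_trans (hC _ _ (hX n n0n) a b _ ab t0)); rewrite lee_fin.
  rewrite -!mulrA ler_wpM2l//.
  have -> : ((b - a)%:R * (u n * eta)) ^+ q.*2 = (((b - a)%:R * (u n * eta)) ^+ 2) ^+ q.
    by rewrite -exprM mul2n.
  rewrite -expr_div_n.
  have -> : (b - a)%:R / ((b - a)%:R * (u n * eta)) ^+ 2 = ((b - a)%:R * (u n * eta) ^+ 2)^-1.
    by field; rewrite !gt_eqF.
  rewrite exprVn -invfM lef_pV2 ?posrE ?exprn_gt0 ?mulr_gt0 ?exprn_gt0//.
  apply: (@le_trans _ _ (((N n)%:R * u n ^+ 3) ^+ q * eta ^+ (3 * q))).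
    by rewrite mulrC ler_wpM2r ?exprn_ge0 ?(ltW eta0)//; exact: hu.
  rewrite exprM -exprMn lerXn2r ?nnegrE ?mulr_ge0 ?exprn_ge0 ?(ltW eta0) ?(ltW (u0 n)) ?(ltW N0)//.
  apply: (@le_trans _ _ ((N n)%:R * u n * eta * (u n * eta) ^+ 2)).
    by rewrite le_eqVlt; apply/orP; left; apply/eqP; ring.
  by rewrite ler_wpM2r ?sqr_ge0.
have mF' n : measurable (F' n).
  rewrite /F'; case: ifP => // n0n.
  by apply: bigsetU_measurable => a _; apply: bigsetU_measurable => b _; exact: mE.
have := @borel_cantelli_inverse_square F' (4 * (C / eta ^+ (3 * q)) / kappa ^+ 2) n0 mF'.
have c0 : 0 <= 4 * (C / eta ^+ (3 * q)) / kappa ^+ 2.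
  by rewrite divr_ge0 ?mulr_ge0 ?invr_ge0 ?exprn_ge0 ?(ltW eta0) ?(ltW kappa0).
move=> /(_ c0) BC.
have : {ae P, forall w, \forall n \near \oo, ~ F' n w}.
  apply: BC => n n0n; rewrite /F' n0n.
  have N0 : 0 < (N n)%:R :> R.
    by apply: lt_le_trans (hN n n0n); rewrite mulr_gt0 ?ltr0n.
  have N1 : 1 <= (N n)%:R :> R by move: N0; rewrite ltr0n ler1n.
  set B := (C / eta ^+ (3 * q) / (N n)%:R ^+ 4) in PE.
  apply: (@le_trans _ _ (\sum_(a < (N n).+1) \sum_(b < (N n).+1) B%:E)%E).
    have mUE a : measurable (\big[setU/set0]_(b < (N n).+1) E n a b).
      by apply: bigsetU_measurable => b _; exact: mE.
    apply: le_trans (Boole_inequality P (fun a _ => mUE a)) _.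
    apply: lee_sum => a _.
    apply: le_trans (Boole_inequality P (fun b _ => mE n a b n0n)) _.
    by apply: lee_sum => b _; exact: PE.
  under eq_bigr do rewrite sumEFin.
  rewrite sumEFin !sumr_const !card_ord lee_fin -[(_ *+ _) *+ _]mulrnA -[B *+ _]mulr_natr natrM.
  rewrite /B; set D := C / _.
  have D0 : 0 <= D by rewrite divr_ge0 ?exprn_ge0// ltW.
  have h1 : (N n).+1%:R <= 2 * (N n)%:R :> R by rewrite -natr1; lra.
  have h2 : (N n).+1%:R * (N n).+1%:R <= 4 * (N n)%:R ^+ 2 :> R.
    have := ler_pM (ler0n _ _) (ler0n _ _) h1 h1; move/le_trans; apply.
    by rewrite le_eqVlt; apply/orP; left; apply/eqP; ring.
  apply: (@le_trans _ _ (D / (N n)%:R ^+ 4 * (4 * (N n)%:R ^+ 2))).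
    by rewrite ler_wpM2l// divr_ge0// exprn_ge0// ltW.
  have -> : D / (N n)%:R ^+ 4 * (4 * (N n)%:R ^+ 2) = 4 * D * ((N n)%:R ^+ 2)^-1.
    by field; rewrite gt_eqF.
  rewrite -[leRHS]mulrA -invfM ler_wpM2l ?(mulr_ge0 _ D0)//.
  rewrite lef_pV2 ?posrE ?mulr_gt0 ?exprn_gt0 ?mulr_gt0 ?ltr0n// -1?(ltr0n R)//.
  by rewrite -exprMn lerXn2r ?nnegrE ?mulr_ge0// ?(ltW kappa0) ?(ltW N0)//; exact: hN.
apply: filterS => w [m _ hm]; exists (maxn m n0) => // n /=; rewrite geq_max => /andP[mn n0n].
move=> a b ab ab'; rewrite leNgt; apply/negP => lt; apply: (hm n mn).
rewrite /F' n0n /F -(bigcup_mkord _ (fun a => \big[setU/set0]_(b < (N n).+1) E n a b)); have /andP[aleb bN] := ab.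
exists a; first by rewrite /= ltnS (leq_trans aleb).
by rewrite -(bigcup_mkord _ (fun b => E n a b)); exists b.
Qed.

End almost_sure_rates.

(** * Isotonic regression near a level crossing *)

Local Notation num_le := Defs.num_le.

Section isotonic_regression.
Context {R : realType}.
Context (m : nat) (x y : nat -> R).
Hypothesis hx : is_design m x.

Let x01 i : (i < m)%N -> 0 <= x i <= 1. Proof. exact: hx.1. Qed.

Lemma design_lt i j : (i < m)%N -> (j < m)%N -> (x i < x j) = (i < j)%N.
Proof.
move=> im jm; case: (ltngtP i j) => [ij|ji|->]; last by rewrite ltxx.
  by apply: hx.2; rewrite ij.
by apply/negbTE; rewrite -leNgt ltW//; apply: hx.2; rewrite ji.
Qed.

Lemma design_le i j : (i < m)%N -> (j < m)%N -> (x i <= x j) = (i <= j)%N.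
Proof. by move=> im jm; rewrite leNgt design_lt// -leqNgt. Qed.

Lemma num_le_bound t : (num_le m x t <= m)%N.
Proof. by rewrite /num_le -[X in (_ <= X)%N](card_ord m) max_card. Qed.

(** The design is sorted, so the points counted are the first ones. *)
Lemma lt_num_le i t : (i < m)%N -> (i < num_le m x t)%N = (x i <= t).
Proof.
move=> im.
have E : num_le m x t = count (fun i => x i <= t)%R (iota 0 m).
  rewrite /num_le cardE size_filter -val_enum_ord count_map.
  by rewrite enumT; apply: eq_count => j; rewrite inE.
have : forall k, (k <= m)%N -> count (fun i => x i <= t)%R (iota 0 k) = minn k (num_le m x t).
  have H k : (k <= m)%N ->
     count (fun i => x i <= t)%R (iota 0 k) = k \/
     ((count (fun i => x i <= t)%R (iota 0 k) < k)%N /\ forall l, (k <= l < m)%N -> (t < x l)%R).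
    elim: k => [|k IH] km; first by left.
    rewrite -addn1 iotaD count_cat /= add0n addn0 addn1.
    have [->|[c1 c2]] := IH (ltnW km).
      case: (leP (x k) t) => xkt; first by left; rewrite addn1.
      right; rewrite addn0; split=> // l /andP[kl lm].
      by apply: lt_trans xkt _; apply: hx.2; rewrite kl.
    right; split; last by move=> l /andP[kl lm]; apply: c2; rewrite lm ltnW.
    rewrite (_ : (x k <= t) = false) ?addn0; first exact: ltnW.
    by apply/negbTE; rewrite -ltNge; apply: c2; rewrite leqnn km.
  have tot k : (k <= m)%N -> num_le m x t =
     (count (fun i => x i <= t)%R (iota 0 k) + count (fun i => x i <= t)%R (iota k (m - k)))%N.
    by move=> km; rewrite E -count_cat -[X in iota X (m - k)]add0n -iotaD subnKC.
  move=> k km; have [e|[lt1 gt]] := H k km.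
    by rewrite e; apply/esym/minn_idPl; rewrite (tot k km) e leq_addr.
  have z : count (fun i => x i <= t)%R (iota k (m - k)) = 0%N.
    apply/eqP; rewrite -leqn0 leqNgt -has_count; apply/hasPn => l.
    rewrite mem_iota subnKC// => /gt; by rewrite ltNge.
  have := tot k km; rewrite z addn0 => e; rewrite e.
  by apply/esym/minn_idPr; rewrite ltnW.
move=> H; have h1 := H i.+1 im; have h0 := H i (ltnW im).
rewrite -addn1 iotaD count_cat /= add0n addn0 h0 addn1 in h1.
case: (leP (x i) t) h1 => _ h1.
  by apply/idP; move: h1; rewrite /minn; do 2 case: ifP; lia.
by apply/idP; move: h1; rewrite /minn; do 2 case: ifP; lia.
Qed.

Definition isotonic_optimal (h : R -> R) := nondecreasing01 h /\
  forall k, nondecreasing01 k -> sum_sq m x y h <= sum_sq m x y k.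

(** Lowering a whole block of fitted values that starts at a jump keeps the fit
nondecreasing; by optimality the sum of squares does not decrease to first
order. *)
Lemma block_sum_right h j l : isotonic_optimal h -> (j <= l < m)%N ->
  (forall i, (i < j)%N -> h (x i) < h (x j)) ->
  0 <= \sum_(j <= i < l.+1) (y i - h (x i)).
Proof.
move=> [h_nd h_opt] /andP[jl lm] jump.
have jm : (j < m)%N by exact: leq_ltn_trans lm.
have in01 i : (i < m)%N -> x i \in `[0, 1] by move=> im; rewrite in_itv /= x01.
have [g g0 hg] : exists2 g : R, 0 < g & forall i, (i < j)%N -> h (x i) <= h (x j) - g.
  case: j jl jm jump => [|j] jl jm jump; first by exists 1.
  exists (h (x j.+1) - h (x j)) => [|i ij]; first by rewrite subr_gt0 jump.
  rewrite opprB addrC subrK; apply: h_nd; rewrite ?in01//.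
  - exact: ltn_trans ij _.
  - exact: ltnW.
  - by rewrite design_le//; [exact: ltn_trans ij _|exact: ltnW].
have opt e : 0 < e -> e <= g ->
    0 <= 2 * e * \sum_(j <= i < l.+1) (y i - h (x i)) + e ^+ 2 * (l.+1 - j)%:R.
  move=> e0 eg.
  pose k t := if t < x j then Num.min (h t) (h (x j) - e)
              else if t <= x l then h t - e else h t.
  have kE i : (i < m)%N -> k (x i) = h (x i) - (if (j <= i <= l)%N then e else 0).
    move=> im; rewrite /k design_lt// design_le//.
    case: (ltnP i j) => ij /=; last by case: ifP => // _; rewrite subr0.
    by rewrite subr0 min_l// (le_trans (hg i ij))// lerB.
  have k_nd : nondecreasing01 k.
    move=> s t s01 t01 st; rewrite /k.
    have [sj|js] := ltP s (x j); have [tj|jt] := ltP t (x j).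
    - rewrite le_min !ge_min h_nd//= lexx orbT//.
    - have hjt : h (x j) <= h t by apply: h_nd => //; exact: in01.
      by case: ifP => _; rewrite ge_min; apply/orP; right; rewrite ?lerB// (le_trans _ hjt)// gerBl ltW.
    - by have := lt_le_trans tj js; rewrite ltNge st.
    - have hst := h_nd s t s01 t01 st.
      case: ifP => sl; case: ifP => tl //; rewrite ?lerB//.
        by rewrite (le_trans _ hst)// gerBl ltW.
      by move: sl; rewrite (le_trans st tl).
  have := h_opt k k_nd.
  rewrite /sum_sq -(big_mkord xpredT (fun i => (y i - h (x i)) ^+ 2)).
  rewrite -(big_mkord xpredT (fun i => (y i - k (x i)) ^+ 2)) -subr_ge0 -sumrB.
  have -> : \sum_(0 <= i < m) ((y i - k (x i)) ^+ 2 - (y i - h (x i)) ^+ 2) =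
     \sum_(j <= i < l.+1) (2 * e * (y i - h (x i)) + e ^+ 2).
    rewrite (big_cat_nat _ (n := j)) //=; last exact: ltnW.
    rewrite (big_cat_nat _ (n := l.+1) (m := j)) //=; last exact: leqW.
    rewrite big_nat big1 ?add0r; last first.
      move=> i /andP[_ ij]; rewrite kE ?(ltn_trans ij)// leqNgt ij /= subr0 subrr //.
    rewrite [X in _ + X]big_nat [X in _ + X]big1 ?addr0; last first.
      move=> i /andP[li im]; rewrite kE// [(i <= l)%N]leqNgt li andbF subr0 subrr //.
    apply: eq_big_nat => i /andP[ji il].
    rewrite kE; last exact: leq_ltn_trans lm.
    by rewrite ji -ltnS il /=; ring.
  by rewrite big_split /= -mulr_sumr sumr_const_nat -[e ^+ 2 *+ _]mulr_natr.
set s := \sum_(_ <= _ < _) _ in opt *.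
rewrite leNgt; apply/negP => s0.
set c : R := (l.+1 - j)%:R in opt.
have c0 : 0 < c by rewrite ltr0n subn_gt0 ltnS.
pose e := Num.min g (- s / c).
have e0 : 0 < e by rewrite lt_min g0 divr_gt0// oppr_gt0.
have eg : e <= g by rewrite ge_min lexx.
have ec : e * c <= - s by rewrite -ler_pdivlMr// ge_min lexx orbT.
have := opt e e0 eg; have : e * (e * c) <= e * (- s) by rewrite ler_wpM2l// ltW.
have : e * s < 0 by rewrite pmulr_rlt0.
rewrite expr2; nra.
Qed.

(** The mirror image: a block that ends just before a jump can be raised. *)
Lemma block_sum_left h j l : isotonic_optimal h -> (l < j <= m)%N ->
  (forall i, (j <= i < m)%N -> h (x j.-1) < h (x i)) ->
  \sum_(l <= i < j) (y i - h (x i)) <= 0.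
Proof.
move=> [h_nd h_opt] /andP[lj jm] jump.
case: j lj jm jump => // j; rewrite ltnS /= => lj jm jump.
have lm : (l < m)%N by exact: leq_ltn_trans jm.
have in01 i : (i < m)%N -> x i \in `[0, 1] by move=> im; rewrite in_itv /= x01.
have [g g0 hg] : exists2 g : R, 0 < g & forall i, (j < i < m)%N -> h (x j) + g <= h (x i).
  have [j1m|mj1] := ltnP j.+1 m; last first.
    by exists 1 => // i /andP[ji im]; have := leq_trans im mj1; rewrite ltnS leqNgt ji.
  exists (h (x j.+1) - h (x j)) => [|i /andP[ji im]].
    by rewrite subr_gt0 jump// leqnn.
  by rewrite addrC subrK; apply: h_nd; rewrite ?in01// design_le.
have opt e : 0 < e -> e <= g ->
    0 <= - (2 * e * \sum_(l <= i < j.+1) (y i - h (x i))) + e ^+ 2 * (j.+1 - l)%:R.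
  move=> e0 eg.
  pose k t := if x j < t then Num.max (h t) (h (x j) + e)
              else if x l <= t then h t + e else h t.
  have kE i : (i < m)%N -> k (x i) = h (x i) + (if (l <= i <= j)%N then e else 0).
    move=> im; rewrite /k design_lt// design_le//.
    case: (ltnP j i) => ij /=; last by rewrite andbT; case: ifP => // _; rewrite addr0.
    by rewrite andbF addr0 max_l// (le_trans _ (hg i _)) ?ij// lerD2l.
  have k_nd : nondecreasing01 k.
    move=> s t s01 t01 st; rewrite /k.
    have [sj|js] := ltP (x j) s; have [tj|jt] := ltP (x j) t.
    - rewrite ge_max !le_max h_nd//= lexx orbT//.
    - by have := lt_le_trans sj st; rewrite ltNge jt.
    - have hsj : h s <= h (x j) by apply: h_nd => //; exact: in01.
      by case: ifP => _; rewrite le_max; apply/orP; right; rewrite ?lerD2r// (le_trans hsj)// lerDl ltW.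
    - have hst := h_nd s t s01 t01 st.
      case: ifP => sl; case: ifP => tl //; rewrite ?lerD2r//.
        by move: tl; rewrite (le_trans sl st).
      by rewrite (le_trans hst)// lerDl ltW.
  have := h_opt k k_nd.
  rewrite /sum_sq -(big_mkord xpredT (fun i => (y i - h (x i)) ^+ 2)).
  rewrite -(big_mkord xpredT (fun i => (y i - k (x i)) ^+ 2)) -subr_ge0 -sumrB.
  have -> : \sum_(0 <= i < m) ((y i - k (x i)) ^+ 2 - (y i - h (x i)) ^+ 2) =
     \sum_(l <= i < j.+1) (- (2 * e * (y i - h (x i))) + e ^+ 2).
    rewrite (big_cat_nat _ (n := l)) //=; last exact: ltnW.
    rewrite (big_cat_nat _ (n := j.+1) (m := l)) //=; last exact: leqW.
    rewrite big_nat big1 ?add0r; last first.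
      move=> i /andP[_ il]; rewrite kE ?(ltn_trans il)// leqNgt il /= addr0 subrr //.
    rewrite [X in _ + X]big_nat [X in _ + X]big1 ?addr0; last first.
      move=> i /andP[li im]; rewrite kE// [(i <= j)%N]leqNgt li andbF addr0 subrr //.
    apply: eq_big_nat => i /andP[li ij].
    rewrite kE; last exact: leq_ltn_trans jm.
    by rewrite li -ltnS ij /=; ring.
  by rewrite big_split /= sumrN -mulr_sumr sumr_const_nat -[e ^+ 2 *+ _]mulr_natr.
set s := \sum_(_ <= _ < _) _ in opt *.
rewrite leNgt; apply/negP => s0.
set c : R := (j.+1 - l)%:R in opt.
have c0 : 0 < c by rewrite ltr0n subn_gt0 ltnS.
pose e := Num.min g (s / c).
have e0 : 0 < e by rewrite lt_min g0 divr_gt0.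
have eg : e <= g by rewrite ge_min lexx.
have ec : e * c <= s by rewrite -ler_pdivlMr// ge_min lexx orbT.
have := opt e e0 eg; have : e * (e * c) <= e * s by rewrite ler_wpM2l// ltW.
have : 0 < e * s by rewrite mulr_gt0.
rewrite expr2; nra.
Qed.

Lemma num_le_homo s t : s <= t -> (num_le m x s <= num_le m x t)%N.
Proof.
move=> st; apply: subset_leq_card; apply/fintype.subsetP => i; rewrite !inE => xs.
exact: le_trans xs st.
Qed.

Lemma num_le_design i : (i < m)%N -> num_le m x (x i) = i.+1.
Proof.
move=> im; apply/eqP; rewrite eqn_leq; apply/andP; split; last by rewrite lt_num_le.
rewrite leqNgt; apply/negP => i1.
have i1m : (i.+1 < m)%N by exact: leq_trans i1 (num_le_bound _).
by move: i1; rewrite lt_num_le// design_le// ltnn.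
Qed.

(** Clipping a fit to [- B, B], where [B] bounds all the responses, does not
increase the sum of squares; the clipped nondecreasing vectors of fitted
values form a compact set. *)
Lemma isotonic_optimal_exists : (0 < m)%N -> exists h, isotonic_optimal h.
Proof.
move=> m0.
pose B : R := \sum_(i < m) `|y i|.
have yB i : (i < m)%N -> `|y i| <= B.
  move=> im; rewrite /B (bigD1 (Ordinal im)) //= lerDl.
  by apply: sumr_ge0.
have B0 : 0 <= B by apply: sumr_ge0.
pose bounded := [set v : 'rV[R]_m | forall i, (v ord0 i) \in `[- B, B] ].
pose sorted_ := [set v : 'rV[R]_m | forall i j : 'I_m, (i <= j)%N -> v ord0 i <= v ord0 j].
pose A := bounded `&` sorted_.
have coordc (i : 'I_m) : continuous (fun v : 'rV[R]_m => v ord0 i).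
  exact: (@coord_continuous R 1 m ord0 i).
have cA : compact A.
  apply: compact_closedI.
    apply: (@rV_compact R m (fun=> [set` `[- B, B]])) => i.
    exact: segment_compact.
  rewrite (_ : sorted_ = \bigcap_(ij in [set ij : 'I_m * 'I_m | (ij.1 <= ij.2)%N])
      [set v : 'rV[R]_m | v ord0 ij.1 - v ord0 ij.2 <= 0]); last first.
    apply/seteqP; split=> v hv /= ij.
      by move=> ij12 /=; rewrite subr_le0; exact: hv.
    by move=> j ijj; rewrite -subr_le0; exact: (hv (ij, j)).
  apply: closed_bigI => -[i j] _ /=.
  apply: (@preimage_closed _ _ (fun v : 'rV[R]_m => v ord0 i - v ord0 j) [set t | t <= 0]).
    move=> v _; have cd : continuous (fun v : 'rV[R]_m => v ord0 i - v ord0 j).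
      by move=> w; exact: (cvgB (coordc i w) (coordc j w)).
    exact: cd.
  exact: closed_le.
pose loss (v : 'rV[R]_m) := \sum_(i < m) (y i - v ord0 i) ^+ 2.
have closs : continuous loss.
  rewrite /loss; elim: (index_enum _) => [|i s IH] v.
    rewrite (_ : (fun _ => _) = (fun=> 0 : R)); first exact: cst_continuous.
    by apply/funext => u; rewrite big_nil.
  rewrite (_ : (fun _ => _) = (fun u : 'rV[R]_m => (y i - u ord0 i) ^+ 2 +
      \sum_(j <- s) (y j - u ord0 j) ^+ 2)); last first.
    by apply/funext => u; rewrite big_cons.
  apply: (@cvgD _ R^o _ (nbhs v) _ (fun u : 'rV[R]_m => (y i - u ord0 i) ^+ 2)); last exact: IH.
  apply: (@continuous_comp _ _ _ (fun v : 'rV[R]_m => y i - v ord0 i) (fun t => t ^+ 2)).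
    exact: (continuousB (@cst_continuous _ R^o (y i) v) (coordc i v)).
  exact: exprn_continuous.
have A0 : A !=set0.
  exists 0; split=> [i|i j _]; last by rewrite !mxE.
  by rewrite mxE in_itv /= oppr_le0 B0.
have [v vA vmin] := EVT_min_rV A0 cA (continuous_subspaceT closs).
move: vA; rewrite inE => -[vb vs].
have m1 t : ((num_le m x t).-1 < m)%N.
  by case: (num_le m x t) (num_le_bound t) => [|k].
pose h t := v ord0 (Ordinal (m1 t)).
exists h; split.
  move=> s t _ _ st; apply: vs => /=.
  have := num_le_homo st; case: (num_le m x s) => [|k] //=.
  by case: (num_le m x t).
move=> k k_nd.
pose clip (t : R) := Num.max (- B) (Num.min t B).
pose vk := \row_(i < m) clip (k (x i)).
have clip_nd s t : s <= t -> clip s <= clip t.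
  move=> st; rewrite /clip ge_max !le_max lexx /=; apply/orP; right.
  by rewrite le_min !ge_min st lexx orbT.
have vkA : vk \in A.
  rewrite inE; split=> [i|i j ij].
    rewrite mxE in_itv /= /clip le_max lexx /= ge_max ge_min lexx orbT andbT.
    by rewrite (le_trans _ B0)// oppr_le0.
  rewrite !mxE; apply: clip_nd; apply: k_nd; rewrite ?in_itv /= ?x01//.
  by rewrite design_le.
have -> : sum_sq m x y h = loss v.
  apply: eq_bigr => i _; congr ((_ - v ord0 _) ^+ 2); apply: val_inj => /=.
  by rewrite num_le_design.
apply: (le_trans (vmin _ vkA)); apply: ler_sum => i _; rewrite mxE.
have := yB i (ltn_ord i); rewrite ler_norml => /andP[y1 y2].
rewrite /clip; have [kB|Bk] := leP (k (x i)) B.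
  have [Bk|kB'] := leP (- B) (k (x i)); first by [].
  by nra.
by rewrite max_r; [nra|lra].
Qed.

Lemma isotonic_fit_optimal : (0 < m)%N -> isotonic_optimal (isotonic_fit m x y).
Proof.
move=> m0; have [h hh] := isotonic_optimal_exists m0.
by apply: (@getPex _ [set h | isotonic_optimal h]); exists h.
Qed.

(** The integer [j] counts the design points at which the fit is below [theta].
The fit jumps across [theta] there, so that the blocks ending or starting at
[j] satisfy the block inequalities, in which the fitted values may be replaced
by [theta]. *)
Lemma dhat1_crossing theta : (0 < m)%N -> exists j,
  [/\ (j <= m)%N,
      forall l, (l < j)%N -> \sum_(l <= i < j) (y i - theta) <= 0,
      forall l, (j <= l < m)%N -> 0 <= \sum_(j <= i < l.+1) (y i - theta),
      forall t, 0 <= t <= 1 -> t < dhat1 theta m x y -> (num_le m x t <= j)%N &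
      forall t, t <= 1 -> dhat1 theta m x y < t -> (j <= num_le m x t)%N].
Proof.
move=> m0.
have opt := isotonic_fit_optimal m0; set h := isotonic_fit m x y in opt *.
have h_nd i k : (i <= k)%N -> (k < m)%N -> h (x i) <= h (x k).
  move=> ik km; have im := leq_ltn_trans ik km.
  by apply: opt.1; rewrite ?in_itv /= ?x01// design_le.
have [j [jm jP]] : exists j, (j <= m)%N /\ forall i, (i < m)%N -> (i < j)%N = (h (x i) < theta).
  have [/existsP[i0 hi0]|none] := boolP [exists i : 'I_m, theta <= h (x i)]; last first.
    exists m; split=> // i im; rewrite im; apply/esym.
    rewrite ltNge; apply: contra none => hi.
    by apply/existsP; exists (Ordinal im).
  have ex : exists i, (i < m)%N && (theta <= h (x i)) by exists i0; rewrite ltn_ord.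
  case: (ex_minnP ex) => j /andP[jm hj] jmin; exists j; split; first exact: ltnW.
  move=> i im; case: (ltnP i j) => ij; apply/esym.
    by rewrite ltNge; apply/negP => hi; have := jmin i; rewrite im hi leqNgt ij => /(_ isT).
  by apply/negbTE; rewrite -leNgt (le_trans hj)// h_nd.
have stepE t : isotonic_step m x y t = h (x (num_le m x t).-1) by [].
have pm t : ((num_le m x t).-1 < m)%N.
  by case: (num_le m x t) (num_le_bound t) => [|k].
exists j; split=> //.
- move=> l lj; have := @block_sum_left h j l opt.
  rewrite lj jm => /(_ isT) H.
  have j1m : (j.-1 < m)%N by case: (j) lj jm.
  have j1j : (j.-1 < j)%N by case: (j) lj.
  apply: le_trans (H _).
    rewrite !big_nat; apply: ler_sum => i /andP[_ ij].
    by rewrite lerB// ltW// -jP// (leq_trans ij).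
  move=> i /andP[ji im]; apply: (@lt_le_trans _ _ theta); first by rewrite -jP.
  by rewrite leNgt -jP// -leqNgt.
- move=> l /andP[jl lm]; have := @block_sum_right h j l opt.
  rewrite jl lm => /(_ isT) H; have jm' := leq_ltn_trans jl lm.
  have hj : theta <= h (x j) by rewrite leNgt -jP// ltnn.
  apply: le_trans (H _) _.
    move=> i ij; apply: lt_le_trans hj; rewrite -jP//; exact: ltn_trans ij jm'.
  rewrite !big_nat; apply: ler_sum => i /andP[ji il].
  have im : (i < m)%N := leq_trans il lm.
  by rewrite lerB// leNgt -jP// -leqNgt.
- move=> t t01 tlt; rewrite leqNgt; apply/negP => jt.
  have At : [set t | 0 <= t <= 1 /\ theta <= isotonic_step m x y t] t.
    split=> //; rewrite stepE leNgt -jP// -leqNgt.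
    by case: (num_le m x t) jt.
  move: tlt; rewrite /dhat1 asboolT; last by exists t.
  rewrite ltNge => /negP; apply; apply: ge_inf => //.
  by exists 0 => s [/andP[]].
- move=> t t1; rewrite /dhat1; case: asboolP => [A0|_]; last by rewrite ltNge t1.
  move=> /(inf_lt A0)[s [s01]]; rewrite stepE leNgt -jP// -leqNgt => js st.
  apply: (leq_trans js); apply: leq_trans (leq_pred _) _.
  exact/num_le_homo/ltW.
Qed.

End isotonic_regression.

Section crossing_point.
Context {R : realType}.
Context (m : nat) (x e : nat -> R) (f : R -> R) (d0 delta rho tau : R).
Hypothesis hx : is_design m x.
Hypothesis m_gt0 : (0 < m)%N.
Hypothesis f_incr : {in `[0, 1] &, {homo f : a b / a < b}}.
Hypotheses (delta_gt0 : 0 < delta) (lo0 : 0 < d0 - delta) (hi1 : d0 + delta < 1).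
Let N t := num_le m x t.
Local Ltac arith :=
  have ? := delta_gt0; have ? := lo0; have ? := hi1; lra.
(** At least a fraction [rho] of the design points within [delta] of [d0], on
either side, lies in the half of that window that is away from [d0], where [f]
has moved by more than [tau / rho] from [f d0]. *)
Hypotheses (rho1 : rho <= 1).
Hypotheses (right_points : (N d0 < N (d0 + delta))%N) (left_points : (N (d0 - delta) < N d0)%N).
Hypothesis right_half :
  rho * (N (d0 + delta) - N d0)%:R <= (N (d0 + delta) - N (d0 + delta / 2))%:R.
Hypothesis left_half :
  rho * (N d0 - N (d0 - delta))%:R <= (N (d0 - delta / 2) - N (d0 - delta))%:R.
Hypothesis rise_right : tau < rho * (f (d0 + delta / 2) - f d0).
Hypothesis rise_left : tau < rho * (f d0 - f (d0 - delta / 2)).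
Hypothesis averages : forall a b, (a <= b <= m)%N ->
  ((N (d0 + delta) - N d0 <= b - a)%N || (N d0 - N (d0 - delta) <= b - a)%N) ->
  `|\sum_(a <= i < b) e i| <= tau * (b - a)%:R.

Let f_le s t : 0 <= s -> s <= t -> t <= 1 -> f s <= f t.
Proof.
move=> s0; rewrite le_eqVlt => /predU1P[-> //|st t1].
by apply/ltW/f_incr => //; rewrite in_itv /= ?s0 ?(ltW (lt_le_trans st t1)) ?t1 ?(le_trans s0 (ltW st)).
Qed.

(** If the estimate were below [d0 - delta], the block from the crossing index to
[d0] would have a nonnegative sum of [y - f d0]. On that block the drift of
[f] contributes less than [- tau] times its length, and the errors at most
[tau] times its length. The other side is symmetric. *)
Lemma dhat1_near : `|dhat1 (f d0) m x (fun i => f (x i) + e i) - d0| <= delta.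
Proof.
have [j [jm neg pos low up]] := dhat1_crossing (fun i => f (x i) + e i) hx (f d0) m_gt0.
have x01 i : (i < m)%N -> 0 <= x i <= 1 by exact: hx.1.
have f_lt s t : 0 <= s -> s < t -> t <= 1 -> f s < f t.
  move=> s0 st t1; apply: f_incr => //; rewrite in_itv /= ?s0 ?t1 /=.
    by rewrite (le_trans (ltW st)).
  by rewrite (le_trans s0 (ltW st)).
rewrite ler_distl; apply/andP; split; rewrite leNgt; apply/negP => far.
- have jl : (j <= N (d0 - delta))%N by apply: (up _ _ far); arith.
  have jn0 : (j < N d0)%N by exact: leq_ltn_trans left_points.
  have n0m : (N d0 <= m)%N by exact: num_le_bound.
  have l12 : (N (d0 - delta) <= N (d0 - delta / 2))%N by apply: num_le_homo; arith.
  have l23 : (N (d0 - delta / 2) <= N d0)%N by apply: num_le_homo; arith.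
  have n0K : (N d0).-1.+1 = N d0 by case: (N d0) jn0.
  have jn0' : (j <= (N d0).-1)%N by rewrite -ltnS n0K.
  have := pos (N d0).-1; rewrite n0K n0m jn0' => /(_ isT).
  under eq_bigr do rewrite addrAC.
  rewrite big_split /= => sum_ge0.
  have := averages (a := j) (b := N d0).
  rewrite (ltnW jn0) n0m => /(_ isT).
  rewrite [X in _ || X](leq_sub2l _ jl) orbT => /(_ isT) avg.
  have drift : \sum_(j <= i < N d0) (f (x i) - f d0) <=
      - ((f d0 - f (d0 - delta / 2)) * (N (d0 - delta / 2) - j)%:R).
    rewrite (big_cat_nat _ (n := N (d0 - delta / 2))) //=; last exact: leq_trans l12.
    rewrite -[leRHS]addr0; apply: lerD.
      rewrite [leRHS](_ : _ = (f (d0 - delta / 2) - f d0) *+ (N (d0 - delta / 2) - j)); last first.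
        by rewrite -[RHS]mulr_natr -mulNr opprB.
      rewrite -sumr_const_nat !big_nat; apply: ler_sum => i /andP[ji il].
      have im : (i < m)%N by apply: leq_trans il _; exact: num_le_bound.
      rewrite lerB// f_le//; have /andP[] := x01 i im => //.
        by move=> _ _; rewrite -(lt_num_le hx).
      by move=> _ _; arith.
    rewrite big_nat; apply: sumr_le0 => i /andP[ji il].
    have im : (i < m)%N by apply: leq_trans il _.
    rewrite subr_le0 f_le//; have /andP[] := x01 i im => //.
      by move=> _ _; rewrite -(lt_num_le hx).
    by move=> _ _; arith.
  have cnt : rho * (N d0 - j)%:R <= (N (d0 - delta / 2) - j)%:R.
    move: left_half; rewrite !natrB ?(leq_trans jl)// ?(ltnW left_points)// ?(ltnW jn0)//.
    have : 0 <= (1 - rho) * ((N (d0 - delta))%:R - j%:R).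
      by rewrite mulr_ge0 ?subr_ge0// ler_nat.
    by move=> ? ?; lra.
  have l0 : 0 < (N d0 - j)%:R :> R by rewrite ltr0n subn_gt0.
  have D0 : 0 <= f d0 - f (d0 - delta / 2) by rewrite subr_ge0 f_le//; arith.
  have h1 := ler_wpM2l D0 cnt.
  have h2 : tau * (N d0 - j)%:R < rho * (f d0 - f (d0 - delta / 2)) * (N d0 - j)%:R.
    by rewrite ltr_pM2r.
  have h3 := le_trans (ler_norm _) avg.
  by lra.
- have jr : (N (d0 + delta) <= j)%N by apply: (low _ _ far); apply/andP; split; arith.
  have n0j : (N d0 < j)%N by exact: leq_trans jr.
  have l12 : (N d0 <= N (d0 + delta / 2))%N by apply: num_le_homo; arith.
  have l23 : (N (d0 + delta / 2) <= N (d0 + delta))%N by apply: num_le_homo; arith.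
  have := neg (N d0) n0j.
  under eq_bigr do rewrite addrAC.
  rewrite big_split /= => sum_le0.
  have := averages (a := N d0) (b := j).
  rewrite (ltnW n0j) jm => /(_ isT).
  rewrite [X in X || _](leq_sub2r _ jr) => /(_ isT) avg.
  have drift : (f (d0 + delta / 2) - f d0) * (j - N (d0 + delta / 2))%:R <=
      \sum_(N d0 <= i < j) (f (x i) - f d0).
    rewrite (big_cat_nat _ (n := N (d0 + delta / 2))) //=; last exact: leq_trans l23 jr.
    rewrite -[leLHS]add0r; apply: lerD.
      rewrite big_nat; apply: sumr_ge0 => i /andP[ji il].
      have im : (i < m)%N by apply: leq_trans il _; exact: num_le_bound.
      rewrite subr_ge0 f_le//; [arith| |by have /andP[] := x01 i im].
      by apply/ltW; rewrite ltNge -(lt_num_le hx)// -leqNgt.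
    rewrite mulr_natr -sumr_const_nat !big_nat; apply: ler_sum => i /andP[ji il].
    have im : (i < m)%N by apply: leq_trans il _.
    rewrite lerB// f_le//; [arith| |by have /andP[] := x01 i im].
    by apply/ltW; rewrite ltNge -(lt_num_le hx)// -leqNgt.
  have cnt : rho * (j - N d0)%:R <= (j - N (d0 + delta / 2))%:R.
    move: right_half; rewrite !natrB ?(leq_trans l23)// ?(ltnW right_points)// ?(ltnW n0j)//.
    have : 0 <= (1 - rho) * (j%:R - (N (d0 + delta))%:R).
      by rewrite mulr_ge0 ?subr_ge0// ler_nat.
    by move=> ? ?; lra.
  have l0 : 0 < (j - N d0)%:R :> R by rewrite ltr0n subn_gt0.
  have D0 : 0 <= f (d0 + delta / 2) - f d0 by rewrite subr_ge0 f_le//; arith.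
  have h1 := ler_wpM2l D0 cnt.
  have h2 : tau * (j - N d0)%:R < rho * (f (d0 + delta / 2) - f d0) * (j - N d0)%:R.
    by rewrite ltr_pM2r.
  have := avg; rewrite ler_norml => /andP[h3 _].
  by lra.
Qed.

End crossing_point.

(** * Rate of the first-stage estimator *)

Section local_estimates.
Context {R : realType}.
Implicit Types (f g : R -> R) (a : R).

Lemma derivable_first_order f a eps : derivable f a 1 -> 0 < eps ->
  exists2 r, 0 < r & forall y, `|y - a| < r ->
    `|f y - f a - derive1 f a * (y - a)| <= eps * `|y - a|.
Proof.
move=> df eps0.
have lim_f : (fun h => h^-1 *: (f (h *: 1 + a) - f a)) @ 0^' --> 'D_1 f a := df.
move/cvgrPdist_le : lim_f => /(_ _ eps0) /nbhs_ballP[r /= r0 H].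
exists r => // y yr.
have [->|ya] := eqVneq y a; first by rewrite !subrr mulr0 subrr !normr0 mulr0.
have h0 : y - a != 0 by rewrite subr_eq0.
have := H (y - a); rewrite /ball /= sub0r normrN => /(_ yr h0).
rewrite /GRing.scale /= mulr1 subrK -derive1E -(ler_pM2r (x := `|y - a|)) ?normr_gt0// -normrM => h; apply: le_trans h.
by rewrite le_eqVlt -normrN; apply/orP; left; apply/eqP; congr (`|_|); field.
Qed.

Lemma is_derive01_continuous g a l eps : 0 < a < 1 -> is_derive01 g a l -> 0 < eps ->
  exists2 r, 0 < r & forall y, `|y - a| < r -> `|g y - g a| <= eps.
Proof.
move=> /andP[a0 a1] /cvgrPdist_le /(_ _ ltr01) /nbhs_ballP[r /= r0 H] eps0.
pose M := `|l| + 1; have M0 : 0 < M by rewrite ltr_pwDr.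
exists (Num.min (Num.min r (eps / M)) (Num.min a (1 - a))).
  by rewrite !lt_min r0 a0 subr_gt0 a1 divr_gt0.
move=> y; rewrite !lt_min => /andP[/andP[yr yM] /andP[ya y1a]].
have [->|nya] := eqVneq y a; first by rewrite subrr normr0 ltW.
have y01 : [set` `[0, 1]] y.
  rewrite /= in_itv /=; move: ya y1a; rewrite !ltr_norml.
  by move=> /andP[? ?] /andP[? ?]; apply/andP; split; lra.
have h0 : y - a != 0 by rewrite subr_eq0.
have := H y; rewrite /ball /= distrC => /(_ yr nya y01) Hy.
have : `|(g y - g a) / (y - a)| <= M.
  have -> : (g y - g a) / (y - a) = l - (l - (g y - g a) / (y - a)) by ring.
  by apply: (le_trans (ler_normB _ _)); rewrite lerD2l.
rewrite normrM normfV ler_pdivrMr ?normr_gt0// => /le_trans; apply.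
by rewrite mulrC -ler_pdivlMr// ltW.
Qed.

End local_estimates.

Section design_density.
Context {R : realType}.
Local Notation num_le := Defs.num_le.

Lemma density_increment (G g : R -> R) s t lo hi :
  has_density G g -> s <= t -> (forall y, s < y <= t -> lo <= g y <= hi) -> 0 <= lo ->
  lo * (t - s) <= G t - G s <= hi * (t - s).
Proof.
move=> [mg g0 _ GE] st gb lo0.
have mgE A : measurable A -> measurable_fun A (EFin \o g).
  by move=> mA; apply/measurable_EFinP; apply: measurable_funTS.
have itvE : `]-oo, t]%classic = `]-oo, s] `|` `]s, t] :> set R.
  by rewrite -itv_bndbnd_setU// bnd_simp.
have inc : ((G t - G s)%:E = \int[lebesgue_measure]_(y in `]s, t]) (g y)%:E)%E.
  have := GE t; rewrite itvE ge0_integral_setU//=; first 1 last.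
  - by rewrite -itvE; exact: mgE.
  - by move=> y _; rewrite lee_fin.
  - apply/disj_setPS => y [] /=; rewrite !in_itv /= => ys /andP[sy _].
    by move: (le_lt_trans ys sy); rewrite ltxx.
  by rewrite -GE EFinB => ->; rewrite addeAC subee// add0e.
have len (c : R) : (\int[lebesgue_measure]_(y in `]s, t]) c%:E = (c * (t - s))%:E)%E.
  rewrite integral_cst//= lebesgue_measure_itv /= lte_fin.
  move: st; rewrite le_eqVlt => /predU1P[->|st']; last by rewrite st' -EFinD -EFinM.
  rewrite ltxx.
  by rewrite mule0 subrr mulr0.
apply/andP; split; rewrite -lee_fin inc -len; apply: ge0_le_integral => //=.
all: try exact: mgE.
all: try by move=> y; rewrite in_itv /= => /gb /andP[h1 h2]; rewrite lee_fin ?(le_trans lo0) ?(le_trans h1).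
Qed.

(** Near [d0] the density is between [g d0 / 2] and [2 * g d0], and the empirical
distribution function of the design is within [c / Num.sqrt m] of [G]. *)
Lemma num_le_density (x : nat -> nat -> R) (d0 : R) : 0 < d0 < 1 -> assumption_A2 x ->
  exists lo hi c r, [/\ 0 < lo, 0 < hi, 0 <= c, 0 < r &
    forall m s t, (0 < m)%N -> d0 - r < s -> s <= t -> t < d0 + r ->
      lo * (t - s) * m%:R - c * Num.sqrt m%:R <=
        (num_le m (x m) t)%:R - (num_le m (x m) s)%:R
        <= hi * (t - s) * m%:R + c * Num.sqrt m%:R].
Proof.
move=> d01 [G [g [dens gpos [dg [M dgP]] [c cP]]]].
have /andP[d00 d011] := d01.
have din : d0 \in `[0, 1] by rewrite in_itv /= !ltW.
have gd := gpos _ din; have [dd _] := dgP _ din.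
have g2 : 0 < g d0 / 2 by rewrite divr_gt0.
have [r r0 rP] := is_derive01_continuous d01 dd g2.
exists (g d0 / 2), (2 * g d0), (2 * Num.max c 0), (Num.min r (Num.min d0 (1 - d0))).
split; rewrite ?mulr_gt0 ?mulr_ge0 ?le_max ?lexx ?orbT//.
  by rewrite !lt_min r0 d00 subr_gt0.
move=> m s t m0 ds st td.
have [rr [rd r1]] : Num.min r (Num.min d0 (1 - d0)) <= r /\
    Num.min r (Num.min d0 (1 - d0)) <= d0 /\ Num.min r (Num.min d0 (1 - d0)) <= 1 - d0.
  by rewrite !ge_min !lexx !orbT.
set rho := Num.min r _ in ds td rr rd r1.
have inc : g d0 / 2 * (t - s) <= G t - G s <= 2 * g d0 * (t - s).
  apply: (density_increment dens st _ (ltW g2)) => y /andP[sy yt].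
  have : `|y - d0| < r by rewrite ltr_distl; apply/andP; split; lra.
  by move=> /rP; rewrite ler_distl => /andP[? ?]; apply/andP; split; lra.
have sm : 0 < Num.sqrt m%:R :> R by rewrite sqrtr_gt0 ltr0n.
have mE : m%:R = Num.sqrt m%:R * Num.sqrt m%:R :> R by rewrite -expr2 sqr_sqrtr.
have ecdf_near y : 0 <= y <= 1 ->
    `|(num_le m (x m) y)%:R - G y * m%:R| <= Num.max c 0 * Num.sqrt m%:R.
  move=> y01.
  have : `|ecdf m (x m) y - G y| <= c / Num.sqrt m%:R.
    rewrite -lee_fin; apply: le_trans (cP _ m0).
    by apply: ereal_sup_ubound; exists y => //=; rewrite in_itv.
  have m0' : 0 < m%:R :> R by rewrite ltr0n.
  have -> : (num_le m (x m) y)%:R - G y * m%:R = (ecdf m (x m) y - G y) * m%:R.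
    by rewrite /ecdf; field; rewrite gt_eqF.
  rewrite normrM (gtr0_norm m0') -(ler_pM2r m0') => /le_trans; apply.
  rewrite {2}mE mulrA divfK ?gt_eqF// ler_wpM2r ?le_max ?lexx// ltW//.
have := ecdf_near s; have := ecdf_near t.
rewrite !ler_norml.
move=> /(_ _) /andP[]; first by apply/andP; split; lra.
move=> t1 t2 /(_ _) /andP[]; first by apply/andP; split; lra.
move=> s1 s2; have /andP[i1 i2] := inc.
have m0' : 0 <= m%:R :> R by rewrite ler0n.
have := ler_wpM2r m0' i1; have := ler_wpM2r m0' i2.
set S := Num.max c 0 * _ in t1 t2 s1 s2 *.
by move=> ? ?; apply/andP; rewrite -[2 * _ * Num.sqrt _]mulrA -/S; split; lra.
Qed.

(** Since [Num.sqrt (N n) * u n] tends to infinity, the discrepancy of the design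
is negligible at the scale [u]: windows of width [eta * u n] contain a number
of design points of the exact order [eta * u n * N n]. The drift of [f] over
such a window is of order [eta * u n], which the averages of the errors do not
reach. *)
Lemma dhat1_rate (x : nat -> nat -> R) (d0 : R) (f : R -> R)
    (N : nat -> nat) (u : nat -> R) (e : nat -> nat -> R) :
  (forall m, is_design m (x m)) -> assumption_A2 x ->
  0 < d0 < 1 -> {in `[0, 1] &, {homo f : a b / a < b}} ->
  derivable f d0 1 -> 0 < derive1 f d0 ->
  (forall n, 0 < u n) -> u n @[n --> \oo] --> 0 ->
  (Num.sqrt (N n)%:R * u n) @[n --> \oo] --> +oo ->
  small_averages N u e ->
  forall eta, 0 < eta -> \forall n \near \oo,
    `|dhat1 (f d0) (N n) (x (N n)) (fun i => f (x (N n) i) + e n i) - d0| <= eta * u n.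
Proof.
move=> hx hA2 d01 fincr df f'0 u0 ucvg Nu small eta eta0.
have /andP[d00 d011] := d01.
have [lo [hi [c [r [lo0 hi0 c0 r0 cnt]]]]] := num_le_density d01 hA2.
have f'2 : 0 < derive1 f d0 / 2 by rewrite divr_gt0.
have [r' r'0 rise] := derivable_first_order df f'2.
pose rho := lo / (4 * (lo + hi)).
have lohi : 0 < 4 * (lo + hi) by rewrite mulr_gt0 ?addr_gt0.
have rho0 : 0 < rho by rewrite divr_gt0.
have rho1 : rho <= 1 by rewrite ler_pdivrMr//; lra.
pose small1 := Num.min (3 / 4 * (lo * eta)) (rho * derive1 f d0 / 8 * eta).
have small0 : 0 < small1 by rewrite lt_min !mulr_gt0 ?invr_gt0.
pose j := Num.truncn small1^-1.
have jP : j.+1%:R^-1 <= small1.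
  by rewrite -[leRHS]invrK lef_pV2 ?posrE ?invr_gt0// ltW// truncnS_gt.
have ult z : 0 < z -> \forall n \near \oo, eta * u n < z.
  move=> z0; have z1 : 0 < z / eta by rewrite divr_gt0.
  have : \forall n \near \oo, u n < z / eta by apply: (cvgr_lt (0 : R)).
  by apply: filterS => n; rewrite ltr_pdivlMr// mulrC.
near=> n.
have dr : eta * u n < r by near: n; exact: ult.
have dr' : eta * u n < r' by near: n; exact: ult.
have dd0 : eta * u n < d0 by near: n; exact: ult.
have d1d0 : eta * u n < 1 - d0 by near: n; apply: ult; rewrite subr_gt0.
have big : 4 * c / (lo * eta) < Num.sqrt (N n)%:R * u n by near: n; move/cvgryPgt : Nu; apply.
have averages : forall a b, (a <= b <= N n)%N ->
    (N n)%:R * u n / j.+1%:R <= (b - a)%:R ->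
    `|\sum_(a <= i < b) e n i| <= (b - a)%:R * u n / j.+1%:R.
  by near: n; exact: small.
set m := N n in big averages *; set delta := eta * u n in dr dr' dd0 d1d0 *.
have delta0 : 0 < delta by rewrite mulr_gt0.
have m0 : (0 < m)%N.
  rewrite lt0n; apply/negP => /eqP m0; move: big; rewrite m0 sqrtr0 mul0r ltNge.
  by rewrite divr_ge0// mulr_ge0 ?(ltW lo0) ?(ltW eta0).
have m0' : 0 < m%:R :> R by rewrite ltr0n.
have sm : 0 < Num.sqrt m%:R :> R by rewrite sqrtr_gt0.
have noise : c * Num.sqrt m%:R <= lo * delta / 4 * m%:R.
  have mE : m%:R = Num.sqrt m%:R * Num.sqrt m%:R :> R by rewrite -expr2 sqr_sqrtr ?ltW.
  rewrite [in leRHS]mE mulrA ler_pM2r//.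
  move: big; rewrite ltr_pdivrMr ?mulr_gt0// /delta => big.
  by apply: ltW; lra.
have sd : Num.sqrt m%:R = Num.sqrt m%:R :> R by [].
set s := Num.sqrt m%:R in noise.
have c1 a b := cnt m a b m0.
have pr1 : 0 < lo * delta * m%:R by rewrite !mulr_gt0.
have pr2 : 0 < hi * delta * m%:R by rewrite !mulr_gt0.
have half : delta / 2 < delta by rewrite ltr_pdivrMr// ltr_pMr// ltr1n.
have rhoE : rho * ((lo + hi) * delta * m%:R) = lo * delta * m%:R / 4.
  by rewrite /rho; field; rewrite gt_eqF// addr_gt0.
have full a : d0 - r < a -> a + delta < d0 + r ->
    3 / 4 * (lo * delta * m%:R) <=
      (num_le m (x m) (a + delta))%:R - (num_le m (x m) a)%:R
      <= (lo + hi) * delta * m%:R.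
  move=> ra ar; have aa : a <= a + delta by rewrite lerDl ltW.
  have := cnt m a (a + delta) m0 ra aa ar; rewrite -/s [a + delta - a]addrAC subrr add0r.
  by move=> /andP[h1 h2]; apply/andP; split; clear -h1 h2 noise pr1 pr2; lra.
have halfw a : d0 - r < a -> a + delta / 2 < d0 + r ->
    lo * delta * m%:R / 4 <=
      (num_le m (x m) (a + delta / 2))%:R - (num_le m (x m) a)%:R.
  move=> ra ar; have aa : a <= a + delta / 2 by rewrite lerDl divr_ge0// ltW.
  have := cnt m a (a + delta / 2) m0 ra aa ar; rewrite -/s [a + delta / 2 - a]addrAC subrr add0r.
  by move=> /andP[h1 h2]; clear -h1 h2 noise pr1 pr2; lra.
pose tau := rho * derive1 f d0 / 8 * delta.
have tauP : 0 < rho * derive1 f d0 * delta by rewrite (mulr_gt0 (mulr_gt0 rho0 f'0)).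
have ltNd k l : (k%:R < l%:R :> R) = (k < l)%N by rewrite ltr_nat.
have right_full := full d0; have left_full := full (d0 - delta).
have right_top := halfw (d0 + delta / 2); have left_bot := halfw (d0 - delta).
have e1 : d0 - delta + delta = d0 by rewrite subrK.
have e2 : d0 + delta / 2 + delta / 2 = d0 + delta by clear; lra.
have e3 : d0 - delta + delta / 2 = d0 - delta / 2 by clear; lra.
have i1 : d0 - r < d0 by clear -r0; lra.
have i2 : d0 + delta < d0 + r by clear -dr; lra.
have i3 : d0 - r < d0 - delta by clear -dr; lra.
have i4 : d0 < d0 + r by clear -r0; lra.
have i5 : d0 - r < d0 + delta / 2 by clear -r0 delta0; lra.
have i6 : d0 - delta / 2 < d0 + r by clear -r0 delta0; lra.
rewrite {}e1 in left_full; rewrite {}e2 in right_top; rewrite {}e3 in left_bot.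
have /andP[rf1 rf2] := right_full i1 i2.
have /andP[lf1 lf2] := left_full i3 i4.
have rt := right_top i5 i2; have lb := left_bot i3 i6.
clear right_full left_full right_top left_bot full halfw cnt c1.
have n1 : (num_le m (x m) d0 <= num_le m (x m) (d0 + delta))%N.
  by apply: num_le_homo; clear -delta0; lra.
have n2 : (num_le m (x m) (d0 + delta / 2) <= num_le m (x m) (d0 + delta))%N.
  by apply: num_le_homo; clear -delta0; lra.
have n3 : (num_le m (x m) (d0 - delta) <= num_le m (x m) d0)%N.
  by apply: num_le_homo; clear -delta0; lra.
have n4 : (num_le m (x m) (d0 - delta) <= num_le m (x m) (d0 - delta / 2))%N.
  by apply: num_le_homo; clear -delta0; lra.
apply: (@dhat1_near R m (x m) (e n) f d0 delta rho tau) => //.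
- by clear -dd0; lra.
- by clear -d1d0; lra.
- by rewrite -ltNd; clear -rf1 pr1; lra.
- by rewrite -ltNd; clear -lf1 pr1; lra.
- rewrite !natrB//; have := ler_wpM2l (ltW rho0) rf2; rewrite rhoE => h.
  by clear -h rt; lra.
- rewrite !natrB//; have := ler_wpM2l (ltW rho0) lf2; rewrite rhoE => h.
  by clear -h lb; lra.
- have := rise (d0 + delta / 2).
  rewrite [d0 + _ - _]addrAC subrr add0r gtr0_norm ?divr_gt0// => /(_ (lt_trans half dr')).
  rewrite ler_norml => /andP[lower _].
  have : derive1 f d0 * delta / 4 <= f (d0 + delta / 2) - f d0.
    by clear -lower; lra.
  by move=> /(ler_wpM2l (ltW rho0)) h; rewrite /tau; clear -h tauP; lra.
- have := rise (d0 - delta / 2).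
  rewrite [d0 - _ - _]addrAC subrr add0r normrN gtr0_norm ?divr_gt0// => /(_ (lt_trans half dr')).
  rewrite ler_norml => /andP[_ upper].
  have : derive1 f d0 * delta / 4 <= f d0 - f (d0 - delta / 2).
    by clear -upper; lra.
  by move=> /(ler_wpM2l (ltW rho0)) h; rewrite /tau; clear -h tauP; lra.
- move=> a b abm win.
  have big' : 3 / 4 * (lo * delta * m%:R) <= (b - a)%:R.
    by case/orP: win; rewrite -(ler_nat R) => /(le_trans _); apply; rewrite natrB.
  have uj : u n / j.+1%:R <= u n * small1 by rewrite ler_pM2l.
  have ba0 : 0 <= (b - a)%:R :> R by [].
  apply: le_trans (averages a b abm _) _.
  + rewrite -mulrA; apply: le_trans (ler_wpM2l (ltW m0') uj) _.
    apply: le_trans big'; rewrite /delta.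
    have : small1 <= 3 / 4 * (lo * eta) by rewrite ge_min lexx.
    by move=> /(ler_wpM2l (ltW (mulr_gt0 m0' (u0 n)))) h; clear -h; lra.
  + rewrite [tau * _]mulrC -mulrA ler_wpM2l// (le_trans uj)// /tau /delta.
    have : small1 <= rho * derive1 f d0 / 8 * eta by rewrite ge_min lexx orbT.
    by move=> /(ler_wpM2l (ltW (u0 n))) h; clear -h; lra.
Unshelve. all: by end_near.
Qed.

End design_density.

(** * The bootstrap law for a fixed sequence of data *)

Section centered_means.
Context {R : realType} (I : finType) (c : R) (e : I -> R).
Hypothesis I_gt0 : (0 < #|I|)%N.

Lemma mean_shift : mean (fun i => c + e i) = c + mean e.
Proof. by rewrite meanD mean_cst. Qed.

Lemma mean_centered_sqr :
  mean (fun i => (c + e i - mean (fun j => c + e j)) ^+ 2) =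
  mean (fun i => e i ^+ 2) - mean e ^+ 2.
Proof.
rewrite mean_shift; set b := mean e.
rewrite (_ : (fun i => _) = (fun i => (e i ^+ 2 + b ^+ 2) + (- 2 * b) * e i)).
  rewrite !meanD mean_cst// (_ : mean (fun i => - 2 * b * e i) = - 2 * b * b); first by ring.
  exact: meanZ.
by apply/funext => i; ring.
Qed.

(** The bound [`|z| ^+ 3 <= 1 + z ^+ 4] reduces the third absolute moment to
averages of powers of the errors. *)
Lemma mean_centered_abs3 :
  mean (fun i => `|c + e i - mean (fun j => c + e j)| ^+ 3) <=
  1 + 8 * (mean (fun i => e i ^+ 4) + mean e ^+ 4).
Proof.
rewrite mean_shift; set b := mean e.
have h : mean (fun i => `|c + e i - (c + b)| ^+ 3) <=
    mean (fun i => (1 + 8 * b ^+ 4) + 8 * e i ^+ 4).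
  apply: le_mean => i; set z := c + e i - (c + b).
  have -> : 1 + 8 * b ^+ 4 + 8 * e i ^+ 4 = 1 + 8 * (b ^+ 4 + e i ^+ 4) by ring.
  have zE : z = e i - b by rewrite /z; ring.
  have z3 : `|z| ^+ 3 <= 1 + z ^+ 4.
    have -> : z ^+ 4 = `|z| ^+ 4 by rewrite -normrX ger0_norm// exprn_even_ge0.
    have : 0 <= `|z| by []. move: `|z| => a a0.
    have [a1|a1] := leP a 1; first by rewrite (le_trans (exprn_ile1 _ a0 a1))// lerDl exprn_ge0.
    by rewrite (le_trans (ler_weXn2l (ltW a1) (leqnSn 3)))// lerDr.
  apply: (le_trans z3); rewrite lerD2l zE.
  have h0 (s t : R) : (s + t) ^+ 2 <= 2 * (s ^+ 2 + t ^+ 2).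
    by rewrite -subr_ge0 (_ : _ - _ = (s - t) ^+ 2) ?sqr_ge0//; ring.
  have h1 := h0 (e i) (- b); have h2 := h0 (e i ^+ 2) (b ^+ 2).
  rewrite (_ : (e i - b) ^+ 4 = ((e i - b) ^+ 2) ^+ 2); last by rewrite -exprM.
  apply: (@le_trans _ _ ((2 * (e i ^+ 2 + b ^+ 2)) ^+ 2)).
    rewrite lerXn2r ?nnegrE ?sqr_ge0 ?(mulr_ge0 _ (addr_ge0 _ _)) ?sqr_ge0//.
    by move: h1; rewrite sqrrN.
  by rewrite -!exprM/= in h2; rewrite exprMn; lra.
apply: (le_trans h); rewrite meanD mean_cst// meanZ; lra.
Qed.

End centered_means.

Section rates_of_the_error_terms.
Context {R : realType}.

(** The bootstrap error in units of the half-width [h], plus the linear statistic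
[c * s * (x' + x'')]. Freezing the slope [Delta + zeta] at [Delta] makes the
error linear; its two coefficients then have to cancel with [c], and the
change of slope costs a multiple of [rho]. *)
Lemma linearization_bound (nu s h M a b x' x'' c : R) :
  0 <= nu -> 0 < s -> 0 < h -> 0 < M ->
  let rho := M / (s * h) in
  let Delta := b - a in
  2 * rho < Delta -> `|x'| <= M / s -> `|x''| <= M / s ->
  `|nu * s * (2 * h) * (h * a * x'' - h * b * x')
      / ((h * b - h * a) * (h * b - h * a + x'' - x')) + c * s * (x' + x'')| <=
  M * (`|c + 2 * nu * a / Delta ^+ 2| + `|c - 2 * nu * b / Delta ^+ 2|
    + 4 * nu * (`|a| + `|b|) * rho / (Delta ^+ 2 * (Delta - 2 * rho))).
Proof.
move=> n0 s0 h0 M0 rho Delta D0 x'M x''M.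
pose z' := x' * s; pose z'' := x'' * s; pose zeta := (x'' - x') / h.
have rho0 : 0 < rho by rewrite divr_gt0 ?mulr_gt0.
have Dp : 0 < Delta by lra.
have z'M : `|z'| <= M by rewrite normrM (gtr0_norm s0) -ler_pdivlMr.
have z''M : `|z''| <= M by rewrite normrM (gtr0_norm s0) -ler_pdivlMr.
have zetaM : `|zeta| <= 2 * rho.
  rewrite normrM normfV (gtr0_norm h0) ler_pdivrMr//.
  have -> : 2 * rho * h = M / s + M / s by rewrite /rho; field; rewrite !gt_eqF.
  by apply: (le_trans (ler_normB _ _)); rewrite lerD.
have Dz : 0 < Delta - 2 * rho by lra.
have Dz' : Delta - 2 * rho <= Delta + zeta by move: zetaM; rewrite ler_norml => /andP[]; lra.
have Dz0 : 0 < Delta + zeta by exact: lt_le_trans Dz'.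
have -> : nu * s * (2 * h) * (h * a * x'' - h * b * x')
      / ((h * b - h * a) * (h * b - h * a + x'' - x')) + c * s * (x' + x'') =
    z'' * (c + 2 * nu * a / Delta ^+ 2) + z' * (c - 2 * nu * b / Delta ^+ 2)
    - 2 * nu * (a * z'' - b * z') * zeta / (Delta ^+ 2 * (Delta + zeta)).
  have -> : h * b - h * a + x'' - x' = h * (Delta + zeta).
    by rewrite /Delta /zeta; field; rewrite gt_eqF.
  have -> : h * b - h * a = h * Delta by rewrite /Delta; ring.
  have x'E : x' = z' / s by rewrite /z' mulfK ?gt_eqF.
  have x''E : x'' = z'' / s by rewrite /z'' mulfK ?gt_eqF.
  clear -h0 s0 Dp Dz0 x'E x''E; rewrite x'E x''E.
  clear x'E x''E; clearbody zeta z' z'' Delta.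
  by field; do ?[apply/andP; split]; rewrite gt_eqF.
clearbody zeta z' z'' Delta rho.
have t1 : `|z'' * (c + 2 * nu * a / Delta ^+ 2)| <= M * `|c + 2 * nu * a / Delta ^+ 2|.
  by rewrite normrM ler_wpM2r.
have t2 : `|z' * (c - 2 * nu * b / Delta ^+ 2)| <= M * `|c - 2 * nu * b / Delta ^+ 2|.
  by rewrite normrM ler_wpM2r.
have t3 : `|2 * nu * (a * z'' - b * z') * zeta / (Delta ^+ 2 * (Delta + zeta))| <=
    M * (4 * nu * (`|a| + `|b|) * rho / (Delta ^+ 2 * (Delta - 2 * rho))).
  have den : 0 < Delta ^+ 2 * (Delta + zeta) by rewrite mulr_gt0 ?exprn_gt0.
  rewrite normrM normfV (gtr0_norm den) !normrM (ger0_norm n0) (ger0_norm (ler0n _ 2)).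
  rewrite (_ : M * _ = 2 * nu * ((`|a| + `|b|) * M) * (2 * rho) / (Delta ^+ 2 * (Delta - 2 * rho))); last by ring.
  apply: ler_pM; rewrite ?invr_ge0 ?(ltW den) ?mulr_ge0//.
    apply: ler_pM => //; first by rewrite !mulr_ge0.
    rewrite ler_wpM2l ?mulr_ge0// mulrDl (le_trans (ler_normB _ _))// !normrM.
    by rewrite lerD// ler_wpM2l.
  by rewrite lef_pV2 ?posrE ?mulr_gt0 ?exprn_gt0// ler_pM2l ?exprn_gt0.
apply: (le_trans (ler_normB _ _)); rewrite [leRHS]mulrDr lerD// [leRHS]mulrDr.
by apply: (le_trans (ler_normD _ _)); rewrite lerD.
Qed.

(** The two third moments that occur in [lindeberg_error], before studentization. *)
Definition third_moment_scale (k : nat) (y : 'I_k -> R) : R :=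
  mean (fun i => `|y i - mean y| ^+ 3) +
  Num.sqrt (mean (fun i => (y i - mean y) ^+ 2)) ^+ 3 * gaussian_abs3.

(** A studentized term is of order [k ^ (- 1/2)], its cube of order [k ^ (- 3/2)],
and there are [k + k] exchanges: the error decreases as [(Num.sqrt k)^-1]. *)
Lemma resampling_error_studentized (k : nat) (C delta : R) (y' y'' : 'I_k -> R) :
  let V := mean (fun i => (y' i - mean y') ^+ 2) +
           mean (fun i => (y'' i - mean y'') ^+ 2) in
  (0 < k)%N -> 0 < C -> 0 < V ->
  resampling_error (studentized y' y'' C y') (studentized y' y'' C y'') delta =
  4 / 3 / delta ^+ 3 * (C / Num.sqrt V) ^+ 3 / Num.sqrt k%:R *
    (third_moment_scale y' + third_moment_scale y'').
Proof.
move=> V k0 C0 V0.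
have k0' : 0 < k%:R :> R by rewrite ltr0n.
pose s : R := Num.sqrt k%:R; have s0 : 0 < s by rewrite sqrtr_gt0.
have ks : k%:R = s ^+ 2 by rewrite sqr_sqrtr// ltW.
pose r := C / Num.sqrt V; have r0 : 0 < r by rewrite divr_gt0// sqrtr_gt0.
have qE : - (C / Num.sqrt (V / k%:R)) = - (r * s).
  rewrite sqrtrM ?(ltW V0)// sqrtrV ?(ltW k0')// -/s /r.
  by rewrite invfM invrK mulrA.
have err (y : 'I_k -> R) (B : R) : lindeberg_error (studentized y' y'' C y) B =
    B * (r ^+ 3 / s ^+ 3 * third_moment_scale y).
  have cE i : studentized y' y'' C y i = (- (r / s)) * (y i - mean y).
    rewrite /studentized -/V qE ks; field; exact: lt0r_neq0.
  rewrite /lindeberg_error /third_moment_scale.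
  have -> : mean (fun i => `|studentized y' y'' C y i| ^+ 3) =
      r ^+ 3 / s ^+ 3 * mean (fun i => `|y i - mean y| ^+ 3).
    rewrite -meanZ; congr mean; apply/funext => i.
    by rewrite cE normrM normrN (gtr0_norm (divr_gt0 r0 s0)) exprMn expr_div_n.
  have -> : mean (fun i => studentized y' y'' C y i ^+ 2) =
      (r / s) ^+ 2 * mean (fun i => (y i - mean y) ^+ 2).
    by rewrite -meanZ; congr mean; apply/funext => i; rewrite cE exprMn sqrrN.
  rewrite sqrtrM ?sqr_ge0// sqrtr_sqr (gtr0_norm (divr_gt0 r0 s0)).
  by field; exact: lt0r_neq0.
rewrite /resampling_error !err -/r -/s ks; move: (4 / 3 / delta ^+ 3) => B.
by field; exact: lt0r_neq0.
Qed.

End rates_of_the_error_terms.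

Section sequence_limits.
Context {R : realType}.
Implicit Types (u v : nat -> R) (a b : R).

Lemma lim_cst a : a @[_ --> \oo] --> a. Proof. exact: cvg_cst. Qed.

Lemma limD u v a b : u n @[n --> \oo] --> a -> v n @[n --> \oo] --> b ->
  u n + v n @[n --> \oo] --> a + b.
Proof. by move=> ua vb; exact: cvgD. Qed.

Lemma limB u v a b : u n @[n --> \oo] --> a -> v n @[n --> \oo] --> b ->
  u n - v n @[n --> \oo] --> a - b.
Proof. by move=> ua vb; exact: cvgB. Qed.

Lemma limM u v a b : u n @[n --> \oo] --> a -> v n @[n --> \oo] --> b ->
  u n * v n @[n --> \oo] --> a * b.
Proof. by move=> ua vb; exact: cvgM. Qed.

Lemma limV u a : a != 0 -> u n @[n --> \oo] --> a -> (u n)^-1 @[n --> \oo] --> a^-1.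
Proof. by move=> a0 ua; exact: cvgV. Qed.

Lemma lim_norm u a : u n @[n --> \oo] --> a -> `|u n| @[n --> \oo] --> `|a|.
Proof. by move=> ua; exact: cvg_norm. Qed.

Lemma lim_exp q u a : u n @[n --> \oo] --> a -> u n ^+ q @[n --> \oo] --> a ^+ q.
Proof.
move=> ua; elim: q => [|q IH]; first exact: cvg_cst.
by rewrite exprS; under eq_fun do rewrite exprS; exact: limM.
Qed.

Lemma lim_sqrt u a : u n @[n --> \oo] --> a -> Num.sqrt (u n) @[n --> \oo] --> Num.sqrt a.
Proof. by move=> ua; apply: continuous_cvg ua; exact: sqrt_continuous. Qed.

Lemma lim_inv_pinfty u : u n @[n --> \oo] --> +oo -> (u n)^-1 @[n --> \oo] --> (0 : R).
Proof.
move=> uy; apply/gtr0_cvgV0 => //.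
by move/cvgryPgt : uy; apply.
Qed.

Lemma near_lim_lt u a b : u n @[n --> \oo] --> a -> a < b -> \forall n \near \oo, u n < b.
Proof. by move=> ua ab; exact: (cvgr_lt a). Qed.

Lemma near_lim_gt u a b : u n @[n --> \oo] --> a -> b < a -> \forall n \near \oo, b < u n.
Proof. by move=> ua ab; exact: (cvgr_gt a). Qed.

End sequence_limits.
Arguments lim_cst {R} a.
Arguments lim_exp {R} q {u a}.

Section bootstrap_limit.
Context {R : realType}.

Lemma difference_quotient_cvg (f : R -> R) (a b : R) (h l : nat -> R) :
  derivable f a 1 -> (forall n, 0 < h n) ->
  h n @[n --> \oo] --> (0 : R) -> l n @[n --> \oo] --> b ->
  (f (a + h n * l n) - f a) / h n @[n --> \oo] --> derive1 f a * b.
Proof.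
move=> df h0 hcvg lcvg.
have main : (f (a + h n * l n) - f a) / h n - derive1 f a * l n @[n --> \oo] --> (0 : R).
  apply/cvgr0Pnorm_le => eps eps0.
  have b0 : 0 < `|b| + 1 by rewrite ltr_pwDr.
  have [r r0 taylor] := derivable_first_order df (divr_gt0 eps0 b0).
  have xi : h n * l n @[n --> \oo] --> (0 : R) by rewrite -[0](mul0r b); exact: cvgM.
  near=> n.
  have lb : `|l n| <= `|b| + 1.
    by near: n; apply: (cvgr_norm_le b) => //; rewrite ltrDl.
  have small : `|h n * l n| < r.
    by near: n; apply: (cvgr_norm_lt (0 : R)) => //; rewrite normr0.
  have := taylor (a + h n * l n); rewrite [a + _ - a]addrAC subrr add0r => /(_ small).
  move=> main.
  have -> : (f (a + h n * l n) - f a) / h n - derive1 f a * l n =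
      (f (a + h n * l n) - f a - derive1 f a * (h n * l n)) / h n.
    by field; rewrite gt_eqF.
  rewrite normrM normfV (gtr0_norm (h0 n)) ler_pdivrMr// (le_trans main)//.
  rewrite normrM (gtr0_norm (h0 n)) mulrCA mulrC ler_pM2r//.
  by rewrite mulrAC ler_pdivrMr// ler_pM2l.
have -> : (fun n => (f (a + h n * l n) - f a) / h n) =
    (fun n => ((f (a + h n * l n) - f a) / h n - derive1 f a * l n) + derive1 f a * l n).
  by apply/funext => n; rewrite subrK.
rewrite -[derive1 f a * b]add0r.
exact: (cvgD main (cvgM (cvg_cst (derive1 f a)) lcvg)).
Unshelve. all: by end_near.
Qed.

(** The two sampling points are [dh n - h n] and [dh n + h n]; the errors observed
there are the first [k n] entries of the rows of [e'] and [e'']. *)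
Context (f : R -> R) (d0 sigma p : R) (k : nat -> nat) (h dh : nat -> R).
Context (e' e'' : nat -> nat -> R).
Hypotheses (df : derivable f d0 1) (f'0 : 0 < derive1 f d0).
Hypotheses (sigma0 : 0 < sigma) (p01 : 0 < p < 1).
Hypotheses (h0 : forall n, 0 < h n) (hcvg : h n @[n --> \oo] --> (0 : R)).
Hypothesis dh_near : (dh n - d0) / h n @[n --> \oo] --> (0 : R).
Hypothesis kh : Num.sqrt (k n)%:R * h n @[n --> \oo] --> +oo.
Hypothesis nk : n%:R / (k n)%:R @[n --> \oo] --> 2 / (1 - p).
Let avg (e : nat -> nat -> R) (q n : nat) := mean (fun i : 'I_(k n) => e n i ^+ q).
Hypothesis avg1 : forall e, e = e' \/ e = e'' -> avg e 1 n / h n @[n --> \oo] --> (0 : R).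
Hypothesis avg2 : forall e, e = e' \/ e = e'' -> avg e 2 n @[n --> \oo] --> sigma ^+ 2.
Context (mu4 : R).
Hypothesis avg4 : forall e, e = e' \/ e = e'' -> avg e 4 n @[n --> \oo] --> mu4.

Let C := sigma / (derive1 f d0 * Num.sqrt (1 - p)).
Let C0 : 0 < C.
Proof.
by have /andP[p0 p1] := p01; rewrite divr_gt0// mulr_gt0// sqrtr_gt0 subr_gt0.
Qed.

Let alpha n := (f (dh n - h n) - f d0) / h n + avg e' 1 n / h n.
Let beta n := (f (dh n + h n) - f d0) / h n + avg e'' 1 n / h n.
Let V n := (avg e' 2 n - avg e' 1 n ^+ 2) + (avg e'' 2 n - avg e'' 1 n ^+ 2).
Let nu n : R := Num.sqrt n%:R / Num.sqrt (k n)%:R.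
Let c n := C / Num.sqrt (V n).

Let alpha_cvg : alpha n @[n --> \oo] --> - derive1 f d0.
Proof.
rewrite -[- _]addr0; apply: cvgD; last by apply: avg1; left.
rewrite -[- derive1 f d0]mulrN1.
have := @difference_quotient_cvg f d0 (-1) h (fun n => (dh n - d0) / h n - 1) df h0 hcvg.
have -> : (fun n => (f (d0 + h n * ((dh n - d0) / h n - 1)) - f d0) / h n) =
    (fun n => (f (dh n - h n) - f d0) / h n).
  apply/funext => n; congr ((f _ - _) / _).
  by field; rewrite gt_eqF.
by apply; rewrite -[X in _ --> X]add0r; exact: limB dh_near (lim_cst 1).
Qed.

Let beta_cvg : beta n @[n --> \oo] --> derive1 f d0.
Proof.
rewrite -[derive1 f d0]addr0; apply: cvgD; last by apply: avg1; right.
rewrite -[derive1 f d0]mulr1.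
have := @difference_quotient_cvg f d0 1 h (fun n => (dh n - d0) / h n + 1) df h0 hcvg.
have -> : (fun n => (f (d0 + h n * ((dh n - d0) / h n + 1)) - f d0) / h n) =
    (fun n => (f (dh n + h n) - f d0) / h n).
  apply/funext => n; congr ((f _ - _) / _).
  by field; rewrite gt_eqF.
by apply; rewrite -[X in _ --> X]add0r; exact: limD dh_near (lim_cst 1).
Qed.

Let Delta_cvg : beta n - alpha n @[n --> \oo] --> 2 * derive1 f d0.
Proof.
have -> : 2 * derive1 f d0 = derive1 f d0 - - derive1 f d0 by ring.
exact: limB beta_cvg alpha_cvg.
Qed.

Let avg1_cvg e : e = e' \/ e = e'' -> avg e 1 n @[n --> \oo] --> (0 : R).
Proof.
move=> ee; have -> : avg e 1 = (fun n => avg e 1 n / h n * h n).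
  by apply/funext => n; rewrite divfK// gt_eqF.
rewrite -[0](mul0r (0 : R)); apply: cvgM => //; exact: avg1.
Qed.

Let V_cvg : V n @[n --> \oo] --> 2 * sigma ^+ 2.
Proof.
have -> : 2 * sigma ^+ 2 = (sigma ^+ 2 - 0 * 0) + (sigma ^+ 2 - 0 * 0) by ring.
by apply: limD; apply: limB; [apply: avg2|apply: limM; apply: avg1_cvg|
  apply: avg2|apply: limM; apply: avg1_cvg]; tauto.
Qed.

Let nu_cvg : nu n @[n --> \oo] --> Num.sqrt (2 / (1 - p)).
Proof.
have -> : nu = (fun n => Num.sqrt (n%:R / (k n)%:R)).
  by apply/funext => n; rewrite /nu sqrtrM// sqrtrV.
exact: lim_sqrt.
Qed.

Let c_cvg : c n @[n --> \oo] --> C / Num.sqrt (2 * sigma ^+ 2).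
Proof.
apply: limM (lim_cst C) _; apply: limV; first by rewrite gt_eqF// sqrtr_gt0 mulr_gt0 ?exprn_gt0.
exact: lim_sqrt.
Qed.

(** The coefficient of the linear statistic has the same limit as the slopes that
it has to cancel in [linearization_bound]; this determines the standard
deviation [C] of the limit. *)
Let c_limit : C / Num.sqrt (2 * sigma ^+ 2) =
  2 * Num.sqrt (2 / (1 - p)) * derive1 f d0 / (2 * derive1 f d0) ^+ 2.
Proof.
have /andP[p0 p1] := p01; have q0 : 0 < 1 - p by rewrite subr_gt0.
have -> : Num.sqrt (2 * sigma ^+ 2) = Num.sqrt 2 * sigma.
  by rewrite sqrtrM// sqrtr_sqr gtr0_norm.
have -> : Num.sqrt (2 / (1 - p)) = Num.sqrt 2 / Num.sqrt (1 - p).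
  by rewrite sqrtrM// sqrtrV// ltW.
rewrite /C.
have two : 2 = Num.sqrt 2 * Num.sqrt 2 :> R by rewrite -expr2 sqr_sqrtr.
have t0 : 0 < Num.sqrt 2 :> R by rewrite sqrtr_gt0.
have r0 : 0 < Num.sqrt (1 - p) by rewrite sqrtr_gt0.
move: (Num.sqrt 2) t0 two => t t0 ->.
by field; do ?[apply/andP; split]; rewrite gt_eqF.
Qed.

Let rho M n := M / (Num.sqrt (k n)%:R * h n).

Let rho_cvg M : rho M n @[n --> \oo] --> (0 : R).
Proof.
by rewrite -[0](mulr0 M); exact: limM (lim_cst M) (lim_inv_pinfty kh).
Qed.

Let bound M n := M * (`|c n + 2 * nu n * alpha n / (beta n - alpha n) ^+ 2|
  + `|c n - 2 * nu n * beta n / (beta n - alpha n) ^+ 2|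
  + 4 * nu n * (`|alpha n| + `|beta n|) * rho M n /
      ((beta n - alpha n) ^+ 2 * (beta n - alpha n - 2 * rho M n))).

Let bound_cvg M : bound M n @[n --> \oo] --> (0 : R).
Proof.
have D2 := limM Delta_cvg Delta_cvg.
have Dn0 : 2 * derive1 f d0 * (2 * derive1 f d0) != 0.
  by rewrite gt_eqF// !mulr_gt0.
have DV := limV Dn0 D2.
have n2 := limM (lim_cst 2) nu_cvg.
have ca := lim_norm (limD c_cvg (limM (limM n2 alpha_cvg) DV)).
have cb := lim_norm (limB c_cvg (limM (limM n2 beta_cvg) DV)).
have r2 := limM (lim_cst 2) (rho_cvg M).
have den := limM D2 (limB Delta_cvg r2).
have den0 : 2 * derive1 f d0 * (2 * derive1 f d0) * (2 * derive1 f d0 - 2 * 0) != 0.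
  by rewrite gt_eqF// mulr0 subr0 !mulr_gt0.
have rest := limM (limM (limM (limM (lim_cst 4) nu_cvg)
  (limD (lim_norm alpha_cvg) (lim_norm beta_cvg))) (rho_cvg M)) (limV den0 den).
have := limM (lim_cst M) (limD (limD ca cb) rest).
by rewrite c_limit -!expr2 mulrN mulNr subrr normr0 mulr0 mul0r !addr0 mulr0.
Qed.

Let W e n := 1 + 8 * (avg e 4 n + avg e 1 n ^+ 4)
  + Num.sqrt (avg e 2 n - avg e 1 n ^+ 2) ^+ 3 * gaussian_abs3.

Let W_cvg e : e = e' \/ e = e'' -> W e n @[n --> \oo] -->
  1 + 8 * (mu4 + 0 ^+ 4) + Num.sqrt (sigma ^+ 2 - 0 ^+ 2) ^+ 3 * gaussian_abs3.
Proof.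
move=> ee; have a1 := avg1_cvg ee; have a2 := avg2 ee; have a4 := avg4 ee.
apply: limD.
  apply: limD; first exact: lim_cst.
  by apply: limM (lim_cst 8) _; exact: limD a4 (lim_exp 4 a1).
apply: limM (lim_cst _); apply/lim_exp/lim_sqrt; exact: limB a2 (lim_exp 2 a1).
Qed.

Let resampling delta n := 4 / 3 / delta ^+ 3 * c n ^+ 3 / Num.sqrt (k n)%:R *
  (W e' n + W e'' n).

Let resampling_cvg delta : resampling delta n @[n --> \oo] --> (0 : R).
Proof.
have sk : (Num.sqrt (k n)%:R)^-1 @[n --> \oo] --> (0 : R).
  have -> : (fun n => (Num.sqrt (k n)%:R)^-1) = (fun n => h n * rho 1 n).
    by apply/funext => n; rewrite /rho mul1r invfM mulrCA mulfV ?mulr1// gt_eqF.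
  by rewrite -[0](mulr0 (0 : R)); exact: limM hcvg (rho_cvg 1).
have := limM (limM (limM (lim_cst (4 / 3 / delta ^+ 3)) (lim_exp 3 c_cvg)) sk)
  (limD (W_cvg (or_introl erefl)) (W_cvg (or_intror erefl))).
by rewrite mulr0 mul0r.
Qed.

(** With [delta] and [M] chosen from [eps], the terms of
[bootstrap_cdf_near_normal] are eventually at most [eps / 2], [eps / 4] and
[eps / 4]. *)
Lemma bootstrap_cdf_limit eps : 0 < eps -> \forall n \near \oo, forall t,
  `|bootstrap_cdf (f d0) (dh n - h n) (dh n + h n) n
      (fun i : 'I_(k n) => f (dh n - h n) + e' n i)
      (fun i : 'I_(k n) => f (dh n + h n) + e'' n i) t - normal_cdf C t| <= eps.
Proof.
move=> eps0.
have peak0 : 0 < normal_peak 1 :> R by rewrite normal_peak_gt0.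
pose delta := eps * C / (8 * normal_peak 1).
have delta0 : 0 < delta by rewrite divr_gt0 ?(mulr_gt0 eps0 C0)// mulr_gt0.
pose M := 4 * sigma / Num.sqrt eps.
have M0 : 0 < M by rewrite divr_gt0 ?mulr_gt0 ?sqrtr_gt0.
have M2 : M ^+ 2 = 16 * sigma ^+ 2 / eps.
  by rewrite /M expr_div_n sqr_sqrtr ?ltW// exprMn; congr (_ * _ / _); ring.
have eps_split : eps / 2 + eps / 4 + eps / 4 = eps by field.
have eps4 : 0 < eps / 4 by rewrite divr_gt0.
have far_cvg := limM V_cvg (lim_cst (M ^+ 2)^-1).
have far_lim : 2 * sigma ^+ 2 * (M ^+ 2)^-1 < eps / 4.
  rewrite M2 [ltLHS](_ : _ = eps / 8); first by lra.
  by field; rewrite !gt_eqF.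
have gap_cvg := limB Delta_cvg (limM (lim_cst 2) (rho_cvg M)).
have gap_lim : 0 < 2 * derive1 f d0 - 2 * 0 by rewrite mulr0 subr0 mulr_gt0.
near=> n => t.
have k0 : (0 < k n)%N.
  have : 0 < Num.sqrt (k n)%:R * h n by near: n; move/cvgryPgt : kh; apply.
  by rewrite pmulr_lgt0// sqrtr_gt0 ltr0n.
have V0 : 0 < V n by near: n; apply: (near_lim_gt V_cvg); rewrite mulr_gt0 ?exprn_gt0.
have gap : 0 < beta n - alpha n - 2 * rho M n by near: n; exact: near_lim_gt gap_cvg _.
have lin : bound M n < delta by near: n; exact: near_lim_lt (bound_cvg M) _.
have res : resampling delta n < eps / 4 by near: n; exact: near_lim_lt (resampling_cvg delta) _.
have far : V n / M ^+ 2 < eps / 4 by near: n; exact: near_lim_lt far_cvg _.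
have cardk : (0 < #|'I_(k n)|)%N by rewrite card_ord.
set L := dh n - h n; set U := dh n + h n.
set y' := fun i : 'I_(k n) => f L + e' n i.
set y'' := fun i : 'I_(k n) => f U + e'' n i.
have ULE : U - L = 2 * h n by rewrite /U /L; ring.
have LU : L < U by rewrite -subr_gt0 ULE mulr_gt0.
have m' : mean y' = f L + avg e' 1 n by exact: mean_shift.
have m'' : mean y'' = f U + avg e'' 1 n by exact: mean_shift.
have v' : mean (fun i => (y' i - mean y') ^+ 2) = avg e' 2 n - avg e' 1 n ^+ 2.
  exact: mean_centered_sqr.
have v'' : mean (fun i => (y'' i - mean y'') ^+ 2) = avg e'' 2 n - avg e'' 1 n ^+ 2.
  exact: mean_centered_sqr.
have VE : mean (fun i => (y' i - mean y') ^+ 2) + mean (fun i => (y'' i - mean y'') ^+ 2) = V n.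
  by rewrite v' v''.
have hn := h0 n; have hn0 : h n != 0 by rewrite gt_eqF.
have aE : mean y' - f d0 = h n * alpha n by rewrite m' /alpha -/L; field.
have bE : mean y'' - f d0 = h n * beta n by rewrite m'' /beta -/U; field.
have DE : mean y'' - mean y' = h n * beta n - h n * alpha n by rewrite -aE -bE; ring.
have k0' : 0 < (k n)%:R :> R by rewrite ltr0n.
have s0 : 0 < Num.sqrt (k n)%:R :> R by rewrite sqrtr_gt0.
have slope : 2 * (M / Num.sqrt (k n)%:R) < mean y'' - mean y'.
  rewrite DE -mulrBr -ltr_pdivrMl//.
  rewrite (_ : _ * _ = 2 * rho M n); first by rewrite -subr_gt0.
  by rewrite /rho; field; rewrite hn0 gt_eqF.
have cE : C / Num.sqrt (V n / (k n)%:R) = c n * Num.sqrt (k n)%:R.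
  rewrite sqrtrM ?(ltW V0)// sqrtrV ?(ltW k0')// /c.
  by rewrite invfM invrK mulrA.
have linearization x' x'' : `|x'| <= M / Num.sqrt (k n)%:R ->
    `|x''| <= M / Num.sqrt (k n)%:R ->
    `|Num.sqrt n%:R * (U - L) * ((mean y' - f d0) * x'' - (mean y'' - f d0) * x')
       / ((mean y'' - mean y') * (mean y'' - mean y' + x'' - x'))
     + C / Num.sqrt ((mean (fun i => (y' i - mean y') ^+ 2) +
         mean (fun i => (y'' i - mean y'') ^+ 2)) / (k n)%:R) * (x' + x'')| <= delta.
  move=> x'M x''M; rewrite VE cE DE aE bE ULE.
  have -> : Num.sqrt n%:R = nu n * Num.sqrt (k n)%:R by rewrite divfK// gt_eqF.
  apply: le_trans (linearization_bound _ _ _ _ _ _ _ _) (ltW lin) => //.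
    by rewrite divr_ge0 ?sqrtr_ge0.
  by rewrite -subr_gt0.
have V0' : 0 < mean (fun i => (y' i - mean y') ^+ 2) + mean (fun i => (y'' i - mean y'') ^+ 2).
  by rewrite VE.
apply: le_trans (bootstrap_cdf_near_normal k0 LU C0 M0 delta0 V0' slope linearization t) _.
rewrite VE resampling_error_studentized// VE.
have scale (e : nat -> nat -> R) (z : R) : third_moment_scale (fun i : 'I_(k n) => z + e n i) <= W e n.
  rewrite /third_moment_scale mean_centered_sqr// lerD//.
  exact: mean_centered_abs3.
have res' : 4 / 3 / delta ^+ 3 * (C / Num.sqrt (V n)) ^+ 3 / Num.sqrt (k n)%:R *
    (third_moment_scale y' + third_moment_scale y'') <= eps / 4.
  apply: le_trans (ltW res); rewrite /resampling ler_wpM2l//.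
    apply: divr_ge0 (mulr_ge0 (divr_ge0 _ (exprn_ge0 _ (ltW delta0))) _) (sqrtr_ge0 _) => //.
    exact: exprn_ge0 _ (divr_ge0 (ltW C0) (sqrtr_ge0 _)).
  exact: (lerD (scale e' _) (scale e'' _)).
have -> : normal_peak 1 * (4 * delta) / C = eps / 2.
  by rewrite /delta; field; rewrite !gt_eqF.
by rewrite -[leRHS]eps_split; exact: lerD (lerD (lexx _) res') (ltW far).
Unshelve. all: by end_near.
Qed.

End bootstrap_limit.

(** * Transfer from the error law to the arrays of errors *)

Section change_of_law.
Context d (T : measurableType d) dE (TE : measurableType dE) (R : realType).
Context (P : probability T R) (Q : probability TE R).
Context (X : {RV P >-> R}) (e : {RV Q >-> R}).
Hypothesis same_law : forall B : set R, measurable B ->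
  distribution P X B = distribution Q e B.
Context (g : R -> R) (mg : measurable_fun setT g).

Lemma same_law_ge0 (h : R -> R) : measurable_fun setT h -> (forall z, 0 <= h z) ->
  (\int[P]_w (h (X w))%:E = \int[Q]_w (h (e w))%:E)%E.
Proof.
move=> mh h0; have mhE : measurable_fun setT (EFin \o h) by exact/measurable_EFinP.
have := @ge0_integral_pushforward _ _ T R R X (measurable_funPT X) P setT (EFin \o h)
  measurableT mhE (fun y _ => h0 y).
have := @ge0_integral_pushforward _ _ TE R R e (measurable_funPT e) Q setT (EFin \o h)
  measurableT mhE (fun y _ => h0 y).
rewrite !preimage_setT => <- <-; apply: eq_measure_integral => A mA _.
exact: same_law.
Qed.

Lemma same_law_moments : has_moments Q (g \o e) -> has_moments P (g \o X).
Proof.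
move=> [_ ge]; split=> [|k]; first exact: measurableT_comp.
have mk : measurable_fun setT (fun z => `|g z| ^+ k).
  by apply: measurable_funX; exact: measurableT_comp.
have /integrableP[_ fin] := ge k; apply/integrableP; split.
  by apply/measurable_EFinP; exact: (measurableT_comp mk (measurable_funPT X)).
have k0 z : 0 <= `|g z| ^+ k by rewrite exprn_ge0.
have absE (S : Type) (Y : S -> R) : (fun w => `|(EFin \o (fun v => (`|(g \o Y) v| ^+ k)%R)) w|%E) =
    (fun w => (`|g (Y w)| ^+ k)%:E).
  by apply/funext => w; rewrite gee0_abs// lee_fin.
by rewrite absE (same_law_ge0 mk k0) -absE.
Qed.

Lemma same_law_mean : has_moments Q (g \o e) ->
  \int[P]_w g (X w) = \int[Q]_w g (e w).
Proof.
move=> mome; have momX := same_law_moments mome.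
have mgE : measurable_fun setT (EFin \o g) by exact/measurable_EFinP.
have iX := integrable_exp 1 momX; have ie := integrable_exp 1 mome.
have := @integral_distribution _ _ T R R P X (EFin \o g) mgE iX.
have := @integral_distribution _ _ TE R R Q e (EFin \o g) mgE ie.
rewrite /Rintegral => <- <-; congr fine; apply: eq_measure_integral => A mA _.
exact: same_law.
Qed.

End change_of_law.

Section powers.
Context d (T : measurableType d) (R : realType) (P : probability T R).

Lemma has_moments_exp (X : T -> R) m : has_moments P X -> has_moments P (fun w => X w ^+ m).
Proof.
move=> [mX iX]; split=> [|k]; first exact: measurable_funX.
have -> : (fun w => `|X w ^+ m| ^+ k) = (fun w => `|X w| ^+ (m * k)).
  by apply/funext => w; rewrite normrX exprM.
exact: iX.
Qed.

Lemma has_moments_centered (X : T -> R) : has_moments P X ->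
  has_moments P (fun w => X w - \int[P]_v X v) /\
  \int[P]_w (X w - \int[P]_v X v) = 0.
Proof.
move=> mX; split; first exact: (has_momentsD mX (has_moments_cst P (- \int[P]_v X v))).
have iX := integrable_exp 1 mX.
have ic : P.-integrable setT (EFin \o cst (\int[P]_v X v)).
  exact: finite_measure_integrable_cst.
rewrite (RintegralB measurableT iX ic) Rintegral_cst//.
have PT : fine (P [set: T]) = 1 by rewrite probability_setT.
by rewrite PT mulr1 subrr.
Qed.

Lemma assumption_A4_moments (e : {RV P >-> R}) : assumption_A4 e -> has_moments P e.
Proof.
move=> A4; split=> [|k]; first exact: measurable_funPT.
apply/integrableP; split.
  by apply/measurable_EFinP; apply: measurable_normX; exact: measurable_funPT.
have := A4 k; rewrite unlock; congr (_ < _)%E.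
by apply: eq_integral => w _; rewrite gee0_abs//= lee_fin exprn_ge0.
Qed.

Lemma mean_of_expectation (e : {RV P >-> R}) a : ('E_P[e] = a%:E)%E -> \int[P]_w e w = a.
Proof. by rewrite unlock /Rintegral => ->. Qed.

Lemma second_moment_of_variance (e : {RV P >-> R}) v : ('E_P[e] = 0)%E ->
  ('V_P[e] = v%:E)%E -> \int[P]_w (e w ^+ 2) = v.
Proof.
move=> e0; rewrite /variance unlock e0 /= unlock /Rintegral.
rewrite (_ : (fun w => _) = (fun w => (e w ^+ 2)%:E)); first by move=> ->.
by apply/funext => w; rewrite -[in RHS](subr0 (e w)) expr2.
Qed.

End powers.

Section error_arrays.
Context dE (TE : measurableType dE) d (T : measurableType d) (R : realType).
Context (Q : probability TE R) (P : probability T R) (e : {RV Q >-> R}).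
Context (eps eps' eps'' : nat -> nat -> {RV P >-> R}).
Hypothesis hiid : iid_copies e eps eps' eps''.

(** Independence passes to [g] of the errors because the preimage under [g] of a
Borel set is a Borel set; the moments are computed under the common law. *)
Lemma centered_independent_row (g : R -> R) (j : 'I_3) n N :
  measurable_fun setT g -> has_moments Q (g \o e) -> \int[Q]_w g (e w) = 0 ->
  (N <= n)%N ->
  centered_independent P (fun k => \int[Q]_w (`|g (e w)| ^+ k)) N
    (fun i w => g (errors eps eps' eps'' (j, n, i) w)).
Proof.
move=> mg momg mean0 Nn; have [indep law] := hiid.
have lawi i : (i < N)%N -> forall B : set R, measurable B ->
    distribution P (errors eps eps' eps'' (j, n, i)) B = distribution Q e B.
  by move=> iN; apply: law => /=; exact: leq_trans iN Nn.
split.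
- move=> s B us sN mB.
  pose C (l : 'I_3 * nat * nat) := g @^-1` (B l.2).
  have mC l : measurable (C l) by rewrite -[X in measurable X]setTI; exact: mg.
  have := indep [seq (j, n, i) | i <- s] C.
  rewrite map_inj_uniq ?us; last by move=> a b [].
  move=> /(_ isT _ mC) indeps.
  transitivity (P (\bigcap_(i in [set` [seq (j, n, i) | i <- s]])
      (errors eps eps' eps'' i @^-1` C i))).
    congr (P _); apply/seteqP; split=> w hw.
      by move=> l /= /mapP[i si ->]; exact: (hw i).
    by move=> i /= si; apply: (hw (j, n, i)) => /=; apply/mapP; exists i.
  rewrite indeps ?big_map// => l /mapP[i si ->] /=.
  exact: leq_trans (sN i si) Nn.
- by move=> i; exact: (measurableT_comp mg (measurable_funPT _)).
- by move=> i iN; exact: (same_law_moments (lawi i iN) mg momg).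
- by move=> i iN; rewrite (same_law_mean (lawi i iN) mg momg).
- move=> i k iN; rewrite /Rintegral.
  rewrite (same_law_ge0 (lawi i iN) (h := fun z => `|g z| ^+ k))//.
    by apply: measurable_funX; exact: measurableT_comp.
Qed.

End error_arrays.

(** * Sample sizes of the two stages *)

Section design_sizes.
Context {R : realType} (p : R).
Hypothesis p01 : 0 < p < 1.

Let floor_lt n : (0 < n)%N -> (Num.truncn (n%:R * p) < n)%N.
Proof.
move=> n0; have /andP[p0 p1] := p01.
have np : 0 <= n%:R * p by rewrite mulr_ge0// ltW.
have /andP[le _] := truncn_itv np.
by rewrite -(ltr_nat R) (le_lt_trans le)// gtr_pMr// ltr0n.
Qed.

Lemma stage1_size_le n : (stage1_size p n <= n)%N.
Proof.
rewrite /stage1_size; case: n => [|n]; first by rewrite mul0r truncn0.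
have := floor_lt (ltn0Sn n); set k := Num.truncn _ => kn.
by case: ifP => _ //; exact: ltnW.
Qed.

Lemma stage2_size_double n : (stage2_size p n).*2 = (n - stage1_size p n)%N.
Proof.
rewrite /stage2_size even_halfK// /stage1_size.
case: n => [|n]; first by rewrite mul0r truncn0.
have := floor_lt (ltn0Sn n); set k := Num.truncn _ => kn.
case: ifP => od; last by rewrite od.
by rewrite subnS; move: od; rewrite -{1}(prednK (_ : 0 < n.+1 - k)%N) ?subn_gt0//= negbK => /negbTE ->.
Qed.

Lemma stage1_size_itv n : n%:R * p - 1 <= (stage1_size p n)%:R <= n%:R * p + 1.
Proof.
have /andP[p0 p1] := p01.
have np : 0 <= n%:R * p by rewrite mulr_ge0// ltW.
have /andP[le gt] := truncn_itv np; rewrite /stage1_size.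
by rewrite -natr1 in gt; case: ifP => _; rewrite -?natr1; apply/andP; split; lra.
Qed.

Lemma stage2_size_itv n :
  n%:R * (1 - p) - 1 <= 2 * (stage2_size p n)%:R <= n%:R * (1 - p) + 1.
Proof.
have /andP[lo hi] := stage1_size_itv n.
have := congr1 (fun k => k%:R : R) (stage2_size_double n).
rewrite natrB ?stage1_size_le// -muln2 natrM mulrC => ->.
by apply/andP; split; lra.
Qed.

Lemma stage2_size_le n : (stage2_size p n <= n)%N.
Proof. by have := stage2_size_double n; lia. Qed.

End design_sizes.

(** * Polynomial rates *)

Section power_sequences.
Context {R : realType}.

Lemma powR_pinfty (s : R) : 0 < s -> n.+1%:R `^ s @[n --> \oo] --> +oo.
Proof.
move=> s0; apply/cvgryPgt => A.
pose B := Num.max A 1; have B1 : 1 <= B by rewrite le_max lexx orbT.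
have B0 : 0 <= B by exact: le_trans B1.
pose C := B `^ s^-1.
exists (Num.truncn C) => // n /= Cn.
have Cn' : C < n.+1%:R by apply: lt_le_trans (truncnS_gt _) _; rewrite ler_nat ltnS.
apply: (@le_lt_trans _ _ B); first by rewrite le_max lexx.
have -> : B = C `^ s by rewrite -powRrM mulVf ?gt_eqF// powRr1.
by apply: gt0_ltr_powR => //; rewrite nnegrE ?powR_ge0.
Qed.

Lemma powR_zero (s : R) : 0 < s -> n.+1%:R `^ (- s) @[n --> \oo] --> (0 : R).
Proof.
move=> s0; under eq_fun do rewrite powRN.
exact: lim_inv_pinfty (powR_pinfty s0).
Qed.

Lemma lim_pinfty_le (u v : nat -> R) (n0 : nat) : u n @[n --> \oo] --> +oo ->
  (forall n, (n0 <= n)%N -> u n <= v n) -> v n @[n --> \oo] --> +oo.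
Proof.
move=> /cvgryPgt uy uv; apply/cvgryPgt => A; near=> n.
apply: (@lt_le_trans _ _ (u n)); first by near: n; exact: uy.
by apply: uv; near: n; exists n0.
Unshelve. all: by end_near.
Qed.

Lemma lim_pinftyZ (u : nat -> R) (c : R) : 0 < c -> u n @[n --> \oo] --> +oo ->
  c * u n @[n --> \oo] --> +oo.
Proof.
move=> c0 /cvgryPgt uy; apply/cvgryPgt => A.
by have := uy (A / c); apply: filterS => n; rewrite ltr_pdivrMr// mulrC.
Qed.

Lemma lim_zero_le (u v : nat -> R) (n0 : nat) : v n @[n --> \oo] --> (0 : R) ->
  (forall n, (n0 <= n)%N -> `|u n| <= v n) -> u n @[n --> \oo] --> (0 : R).
Proof.
move=> v0 uv; apply/cvgr0Pnorm_lt => eps eps0; near=> n.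
apply: (@le_lt_trans _ _ (v n)); first by apply: uv; near: n; exists n0.
by near: n; exact: near_lim_lt v0 eps0.
Unshelve. all: by end_near.
Qed.

(** With [u] equal to n^-gamma and [N] of order n, the product N u^3 is of order
n^(1 - 3 gamma). The exponent is positive because gamma is below 1/3, so a
large enough power exceeds N^4. *)
Lemma moment_order (gamma kappa : R) : 0 < gamma < 3^-1 -> 0 < kappa ->
  exists q n0, forall n N, (n0 <= n)%N -> (N <= n.+1)%N -> kappa * n.+1%:R <= N%:R ->
    N%:R ^+ 4 <= (N%:R * (n.+1%:R `^ (- gamma)) ^+ 3) ^+ q.
Proof.
move=> /andP[g0 g1] k0.
have s0 : 0 < 1 - 3 * gamma by rewrite subr_gt0 -ltr_pdivlMl// mulr1.
pose q := (Num.truncn (5 / (1 - 3 * gamma))).+1.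
have qs : 5 <= (1 - 3 * gamma) * q%:R.
  by rewrite mulrC -ler_pdivrMr// ltW// truncnS_gt.
exists q, (Num.truncn (kappa ^+ q)^-1) => n N n0n Nn kN.
have a1 : 1 <= n.+1%:R :> R by rewrite ler1n.
have a0 : 0 < n.+1%:R :> R by [].
set a : R := n.+1%:R in a1 a0 kN *.
have ka : 1 <= kappa ^+ q * a.
  rewrite -ler_pdivrMl ?exprn_gt0// mulr1 ltW//.
  by apply: lt_le_trans (truncnS_gt _) _; rewrite ler_nat ltnS.
have step1 : (kappa * a `^ (1 - 3 * gamma)) ^+ q <= (N%:R * (a `^ (- gamma)) ^+ 3) ^+ q.
  rewrite lerXn2r ?nnegrE ?mulr_ge0 ?powR_ge0 ?exprn_ge0 ?(ltW k0) ?powR_ge0//.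
  have -> : a `^ (1 - 3 * gamma) = a * (a `^ (- gamma)) ^+ 3.
    rewrite -powR_mulrn ?powR_ge0// -powRrM -{2}[a]powRr1 ?(ltW a0)//.
    rewrite -powRD; last by apply/implyP => _; rewrite gt_eqF.
    by congr (_ `^ _); ring.
  by rewrite mulrA ler_wpM2r// exprn_ge0// powR_ge0.
apply: le_trans step1; rewrite exprMn -(powR_mulrn q (powR_ge0 a (1 - 3 * gamma))) -powRrM.
have step2 : a ^+ 5 <= a `^ ((1 - 3 * gamma) * q%:R).
  by rewrite -powR_mulrn ?(ltW a0)// ler_powR.
apply: (@le_trans _ _ (kappa ^+ q * a ^+ 5)); last first.
  by rewrite ler_wpM2l// exprn_ge0// ltW.
apply: (@le_trans _ _ (a ^+ 4)).
  by rewrite lerXn2r ?nnegrE ?(ltW a0)// ler_nat.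
by rewrite [a ^+ 5]exprS mulrA -[leLHS]mul1r ler_wpM2r// exprn_ge0// ltW.
Qed.

(** The whole row is one of the windows. *)
Lemma small_averages_mean (N : nat -> nat) (u h : nat -> R) (b : R) (X : nat -> nat -> R) :
  small_averages N u X -> (\forall n \near \oo, (0 < N n)%N) ->
  u n @[n --> \oo] --> (0 : R) -> 0 < b -> (forall n, 0 < h n) ->
  (forall n, u n <= b * h n) ->
  mean (fun i : 'I_(N n) => X n i) / h n @[n --> \oo] --> (0 : R).
Proof.
move=> small Npos ucvg b0 h0 uh; apply/cvgr0Pnorm_le => eps eps0.
pose j := Num.truncn (b / eps).
have jP : b / j.+1%:R <= eps.
  by rewrite ler_pdivrMr// mulrC -ler_pdivrMr// ltW// truncnS_gt.
near=> n.
have N0 : (0 < N n)%N by near: n.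
have N0' : 0 < (N n)%:R :> R by rewrite ltr0n.
have u1 : u n < 1 by near: n; exact: near_lim_lt ucvg ltr01.
have win : forall a b, (a <= b <= N n)%N ->
    (N n)%:R * u n / j.+1%:R <= (b - a)%:R ->
    `|\sum_(a <= i < b) X n i| <= (b - a)%:R * u n / j.+1%:R by near: n; exact: small.
have := win 0 (N n); rewrite leqnn subn0 => /(_ isT) H.
have {H} sumX : `|\sum_(0 <= i < N n) X n i| <= (N n)%:R * u n / j.+1%:R.
  have uj : u n / j.+1%:R <= 1.
    by rewrite ler_pdivrMr ?ltr0n// mul1r (le_trans (ltW u1))// ler1n.
  by apply: H; rewrite -mulrA ger_pMr.
rewrite /mean card_ord -(big_mkord xpredT (fun i => X n i)).
rewrite !normrM !normfV (gtr0_norm (h0 n)) (gtr0_norm N0') ler_pdivrMr// ler_pdivrMl//.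
apply: (le_trans sumX); rewrite -mulrA ler_pM2l//.
apply: (@le_trans _ _ (b / j.+1%:R * h n)); last by rewrite ler_pM2r.
by rewrite mulrAC ler_pM2r ?invr_gt0.
Unshelve. all: by end_near.
Qed.

End power_sequences.

Lemma lim_ereal_sup_range (R : realType) (I : Type) (i0 : I) (F : nat -> I -> R) :
  (forall n i, 0 <= F n i) ->
  (forall eps, 0 < eps -> \forall n \near \oo, forall i, F n i <= eps) ->
  (ereal_sup (range (fun i => (F n i)%:E)) @[n --> \oo] --> 0)%E.
Proof.
move=> F0 Fsmall.
have sup_ge0 n : (0 <= ereal_sup (range (fun i => (F n i)%:E)))%E.
  by apply: ereal_sup_ge; exists (F n i0)%:E; [exists i0|rewrite lee_fin].
have sup_le eps : 0 < eps -> \forall n \near \oo,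
    (ereal_sup (range (fun i => (F n i)%:E)) <= eps%:E)%E.
  move=> eps0; have := Fsmall _ eps0; apply: filterS => n Fn.
  by apply: ub_ereal_sup => _ [i _ <-]; rewrite lee_fin.
have fin : \forall n \near \oo, ereal_sup (range (fun i => (F n i)%:E)) \is a fin_num.
  have := sup_le 1 ltr01; apply: filterS => n le1.
  by rewrite ge0_fin_numE// (le_lt_trans le1)// ltry.
apply/fine_cvgP; split => //.
apply/cvgr0Pnorm_le => eps eps0; near=> n.
have fn : ereal_sup (range (fun i => (F n i)%:E)) \is a fin_num by near: n.
rewrite /= ger0_norm ?fine_ge0// -lee_fin fineK//.
by near: n; exact: sup_le.
Unshelve. all: by end_near.
Qed.

Section two_stage_procedure.
Context {R : realType} (p gamma K : R).
Hypotheses (p01 : 0 < p < 1) (gamma01 : 0 < gamma < 3^-1) (K0 : 0 < K).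
Let n1 := stage1_size p.
Let n2 := stage2_size p.

Definition rate (n : nat) : R := n.+1%:R `^ (- gamma).

(** The maximum keeps the width positive while the first stage is empty. *)
Definition half_width (n : nat) : R := K * (maxn 1 (n1 n))%:R `^ (- gamma).

Let p0 : 0 < p. Proof. by case/andP : p01. Qed.
Let q0 : 0 < 1 - p. Proof. by rewrite subr_gt0; case/andP : p01. Qed.
Let gamma0 : 0 < gamma. Proof. by case/andP : gamma01. Qed.

Lemma rate_gt0 n : 0 < rate n. Proof. exact: powR_gt0. Qed.

Lemma rate_cvg : rate n @[n --> \oo] --> (0 : R).
Proof. exact: powR_zero. Qed.

Lemma half_width_gt0 n : 0 < half_width n.
Proof. by rewrite mulr_gt0// powR_gt0// ltr0n leq_max. Qed.

Lemma rate_le_half_width n : rate n <= K^-1 * half_width n.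
Proof.
rewrite mulrA mulVf ?gt_eqF// mul1r /rate !powRN lef_pV2 ?posrE ?powR_gt0 ?ltr0n ?leq_max//.
apply: ge0_ler_powR; rewrite ?nnegrE ?(ltW gamma0)// ler_nat geq_max /=.
exact: leq_trans (stage1_size_le p01 n) _.
Qed.

Lemma stage_sizes_linear : exists (kappa : R) n0, [/\ 0 < kappa,
  forall n, (n0 <= n)%N -> kappa * n.+1%:R <= (n1 n)%:R &
  forall n, (n0 <= n)%N -> kappa * n.+1%:R <= (n2 n)%:R].
Proof.
pose kappa := Num.min (p / 2) ((1 - p) / 4).
have kappa0 : 0 < kappa by rewrite lt_min !divr_gt0.
exists kappa, (Num.truncn (2 / kappa)).+1; split=> // n nn.
all: have nk : 2 < kappa * n%:R
  by rewrite -ltr_pdivrMl// mulrC; apply: lt_le_trans (truncnS_gt _) _; rewrite ler_nat.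
all: have [k1 k2] : kappa <= p / 2 /\ kappa <= (1 - p) / 4
  by rewrite !ge_min !lexx orbT.
all: have n0 : 0 <= n%:R :> R by [].
all: have e1 := ler_wpM2r n0 k1; have e2 := ler_wpM2r n0 k2.
all: have := q0; have := p0.
- have /andP[lo _] := stage1_size_itv p01 n.
  by move=> p0' q0'; rewrite -natr1; lra.
- have /andP[lo _] := stage2_size_itv p01 n.
  by move=> p0' q0'; rewrite -natr1; lra.
Qed.

Lemma stage2_size_ratio : n%:R / (n2 n)%:R @[n --> \oo] --> 2 / (1 - p).
Proof.
have key : (n2 n)%:R / n%:R - (1 - p) / 2 @[n --> \oo] --> (0 : R).
  apply: (@lim_zero_le _ _ (fun n => 2 * n.+1%:R `^ (- 1)) 1).
    by rewrite -[0](mulr0 2); apply: limM (lim_cst 2) _; exact: powR_zero.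
  move=> n n0; have n0' : 0 < n%:R :> R by rewrite ltr0n.
  rewrite powR_inv1//.
  have -> : (n2 n)%:R / n%:R - (1 - p) / 2 =
      (2 * (n2 n)%:R - n%:R * (1 - p)) / (2 * n%:R) by field; rewrite gt_eqF.
  rewrite normrM normfV (gtr0_norm (_ : 0 < 2 * n%:R)) ?mulr_gt0// ler_pdivrMr ?mulr_gt0//.
  apply: (@le_trans _ _ 1).
    by rewrite ler_norml; have := stage2_size_itv p01 n => /andP[? ?]; apply/andP; split; lra.
  rewrite mulrAC ler_pdivlMr ?ltr0n// mul1r -natr1.
  by have : 1 <= n%:R :> R; [rewrite ler1n|lra].
have lim2 : (n2 n)%:R / n%:R @[n --> \oo] --> (1 - p) / 2.
  have := limD key (lim_cst ((1 - p) / 2)); rewrite add0r.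
  by under eq_fun do rewrite subrK.
have := limV _ lim2; rewrite invf_div; under eq_fun do rewrite invf_div.
by apply; rewrite gt_eqF// divr_gt0.
Qed.

(** The exponent [2^-1 - gamma] is positive. *)
Lemma sqrt_rate_pinfty (N : nat -> nat) (kappa : R) n0 : 0 < kappa ->
  (forall n, (n0 <= n)%N -> kappa * n.+1%:R <= (N n)%:R) ->
  Num.sqrt (N n)%:R * rate n @[n --> \oo] --> +oo.
Proof.
move=> kappa0 hN; have s0 : 0 < 2^-1 - gamma.
  by case/andP: gamma01 => _ g3; rewrite subr_gt0; lra.
apply: (@lim_pinfty_le _ (fun n => Num.sqrt kappa * n.+1%:R `^ (2^-1 - gamma)) _ n0).
  by apply: lim_pinftyZ; [rewrite sqrtr_gt0|exact: powR_pinfty].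
move=> n n0n; rewrite powRD; last by apply/implyP => _; rewrite pnatr_eq0.
rewrite powR12_sqrt// mulrA -sqrtrM ?(ltW kappa0)// ler_wpM2r ?powR_ge0//.
by rewrite ler_sqrt ?hN.
Qed.

Lemma half_width_cvg : half_width n @[n --> \oo] --> (0 : R).
Proof.
have [kappa [n0 [kappa0 h1 _]]] := stage_sizes_linear.
apply: (@lim_zero_le _ _ (fun n => K * kappa `^ (- gamma) * rate n) n0).
  by rewrite -[0](mulr0 (K * kappa `^ (- gamma))); exact: limM (lim_cst _) rate_cvg.
move=> n n0n; rewrite gtr0_norm ?half_width_gt0// /half_width /rate -mulrA ler_pM2l//.
rewrite -powRM ?(ltW kappa0)// !powRN lef_pV2 ?posrE ?powR_gt0 ?mulr_gt0 ?ltr0n ?leq_max//.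
apply: ge0_ler_powR; rewrite ?nnegrE ?mulr_ge0 ?(ltW gamma0) ?(ltW kappa0)//.
by apply: le_trans (h1 n n0n) _; rewrite ler_nat leq_maxr.
Qed.

End two_stage_procedure.

Lemma small_averages_mean_cvg {R : realType} (N : nat -> nat) (u h : nat -> R) (b c : R)
    (X : nat -> nat -> R) :
  small_averages N u (fun n i => X n i - c) -> (\forall n \near \oo, (0 < N n)%N) ->
  u n @[n --> \oo] --> (0 : R) -> 0 < b -> (forall n, 0 < h n) ->
  (forall n, u n <= b * h n) -> h n @[n --> \oo] --> (0 : R) ->
  mean (fun i : 'I_(N n) => X n i) @[n --> \oo] --> c.
Proof.
move=> small Npos ucvg b0 h0 uh hcvg.
have := limM (small_averages_mean small Npos ucvg b0 h0 uh) hcvg; rewrite mulr0 => lim0.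
have := limD lim0 (lim_cst c); rewrite add0r; apply: cvg_trans; apply: near_eq_cvg.
near=> n; have N0 : (0 < N n)%N by near: n.
by rewrite divfK ?gt_eqF// meanB mean_cst ?card_ord// subrK.
Unshelve. all: by end_near.
Qed.

(** * Almost sure convergence of the bootstrap law *)

Section almost_sure_averages.
Context dE (TE : measurableType dE) d (T : measurableType d) (R : realType).
Context (Q : probability TE R) (P : probability T R) (e : {RV Q >-> R}).
Context (eps eps' eps'' : nat -> nat -> {RV P >-> R}) (gamma : R).
Hypothesis hiid : iid_copies e eps eps' eps''.
Hypothesis gamma01 : 0 < gamma < 3^-1.

Lemma ae_small_averages_row (g : R -> R) (j : 'I_3) (N : nat -> nat) (kappa : R) n0 :
  measurable_fun setT g -> has_moments Q (g \o e) -> \int[Q]_w g (e w) = 0 ->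
  0 < kappa -> (forall n, (N n <= n)%N) ->
  (forall n, (n0 <= n)%N -> kappa * n.+1%:R <= (N n)%:R) ->
  {ae P, forall w, small_averages N (rate gamma)
    (fun n i => g (errors eps eps' eps'' (j, n, i) w))}.
Proof.
move=> mg momg mean0 kappa0 Nn Nlarge.
have [q [n0' ord]] := moment_order gamma01 kappa0.
apply: (@ae_small_averages _ _ _ P N (rate gamma)
  (fun n i w => g (errors eps eps' eps'' (j, n, i) w))
  (fun k => \int[Q]_w (`|g (e w)| ^+ k)) kappa q (maxn n0 n0')) => //.
- by move=> n; rewrite geq_max => /andP[n0n _]; exact: Nlarge.
- by move=> n; exact: powR_gt0.
- move=> n; rewrite geq_max => /andP[n0n n0'n]; apply: ord => //.
    exact: leq_trans (Nn n) _.
  exact: Nlarge.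
- by move=> n _; exact: centered_independent_row.
Qed.

End almost_sure_averages.

Theorem theorem3p4 (R : realType)
    (dE : measure_display) (TE : measurableType dE) (Q : probability TE R)
    (d : measure_display) (Omega : measurableType d) (P : probability Omega R)
    (d0 p gamma K sigma : R) (f : R -> R) (x : nat -> nat -> R)
    (e : {RV Q >-> R}) (eps eps' eps'' : nat -> nat -> {RV P >-> R})
    (hd0 : 0 < d0 < 1) (hp : 0 < p < 1) (hK : 0 < K)
    (hgamma : 0 < gamma < 3^-1)
    (hx : forall m, is_design m (x m))
    (he_cont : forall a : R, distribution Q e [set a] = 0%E)
    (he_mean : ('E_Q[e] = 0)%E)
    (hsigma : 0 < sigma) (he_var : ('V_Q[e] = (sigma ^+ 2)%:E)%E)
    (hiid : iid_copies e eps eps' eps'')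
    (hf_meas : measurable_fun [set: R] f)
    (hf : class_F d0 f)
    (hA2 : assumption_A2 x)
    (hA3 : assumption_A3 d0 f)
    (hA4 : assumption_A4 e) :
  let theta0 := f d0 in
  let n1 := stage1_size p in
  let n2 := stage2_size p in
  let dhat n w :=
    dhat1 theta0 (n1 n) (x (n1 n)) (fun i => f (x (n1 n) i) + eps n i w) in
  let L n w := dhat n w - K * (n1 n)%:R `^ (- gamma) in
  let U n w := dhat n w + K * (n1 n)%:R `^ (- gamma) in
  let Y' n w (i : 'I_(n2 n)) := f (L n w) + eps' n i w in
  let Y'' n w (i : 'I_(n2 n)) := f (U n w) + eps'' n i w in
  let C2 := sigma / (derive1 f d0 * Num.sqrt (1 - p)) in
  {ae P, forall w,
    ereal_sup (range (fun t : R =>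
      `|bootstrap_cdf theta0 (L n w) (U n w) n (Y' n w) (Y'' n w) t
        - fine (normal_prob 0 1 [set z | C2 * z <= t])|%:E))
    @[n --> \oo] --> 0%E}.
Proof.
move=> theta0 n1 n2 dhat L U Y' Y'' C2.
have /andP[p0 p1] := hp.
have [[fincr fnear] _] := hf.
have [df f'0 _] := nbhs_singleton fnear.
have mome := assumption_A4_moments hA4.
have mean_e : \int[Q]_w e w = 0 by exact: mean_of_expectation.
have mom2 := has_moments_exp 2%N mome; have mom4 := has_moments_exp 4%N mome.
have var_e := second_moment_of_variance he_mean he_var.
set mu4 := \int[Q]_w (e w ^+ 4).
have [cmom2 cmean2] := has_moments_centered mom2.
have [cmom4 cmean4] := has_moments_centered mom4.
rewrite var_e in cmom2 cmean2.
have [kappa [n0 [kappa0 n1_large n2_large]]] := stage_sizes_linear hp.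
(* The two second-stage families. For them, besides the errors themselves, their
   centered squares and fourth powers are used: they give the sample variances
   and bound the third absolute moments. *)
pose i1 : 'I_3 := Ordinal (isT : (1 < 3)%N); pose i2 : 'I_3 := Ordinal (isT : (2 < 3)%N).
have mX q c : measurable_fun setT (fun z : R => z ^+ q - c).
  by apply: measurable_funB => //; exact: measurable_funX.
have row1 (j : 'I_3) N := ae_small_averages_row hiid hgamma (g := id) j (N := N)
  (@measurable_id _ _ _) mome mean_e kappa0.
have row2 (j : 'I_3) N := ae_small_averages_row hiid hgamma j (N := N)
  (mX 2%N (sigma ^+ 2)) cmom2 cmean2 kappa0.
have row4 (j : 'I_3) N := ae_small_averages_row hiid hgamma j (N := N)
  (mX 4%N mu4) cmom4 cmean4 kappa0.
have n1n := stage1_size_le hp; have n2n := stage2_size_le hp.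
have ae0 := row1 n0 ord0 _ n1n n1_large.
have ae11 := row1 n0 i1 _ n2n n2_large.
have ae21 := row1 n0 i2 _ n2n n2_large.
have ae12 := row2 n0 i1 _ n2n n2_large.
have ae22 := row2 n0 i2 _ n2n n2_large.
have ae14 := row4 n0 i1 _ n2n n2_large.
have ae24 := row4 n0 i2 _ n2n n2_large.
have ae_filter : Filter (nbhs (almost_everywhere P)) by exact: ae_filter_ringOfSetsType.
have ae_and := @filterI _ _ ae_filter.
have all_ae := ae_and _ _ ae0 (ae_and _ _ (ae_and _ _ ae11 ae21)
  (ae_and _ _ (ae_and _ _ ae12 ae22) (ae_and _ _ ae14 ae24))).
apply: filterS all_ae => w [s0 [[s11 s21] [[s12 s22] [s14 s24]]]].
(* From here on the argument is deterministic, for one outcome at which all the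
   window averages are small. *)
pose h := half_width p gamma K.
have h0 n : 0 < h n by exact: half_width_gt0.
have hcvg : h n @[n --> \oo] --> (0 : R) by exact: half_width_cvg.
have ucvg := rate_cvg hgamma.
have uh n : rate gamma n <= K^-1 * h n by exact: rate_le_half_width.
have K1 : 0 < K^-1 by rewrite invr_gt0.
have n2pos : \forall n \near \oo, (0 < n2 n)%N.
  exists n0 => // n n0n; rewrite -(ltr_nat R); apply: lt_le_trans (n2_large n n0n).
  by rewrite mulr_gt0.
(* The first-stage error is o(rate), and the rate is at most a constant times the
   half-width. *)
have dhat_cvg : (dhat n w - d0) / h n @[n --> \oo] --> (0 : R).
  apply/cvgr0Pnorm_le => eta eta0.
  have etaK : 0 < eta * K by rewrite mulr_gt0.
  have := dhat1_rate hx hA2 hd0 fincr df f'0 (rate_gt0 gamma) ucvg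
    (sqrt_rate_pinfty hgamma kappa0 n1_large) s0 etaK.
  apply: filterS => n dn; rewrite normrM normfV (gtr0_norm (h0 n)) ler_pdivrMr//.
  apply: (le_trans dn); apply: le_trans (ler_wpM2l (ltW etaK) (uh n)) _.
  by rewrite mulrA mulfK ?gt_eqF.
have kh : Num.sqrt (n2 n)%:R * h n @[n --> \oo] --> +oo.
  apply: (@lim_pinfty_le _ (fun n => K * (Num.sqrt (n2 n)%:R * rate gamma n)) _ 0).
    exact: lim_pinftyZ hK (sqrt_rate_pinfty hgamma kappa0 n2_large).
  move=> n _; rewrite mulrCA ler_wpM2l ?sqrtr_ge0//.
  by rewrite -ler_pdivlMl.
have avg1 (X : nat -> nat -> R) : X = (fun n i => eps' n i w) \/ X = (fun n i => eps'' n i w) ->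
    mean (fun i : 'I_(n2 n) => X n i ^+ 1) / h n @[n --> \oo] --> (0 : R).
  by case=> ->; [exact: (small_averages_mean s11 n2pos ucvg K1 h0 uh)|
    exact: (small_averages_mean s21 n2pos ucvg K1 h0 uh)].
have avg2 (X : nat -> nat -> R) : X = (fun n i => eps' n i w) \/ X = (fun n i => eps'' n i w) ->
    mean (fun i : 'I_(n2 n) => X n i ^+ 2) @[n --> \oo] --> sigma ^+ 2.
  by case=> ->; [exact: (small_averages_mean_cvg s12 n2pos ucvg K1 h0 uh hcvg)|
    exact: (small_averages_mean_cvg s22 n2pos ucvg K1 h0 uh hcvg)].
have avg4 (X : nat -> nat -> R) : X = (fun n i => eps' n i w) \/ X = (fun n i => eps'' n i w) ->
    mean (fun i : 'I_(n2 n) => X n i ^+ 4) @[n --> \oo] --> mu4.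
  by case=> ->; [exact: (small_averages_mean_cvg s14 n2pos ucvg K1 h0 uh hcvg)|
    exact: (small_averages_mean_cvg s24 n2pos ucvg K1 h0 uh hcvg)].
have lim := bootstrap_cdf_limit df f'0 hsigma hp h0 hcvg dhat_cvg kh
  (stage2_size_ratio hp) avg1 avg2 avg4.
pose error n t := `|bootstrap_cdf theta0 (L n w) (U n w) n (Y' n w) (Y'' n w) t
  - fine (normal_prob 0 1 [set z | C2 * z <= t])|.
refine (@lim_ereal_sup_range R R 0 error _ _) => [n t|delta delta0].
  exact: normr_ge0.
have large : \forall n \near \oo, (n0 <= n)%N by exists n0.
apply: filterS2 large (lim delta delta0) => n n0n near_normal t.
(* The first stage is not empty, so that the maximum in [half_width] is the
   stage-one size. *)
have hE : h n = K * (n1 n)%:R `^ (- gamma).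
  have n1_pos : 0 < (stage1_size p n)%:R :> R.
    by apply: lt_le_trans (n1_large n n0n); rewrite mulr_gt0.
  by rewrite /h /half_width (maxn_idPr _)// -(ltr0n R).
by move: near_normal => /(_ t); rewrite hE.
Qed.
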